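(* Let $0<1/n\ll \varepsilon\ll \xi\ll \gamma,\alpha\ll 1/r$ where $n,r\in\mathbb N$ and $r\ge 3$, and let $T\in\mathcal T_r$. Suppose that $G$ is a digraph on $n$ vertices with $\delta^0(G)\ge (1-1/r-\varepsilon)n$. Further suppose that $G$ does not contain any $\gamma$-independent set of size at least $n/r$, and that if $T=C_3$ then $G$ does not $\alpha$-contain $Ex(n)$. Then $V(G)$ contains a set $M$ with $|M|\le \xi n$ such that $M$ is a $T$-absorbing set for every $W\subseteq V(G)\setminus M$ with $|W|\in r\mathbb N$ and $|W|\le \xi^2 n$.
   Context: Hierarchy notation: $0<a\ll b\ll c$ means the constants are chosen from right to left, each sufficiently small in terms of those to its right (there are increasing functions $f,g$ such that the statement holds whenever $b\le f(c)$ and $a\le g(b)$); longer hierarchies are analogous. A digraph has no loops and at most one edge in each direction between any two vertices. $\delta^0(G)$ is the minimum of the minimum outdegree and minimum indegree. $\mathcal T_r$ is the set of tournaments on $r$ vertices; $C_3$ is the cyclic triangle (directed 3-cycle). For a digraph $G$ on $n$ vertices, $S\subseteq V(G)$ is $\gamma$-independent if $G[S]$ has at most $\gamma n^2$ edges. $Ex(n)$: let $\lfloor n/3\rfloor\le a_1\le a_2\le a_3\le\lceil n/3\rceil$ be integers with $a_1+a_2+a_3=n$, and let $A_1,A_2,A_3$ be disjoint sets of sizes $a_1,a_2,a_3$; $Ex(n)$ is the digraph on $A_1\cup A_2\cup A_3$ in which each $A_i$ induces a complete digraph (all edges in both directions), and $xy$ is an edge whenever $x\in A_i,y\in A_{i+1}$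 (indices mod 3), and there are no other edges. For digraphs $G,H$ on $n$ vertices, $G$ $\alpha$-contains $H$ if there is an isomorphic copy $G'$ of $G$ with $V(G')=V(H)$ and $|E(H)\setminus E(G')|\le \alpha n^2$. A set $S\subseteq V(G)$ is a $T$-absorbing set for $Q\subseteq V(G)$ if both $G[S]$ and $G[S\cup Q]$ contain perfect $T$-packings (collections of vertex-disjoint, not necessarily induced, copies of $T$ covering all vertices). *)

(* Defs.v *)
From HB Require Import structures.
From mathcomp Require Import all_boot all_order all_algebra.
From mathcomp Require Import reals.
From mathcomp Require Import zify.
Set Implicit Arguments.
Unset Strict Implicit.
Unset Printing Implicit Defensive.
Import Order.TTheory GRing.Theory Num.Theory.

Local Open Scope ring_scope.

(* A digraph on the vertex set V is an irreflexive (G : rel V): no loops, and  *)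
(* at most one edge in each direction between two vertices. Irreflexivity is  *)
(* a separate hypothesis wherever it matters.                                 *)

(* The functions that witness a hierarchy: "a << b" in a statement means that *)
(* for some such f the statement holds whenever a <= f b.                     *)
Definition hierarchy_fun (R : realType) (f : R -> R) : Prop :=
  {in Num.pos, forall x, 0 < f x} /\
  {in Num.pos &, {homo f : x y / x < y}}.

Definition outdegree (V : finType) (G : rel V) (x : V) : nat :=
  #|[set y | G x y]|.

Definition indegree (V : finType) (G : rel V) (x : V) : nat :=
  #|[set y | G y x]|.

(* All degrees are at most #|V|, so the default value of the iterated minimum *)
(* only matters when V is empty.                                              *)
Definition min_semidegree (V : finType) (G : rel V) : nat :=
  \big[minn/#|V|]_(x : V) minn (outdegree G x) (indegree G x).

Definition edges_in (V : finType) (G : rel V) (S : {set V}) : {set V * V} :=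
  [set p | [&& p.1 \in S, p.2 \in S & G p.1 p.2]].

Definition gamma_independent (R : realType) (V : finType) (G : rel V)
    (gamma : R) (S : {set V}) : Prop :=
  #|edges_in G S|%:R <= gamma * #|V|%:R ^+ 2.

Definition tournament (V : finType) (T : rel V) : Prop :=
  irreflexive T /\ forall x y : V, x != y -> T x y (+) T y x.

Definition digraph_iso (V W : finType) (G : rel V) (H : rel W) : Prop :=
  exists2 f : V -> W, bijective f & forall x y : V, H (f x) (f y) = G x y.

Definition C3 : rel 'I_3 := fun i j => j == ordS i.

(* The three classes have sizes n %/ 3 <= n.+1 %/ 3 <= n.+2 %/ 3, which are   *)
(* the only nondecreasing integers between the floor and the ceiling of n / 3 *)
(* that sum to n (see Ex_class_sizeP). The class of a vertex is its tag.      *)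
Definition Ex_class_size (n : nat) (i : 'I_3) : nat := ((n + i) %/ 3)%N.

Definition Ex_vertex (n : nat) : finType := {i : 'I_3 & 'I_(Ex_class_size n i)}.

Definition Ex (n : nat) : rel (Ex_vertex n) := fun x y =>
  (x != y) && ((tag y == tag x) || (tag y == ordS (tag x))).

Lemma Ex_class_sizeP (n a1 a2 a3 : nat) :
  [/\ n %/ 3 <= a1, a1 <= a2, a2 <= a3, a3 <= (n + 2) %/ 3
    & a1 + a2 + a3 = n]%N <->
  [/\ a1 = Ex_class_size n (inord 0), a2 = Ex_class_size n (inord 1)
    & a3 = Ex_class_size n (inord 2)].
Proof.
rewrite /Ex_class_size !inordK //; split=> [[*]|[-> -> ->]]; split; lia.
Qed.

(* G alpha-contains H; meant for #|V| = #|W|. *)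
Definition alpha_contains (R : realType) (V W : finType) (alpha : R)
    (G : rel V) (H : rel W) : Prop :=
  exists2 G' : rel W, digraph_iso G G' &
    #|[set p : W * W | H p.1 p.2 && ~~ G' p.1 p.2]|%:R
      <= alpha * #|W|%:R ^+ 2.

(* A copy of T in G, not necessarily induced, given by its embedding. *)
Definition copy (VT V : finType) (T : rel VT) (G : rel V)
    (f : {ffun VT -> V}) : Prop :=
  injective f /\ forall x y : VT, T x y -> G (f x) (f y).

(* G[S] contains a perfect T-packing. *)
Definition has_perfect_packing (VT V : finType) (T : rel VT) (G : rel V)
    (S : {set V}) : Prop :=
  exists P : {set {ffun VT -> V}},
    [/\ forall f, f \in P -> copy T G f,
        forall f g, f \in P -> g \in P -> f != g ->
          [disjoint f @: [set: VT] & g @: [set: VT]]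
      & \bigcup_(f in P) f @: [set: VT] = S].

Definition absorbing (VT V : finType) (T : rel VT) (G : rel V)
    (S Q : {set V}) : Prop :=
  has_perfect_packing T G S /\ has_perfect_packing T G (S :|: Q).

(* Main.v *)
(* Call a set S connecting for x and y if both S + x and S + y have a perfect
   T-packing. If all pairs of vertices have a positive density of connecting sets
   of one bounded size, then every r-set has a positive density of absorbers, and
   disjoint absorbers serving all r-sets are selected greedily.

   Otherwise a maximal bounded family of pairwise unconnected vertices x_1, x_2...
   colours the other vertices: v gets colour i if it is connected to x_i. Vertices
   of one colour are connected, so no two frequent colour patterns of copies of T
   differ in exactly one role, or else two of the x_i would be connected. Fix all
   but the last two roles of a copy, with candidate sets Y and Z of size about
   2n/r. As every vertex has at most about n/r non-neighbours in each direction,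
   either Y and Z are almost monochromatic or both split into two colours with
   classes of size about n/r, matched by complete and by empty pairs. When three
   roles form a transitive triple the second case contradicts the lack of sparse
   sets of size n/r; the only tournament without such a triple is C_3, and there
   it makes G almost contain Ex(n). So the first case holds, and releasing the
   roles one by one shows that almost all of V has a single colour t. This is
   absurd: some x_i with i <> t is connected to many vertices of colour t, hence
   to x_t. *)
Require Import Defs.
From mathcomp Require Import all_boot all_order all_algebra.
From mathcomp Require Import boolp reals zify ring lra.
Set Implicit Arguments.
Unset Strict Implicit.
Unset Printing Implicit Defensive.
Import Order.TTheory GRing.Theory Num.Theory.
Local Open Scope ring_scope.

(** * Densities *)

(** Connectedness is transitive only at a price: passing through a middle vertex or through two
    copies of T enlarges the connecting sets. Hence the maximal family has to be compared across two
    sizes, and the sizes have to be bounded in advance. This is done on a ladder of sizes. Among any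
    [M] vertices two are connected on the lowest rung, so a family that starts as an unconnected
    pair on rung [M] and gains a member with each step down must get stuck. There it is unconnected
    on rung [l.+1], while no larger family is unconnected on rung [l]: maximality creates
    connections on rung [l], and composing them contradicts the first property. Densities are nested
    quantifiers over sequences that may repeat vertices, because these concatenate without loss;
    distinctness is enforced only when the absorbers are selected. The selection serves all n^r
    tuples at once, which costs a number of absorbers of order log n on top of the linear one. The
    logarithm stays below [xi ^+ 2 * n] once n is at least [xi ^- 5], which is the origin of the
    fifth power in the last hierarchy function. *)

Definition converse (V : Type) (E : rel V) : rel V := fun x y => E y x.
Definition corel (V : Type) (E : rel V) : rel V := fun x y => ~~ E x y.
Definition out (V : finType) (E : rel V) (x : V) : {set V} := [set y | E x y].

Section Density.
Variables (R : realType) (V : finType).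
Implicit Types (A B C : {set V}) (E : rel V) (f g : V -> R) (c : R).

Definition dens A : R := #|A|%:R / #|V|%:R.
(** Division is by the order of the whole digraph, not by [#|A|]. So [avg] grows with [A] for
    nonnegative [f], and [edens] is a number of edges over the squared order, whatever the sizes of
    [A] and [B]. *)
Definition avg A f : R := (\sum_(x in A) f x) / #|V|%:R.
Definition edens E A B : R := avg A (fun x => dens (B :&: out E x)).

Lemma dens_ge0 A : 0 <= dens A.
Proof. by rewrite divr_ge0. Qed.

Lemma dens_sub A B : A \subset B -> dens A <= dens B.
Proof.
by move=> sAB; rewrite ler_wpM2r ?invr_ge0 // ler_nat subset_leq_card.
Qed.

Lemma dens_le1 A : dens A <= 1.
Proof.
rewrite /dens; case: (posnP #|V|) => [->|V0]; first by rewrite invr0 mulr0.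
by rewrite ler_pdivrMr ?ltr0n // mul1r ler_nat max_card.
Qed.

Lemma dens0 : dens set0 = 0.
Proof. by rewrite /dens cards0 mul0r. Qed.

Lemma densID B A : dens A = dens (A :&: B) + dens (A :\: B).
Proof. by rewrite /dens -mulrDl -natrD cardsID. Qed.

Lemma densU A B : dens (A :|: B) <= dens A + dens B.
Proof.
rewrite /dens -mulrDl ler_wpM2r ?invr_ge0 // -natrD ler_nat cardsU; exact: leq_subr.
Qed.

Lemma dens_cover A B C : A \subset B :|: C -> dens A <= dens B + dens C.
Proof. by move=> /dens_sub sAB; apply: le_trans sAB (densU _ _). Qed.

Lemma dens_capU A B C : A \subset C -> B \subset C ->
  dens A + dens B <= dens C + dens (A :&: B).
Proof.
move=> sA sB; have sU : A :|: B \subset C by rewrite subUset sA.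
apply: le_trans (_ : dens (A :|: B) + dens (A :&: B) <= _).
  by rewrite /dens -!mulrDl -!natrD cardsUI.
by rewrite lerD2r dens_sub.
Qed.

Lemma dens_disj A B C : A :&: B = set0 -> A \subset C -> B \subset C ->
  dens A + dens B <= dens C.
Proof.
move=> AB sA sB; rewrite /dens -mulrDl ler_wpM2r ?invr_ge0 // -natrD ler_nat.
have := subset_leq_card (_ : A :|: B \subset C).
by rewrite cardsU AB cards0 subn0 subUset sA sB; apply.
Qed.

Lemma dens_gt0 A : 0 < dens A -> exists x, x \in A.
Proof.
have [->|] := set_0Vmem A; first by rewrite dens0 ltxx.
by case=> x xA _; exists x.
Qed.

Lemma avg_le A f g : (forall x, x \in A -> f x <= g x) -> avg A f <= avg A g.
Proof. by move=> fg; rewrite ler_wpM2r ?invr_ge0 // ler_sum. Qed.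

Lemma avg_const A c : avg A (fun=> c) = c * dens A.
Proof. by rewrite /avg sumr_const /dens -[c *+ _]mulr_natr mulrA. Qed.

Lemma avg_sub A B f : A \subset B -> (forall x, 0 <= f x) -> avg A f <= avg B f.
Proof.
move=> sAB f0; rewrite ler_wpM2r ?invr_ge0 //.
rewrite [leRHS](big_setID A) /= (setIidPr sAB) lerDl; exact: sumr_ge0.
Qed.

Lemma avg_ID B A f : avg A f = avg (A :&: B) f + avg (A :\: B) f.
Proof. by rewrite /avg (big_setID B) /= mulrDl. Qed.

Lemma avg_D A f g : avg A (fun x => f x + g x) = avg A f + avg A g.
Proof. by rewrite /avg big_split /= mulrDl. Qed.

Lemma edens_ge0 E A B : 0 <= edens E A B.
Proof. by rewrite divr_ge0 // sumr_ge0 // => x _; apply: dens_ge0. Qed.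

Lemma edens_le E A B c :
  (forall x, x \in A -> dens (B :&: out E x) <= c) -> edens E A B <= c * dens A.
Proof. by move=> h; rewrite -avg_const; apply: avg_le. Qed.

Lemma edens_ge E A B c :
  (forall x, x \in A -> c <= dens (B :&: out E x)) -> c * dens A <= edens E A B.
Proof. by move=> h; rewrite -avg_const; apply: avg_le. Qed.

Lemma edens_sub E A A' B B' : A \subset A' -> B \subset B' ->
  edens E A B <= edens E A' B'.
Proof.
move=> sA sB; apply: le_trans (avg_sub sA _); last by move=> x; apply: dens_ge0.
by apply: avg_le => x _; apply/dens_sub/setSI.
Qed.

Lemma edens_converse E A B : edens E A B = edens (converse E) B A.
Proof.
rewrite /edens /avg /dens /out; congr (_ / _).
rewrite -!mulr_suml; congr (_ / _); rewrite -!natr_sum; congr _%:R.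
under eq_bigr do rewrite -sum1_card.
under [RHS]eq_bigr do rewrite -sum1_card.
rewrite (exchange_big_dep (mem B)) /=; last by move=> x y _ /setIP[].
apply: eq_bigr => y yB; apply: eq_bigl => x; rewrite !inE.
by rewrite yB.
Qed.

Lemma edens_neg E A B : edens E A B + edens (corel E) A B = dens A * dens B.
Proof.
rewrite -avg_D mulrC -avg_const; rewrite /avg; congr (_ / _).
apply: eq_bigr => x _; rewrite [RHS](densID (out E x)); congr (_ + dens _).
by apply/setP=> y; rewrite !inE /corel andbC.
Qed.

Lemma edens_IDr C E A B : edens E A B = edens E A (B :&: C) + edens E A (B :\: C).
Proof.
rewrite -avg_D; rewrite /edens /avg; congr (_ / _); apply: eq_bigr => x _.
rewrite (densID C); congr (dens _ + dens _); apply/setP=> y; rewrite !inE.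
  by case: (E x y); rewrite ?andbF ?andbT.
by case: (E x y); rewrite ?andbF ?andbT.
Qed.

Lemma edens_IDl C E A B : edens E A B = edens E (A :&: C) B + edens E (A :\: C) B.
Proof. exact: avg_ID. Qed.

Lemma edens_le_densl E A B : edens E A B <= dens A.
Proof. by rewrite -[leRHS]mul1r; apply: edens_le => x _; apply: dens_le1. Qed.

Lemma edens_le_densr E A B : edens E A B <= dens B.
Proof. by rewrite edens_converse edens_le_densl. Qed.

Lemma edens_coverr E A B C D : B \subset C :|: D ->
  edens E A B <= edens E A C + edens E A D.
Proof.
move=> sB; rewrite (edens_IDr C) lerD // edens_sub ?subsetIr //.
by rewrite subDset.
Qed.

Lemma edens_coverl E A B C D : A \subset C :|: D ->
  edens E A B <= edens E C B + edens E D B.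
Proof. by move=> sA; rewrite !(edens_converse E _ B) edens_coverr. Qed.

Lemma edens_markov E A B c :
  c * dens [set x in A | c <= dens (B :&: out E x)] <= edens E A B.
Proof.
set A' := [set x in A | _].
apply: le_trans (_ : edens E A' B <= _).
  by apply: edens_ge => x; rewrite inE => /andP[].
by apply: edens_sub => //; apply/subsetP=> x; rewrite inE => /andP[].
Qed.

(** Reverse Markov inequality: vertices outside the displayed set contribute at most [c] altogether,
    the others at most their own density. *)
Lemma edens_rich E A B c : 0 <= c ->
  edens E A B <= dens [set x in A | c <= dens (B :&: out E x)] + c.
Proof.
move=> c0; set A' := [set x in A | _]; rewrite (edens_IDl A').
rewrite lerD //; last first.
  apply: le_trans (edens_le (c := c) _) _; last by rewrite ler_piMr ?dens_le1.
  by move=> x; rewrite !inE => /andP[+ xA]; rewrite xA -ltNge => /ltW.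
apply: le_trans (edens_le_densl _ _ _) (dens_sub _); exact: subsetIr.
Qed.

(* B fills up the out-non-neighbourhoods of A, so no non-edges are left for
   the rest of the vertices. *)
Lemma neg_outside E A B (q e t : R) :
  (forall x, dens (~: out E x) <= q + e) -> 0 <= e <= t ->
  q - t <= dens B -> edens E A B <= t -> edens (corel E) A (~: B) <= 3 * t.
Proof.
move=> deg /andP[e0 et] hB hE.
have hT : edens (corel E) A setT <= (q + e) * dens A.
  apply: edens_le => x _; apply: le_trans (deg x); apply: dens_sub.
  by apply/subsetP=> y; rewrite !inE.
have hID := edens_IDr B (corel E) A setT; rewrite setTI setTD in hID.
have hN := edens_neg E A B.
have a0 := dens_ge0 A; have a1 := dens_le1 A; nra.
Qed.

End Density.

Arguments dens_ge0 {R V}.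
Arguments dens_sub {R V A B}.
Arguments dens_le1 {R V}.
Arguments densID {R V}.
Arguments densU {R V}.
Arguments dens_cover {R V A B C}.
Arguments dens_capU {R V A B C}.
Arguments dens_disj {R V A B C}.
Arguments edens_rich {R V} E A B {c}.
Arguments edens_ge0 {R V}.
Arguments edens_sub {R V} E {A A' B B'}.
Arguments edens_converse {R V}.
Arguments edens_neg {R V}.
Arguments edens_IDr {R V}.
Arguments edens_IDl {R V}.
Arguments edens_le_densl {R V}.
Arguments edens_le_densr {R V}.
Arguments edens_coverr {R V} E A {B C D}.
Arguments edens_coverl {R V} E {A} B {C D}.

(** * Iterated density quantifiers *)

Section Many.
Variables (R : realType) (V : finType).
Implicit Types (A F : {set V}) (d c : R) (P Q : V -> Prop) (k l : nat).

Definition many d P : Prop := d <= dens R [set v | `[< P v >]].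

(** Nested thresholds instead of a count of tuples: each vertex has many choices given the earlier
    ones. Dependent choices then concatenate with the same [d]; only a change in the order of the
    vertices loses density. *)
Fixpoint manyk d k (P : seq V -> Prop) : Prop :=
  if k is k'.+1 then many d (fun v => manyk d k' (fun s => P (v :: s)))
  else P [::].

Lemma many_le d d' P Q :
  d' <= d -> (forall v, P v -> Q v) -> many d P -> many d' Q.
Proof.
move=> dd' PQ h; apply: le_trans dd' _; apply: le_trans h _; apply: dens_sub.
by apply/subsetP=> v; rewrite !inE => /asboolP/PQ/asboolP.
Qed.

Lemma manyk_le d d' k (P Q : seq V -> Prop) : d' <= d ->
  (forall s, size s = k -> P s -> Q s) -> manyk d k P -> manyk d' k Q.
Proof.
move=> dd'; elim: k P Q => [|k IH] P Q PQ /=; first exact: PQ.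
apply: many_le => // v; apply: IH => s sk; apply: PQ; by rewrite /= sk.
Qed.

Lemma many_ex d P : 0 < d -> many d P -> exists v, P v.
Proof.
move=> d0 h; have [|v] := @dens_gt0 R V [set v | `[< P v >]].
  exact: lt_le_trans h.
by rewrite inE => /asboolP; exists v.
Qed.

Lemma manyk_cat d k l (P : seq V -> Prop) (Q : seq V -> seq V -> Prop) :
  manyk d k P -> (forall s, size s = k -> P s -> manyk d l (Q s)) ->
  manyk d (k + l) (fun s => exists s1 s2,
    [/\ s = s1 ++ s2, size s1 = k, P s1 & Q s1 s2]).
Proof.
elim: k P Q => [|k IH] P Q /= hP hQ.
  by apply: manyk_le (hQ [::] erefl hP) => // s _ Qs; exists [::], s.
apply: many_le hP => // v hv; apply: manyk_le (IH _ (fun s => Q (v :: s)) hv _) => //.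
  by move=> _ _ [s1 [s2 [-> <- ? ?]]]; exists (v :: s1), s2.
by move=> s sk Ps; apply: hQ; rewrite //= sk.
Qed.

Lemma many_pigeon (I : finType) d (P : I -> V -> Prop) : 0 < d ->
  many d (fun v => exists i, P i v) -> exists i, many (d / #|I|%:R) (P i).
Proof.
move=> d0 h; have [v [i0 _]] := many_ex d0 h.
have I0 : 0 < #|I|%:R :> R by rewrite ltr0n; apply/card_gt0P; exists i0.
apply: contrapT => no.
have lt i : dens R [set v | `[< P i v >]] < d / #|I|%:R.
  by rewrite ltNge; apply/negP => hi; apply: no; exists i.
suff : dens R [set v | `[< exists i, P i v >]] < d by rewrite ltNge h.
apply: (@le_lt_trans _ _ (\sum_(i : I) dens R [set v | `[< P i v >]])).
  rewrite /dens -mulr_suml ler_wpM2r ?invr_ge0 // -natr_sum ler_nat.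
  apply: leq_trans (_ : (#|\bigcup_(i : I) [set v | `[< P i v >]]| <= _)%N).
    apply/subset_leq_card/subsetP=> u; rewrite inE => /asboolP[i Pi].
    by apply/bigcupP; exists i => //; rewrite inE; apply/asboolP.
  elim/big_rec2: _ => [|i m A _ le]; first by rewrite cards0.
  by rewrite cardsU (leq_trans (leq_subr _ _)) // leq_add2l.
apply: lt_le_trans (_ : \sum_(i : I) d / #|I|%:R <= _).
  by apply: ltr_sum => //; apply/hasP; exists i0 => //; rewrite mem_index_enum.
by rewrite sumr_const -[(_ / _) *+ _]mulr_natr mulfVK ?gt_eqF.
Qed.

(** Double counting: the related pairs have density at least [a * b], and the [z] with too few
    partners account for at most half of it. *)
Lemma many_swap a b c (Q : V -> V -> Prop) : 0 <= a -> c <= a * b / 2 ->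
  many a (fun v => many b (fun z => Q v z)) ->
  many c (fun z => many c (fun v => Q v z)).
Proof.
move=> a0 cab; rewrite {1}/many; set A := [set v | _] => hA.
pose E : rel V := fun v z => `[< Q v z >].
have hE : b * dens R A <= edens R E A setT.
  by apply: edens_ge => v; rewrite inE => /asboolP; rewrite setTI.
pose Z := [set z | `[< many c (fun v => Q v z) >]].
have [b0|b0] := lerP 0 b; last first.
  apply: (@le_trans _ _ 0); last exact: dens_ge0.
  by have := mulr_le0_ge0 (ltW b0) a0; lra.
have : edens R E A setT <= dens R Z + a * b / 2.
  rewrite (edens_IDr Z) lerD //; first by rewrite setTI edens_le_densr.
  rewrite edens_converse; apply: le_trans (edens_le (c := a * b / 2) _) _.
    move=> z; rewrite !inE andbT => /asboolPn/negP; rewrite -ltNge => lt.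
    apply/ltW/(le_lt_trans _ (lt_le_trans lt cab)); apply: dens_sub.
    by apply/subsetP=> v; rewrite !inE => /andP[].
  by rewrite ler_piMr ?dens_le1 // divr_ge0 // mulr_ge0.
move=> hZ; apply: (@le_trans _ _ (dens R Z)); last first.
  by apply: dens_sub; apply/subsetP=> z; rewrite !inE.
have : a * b <= b * dens R A by rewrite mulrC ler_wpM2l.
by move: hZ hE cab; lra.
Qed.

(** Each chosen vertex joins the forbidden set for the later ones, so no choice loses more than
    [dens R F + k / #|V|]. *)
Lemma manyk_avoid d d' k (P : seq V -> Prop) F :
  dens R F + k%:R / #|V|%:R <= d - d' -> manyk d k P ->
  manyk d' k (fun s => [/\ P s, uniq s & [disjoint s & F]]).
Proof.
elim: k P F => [|k IH] P F /= hF hP.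
  by split=> //; rewrite disjoint_subset; apply/subsetP.
have hS : d <= dens R F + dens R ([set v | `[< manyk d k (fun s => P (v :: s)) >]]
  :\: F).
  apply: le_trans hP _; apply: dens_cover; apply/subsetP=> v; rewrite !inE.
  by move->; rewrite andbT orbN.
have k0 : 0 <= k.+1%:R / #|V|%:R :> R by rewrite divr_ge0.
apply: (@le_trans _ _ (dens R ([set v | `[< manyk d k (fun s => P (v :: s)) >]] :\:
  F))).
  by lra.
apply: dens_sub; apply/subsetP=> v; rewrite !inE => /andP[vF /asboolP hv].
apply/asboolP; apply: manyk_le (IH _ (v |: F) _ hv) => //.
  move=> s _ [Ps us dF]; split=> //=.
    by rewrite us andbT; apply/negP => /(disjointFr dF); rewrite !inE eqxx.
  rewrite disjoint_has /= (negbTE vF) /=; apply/hasPn => u us'.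
  by have /negbT := disjointFr dF us'; rewrite !inE negb_or => /andP[].
have : dens R (v |: F) <= 1 / #|V|%:R + dens R F.
  by apply: le_trans (densU _ _) _; rewrite /dens cards1.
have hk : k.+1%:R / #|V|%:R = 1 / #|V|%:R + k%:R / #|V|%:R :> R.
  by rewrite -mulrDl -natr1 addrC.
by move: hF; rewrite hk; lra.
Qed.

End Many.

(** Moves the last vertex to the front by repeated [many_swap]. The constant is fixed before [V], so
    it is uniform over all digraphs. *)
Lemma manyk_swap (R : realType) (a b : R) k :
  0 < a -> 0 < b -> exists2 c : R, 0 < c &
  forall (V : finType) (Q : seq V -> V -> Prop),
    manyk a k (fun s => many b (Q s)) ->
    many c (fun z => manyk c k (fun s => Q s z)).
Proof.
move=> a0 b0; elim: k => [|k [c c0 IH]] /=; first by exists b.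
pose e := Num.min c (a * c / 2); have e0 : 0 < e.
  by rewrite /e lt_min c0 /= divr_gt0 // mulr_gt0.
exists e => // V Q h.
apply: (@many_le _ _ e _ (fun z => many e (fun v => manyk c k (fun s => Q (v :: s)
  z)))) => //.
  move=> z; apply: many_le => // v; apply: manyk_le => //.
  by rewrite /e ge_min lexx.
apply: (@many_swap _ _ a c) (ltW a0) _ _; first by rewrite /e ge_min lexx orbT.
by apply: many_le h => // v; apply: IH.
Qed.

(** * Packings and reachability *)

Ltac perm_count :=
  apply/permP=> ?; rewrite /= ?count_cat /= ?count_cat /= ?count_cat /=; lia.

Section Tiling.
Variables (VT V : finType) (T : rel VT) (G : rel V).
Implicit Types (s us vs : seq V) (x y z : V).

(** Sequences are read as multisets: the copies may overlap as long as multiplicities match. A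
    packing results only for duplicate-free [s], by [tiled_packing]. *)
Definition tiled s : Prop :=
  exists2 fs : seq {ffun VT -> V}, (forall f, f \in fs -> copy T G f)
    & perm_eq s (flatten [seq codom f | f : {ffun VT -> V} <- fs]).

Lemma tiled_nil : tiled [::].
Proof. by exists [::]. Qed.

Lemma tiled_perm s1 s2 : perm_eq s1 s2 -> tiled s1 -> tiled s2.
Proof.
by rewrite perm_sym => p [fs h p']; exists fs => //; apply: perm_trans p p'.
Qed.

Lemma tiled_cat s1 s2 : tiled s1 -> tiled s2 -> tiled (s1 ++ s2).
Proof.
move=> [fs h p] [fs' h' p']; exists (fs ++ fs').
  by move=> f; rewrite mem_cat => /orP[/h|/h'].
by rewrite map_cat flatten_cat perm_cat.
Qed.

Lemma tiled_copy (f : {ffun VT -> V}) : copy T G f -> tiled (codom f).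
Proof.
by move=> h; exists [:: f] => [g|]; rewrite ?inE /= ?cats0 // => /eqP->.
Qed.

Lemma codom_flatten_disjoint (fs : seq {ffun VT -> V}) f g x :
  uniq (flatten [seq codom f | f : {ffun VT -> V} <- fs]) -> f \in fs -> g \in fs ->
  x \in codom f -> x \in codom g -> f = g.
Proof.
elim: fs => //= h fs IH; rewrite cat_uniq => /and3P[_ /hasPn hd u].
have sub k : k \in fs -> x \in codom k -> x \in codom h -> False.
  move=> kfs xk; apply/negP; apply: hd.
  by apply/flattenP; exists (codom k) => //; apply/mapP; exists k.
rewrite !inE => /predU1P[->|ff] /predU1P[->|gg] //.
- by move=> xh xg; case: (sub g).
- by move=> xh xg; case: (sub f).
- exact: IH.
Qed.

Lemma tiled_packing s : uniq s -> tiled s ->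
  has_perfect_packing T G [set x in s].
Proof.
move=> us [fs hfs p]; have uf := us; rewrite (perm_uniq p) in uf.
have imE f : f @: [set: VT] = [set x in codom f].
  apply/setP=> x; rewrite inE; apply/imsetP/codomP.
    by move=> [a _ ->]; exists a.
  by move=> [a ->]; exists a.
exists [set f in fs]; split.
- by move=> f; rewrite inE; apply: hfs.
- move=> f g; rewrite !inE => ff gg; apply: contraNT => /pred0Pn[x /andP[]].
  rewrite /= !imE !inE => xf xg; apply/eqP.
  exact: codom_flatten_disjoint uf ff gg xf xg.
- apply/setP=> x; rewrite inE (perm_mem p); apply/bigcupP/flattenP.
    by move=> [f]; rewrite imE !inE => ff xf; exists (codom f) => //; apply/mapP;
      exists f.
  by move=> [_ /mapP[f ff ->] xf]; exists f; rewrite ?imE inE.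
Qed.

Variable R : realType.
Local Notation r := #|VT|.

(* A set of t * r - 1 vertices that can be tiled together with x as well as
   together with y; many such sets exist. No disjointness is imposed here, as
   manyk_avoid provides it afterwards. *)
Definition reach (d : R) t x y : Prop :=
  manyk d (t * r).-1 (fun s => tiled (x :: s) /\ tiled (y :: s)).

Lemma reach_sym d t x y : reach d t x y -> reach d t y x.
Proof. by apply: manyk_le => // s _ []. Qed.

(** The connecting sequences of the single pairs are chosen one after another; each block serves
    either entry of its own pair. *)
Lemma reach_zip d t us vs : size us = size vs ->
  (forall p, p \in zip us vs -> reach d t p.1 p.2) ->
  manyk d (size us * (t * r).-1) (fun s => tiled (us ++ s) /\ tiled (vs ++ s)).
Proof.
elim: us vs => [|u us IH] [|v vs] //= => [_ _|[sz] h].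
  by split; apply: tiled_nil.
rewrite mulSn; have hs := h (u, v) (mem_head _ _).
have hzip p : p \in zip us vs -> reach d t p.1 p.2.
  by move=> pz; apply: h; rewrite inE pz orbT.
apply: manyk_le (manyk_cat hs (fun _ _ _ => IH vs sz hzip)) => // s _.
move=> [s1 [s2 [-> _ [/= t1 t1'] [t2 t2']]]]; split.
  apply: tiled_perm (tiled_cat t1 t2); perm_count.
apply: tiled_perm (tiled_cat t1' t2'); perm_count.
Qed.

Hypothesis r_gt0 : (0 < r)%N.
Variable d : R.
Hypothesis many_tiled : manyk d r tiled.

Lemma reach_pad1 t x y : (0 < t)%N -> reach d t x y -> reach d t.+1 x y.
Proof.
move=> t0 h; rewrite /reach.
have -> : (t.+1 * r).-1 = ((t * r).-1 + r)%N.
  by rewrite mulSn addnC -!subn1 -addnBAC // muln_gt0 t0.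
apply: manyk_le (manyk_cat h (fun _ _ _ => many_tiled)) => // s _.
by move=> [s1 [s2 [-> _ [t1 t1'] t2]]]; rewrite -!cat_cons; split; apply: tiled_cat.
Qed.

Lemma reach_pad t t' x y : (0 < t <= t')%N -> reach d t x y -> reach d t' x y.
Proof.
move=> /andP[t0 /subnK <-] h; elim: (t' - t)%N => // k; rewrite addSn.
by apply: reach_pad1; rewrite addn_gt0 t0 orbT.
Qed.

(** The middle vertex [z] becomes part of the connecting sequence. Zipping [x, z] against [z, y]
    gives one remainder that completes both. *)
Lemma reach_comp t x y : (0 < t)%N ->
  many d (fun z => reach d t x z /\ reach d t z y) -> reach d (2 * t) x y.
Proof.
move=> t0 h; rewrite /reach.
have -> : (2 * t * r).-1 = (1 + 2 * (t * r).-1)%N.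
  by have : (0 < t * r)%N; rewrite ?muln_gt0 ?t0 // -mulnA; lia.
rewrite [manyk _ _ _]/=; apply: many_le h => // z [xz zy].
have := @reach_zip d t [:: x; z] [:: z; y] erefl; rewrite /= => hz.
apply: manyk_le (hz _) => //.
  move=> s _ [h1 h2]; split=> //.
  by apply: tiled_perm h2; perm_count.
by move=> p; rewrite !inE => /orP[] /eqP ->.
Qed.

(** The connecting sequence is [s ++ s' ++ u], where [u] exchanges [x :: s'] for [y :: s] through r
    + 1 connected pairs. In the presence of [x], the copy [s] stands alone and [u] joins [x :: s'];
    in the presence of [y], the copy [s'] stands alone and [u] joins [y :: s]. The two copies and
    the r + 1 blocks add up to the stated size. *)
Lemma reach_transfer t x y j (P P' : seq V -> Prop) : (0 < t)%N -> (j < r)%N ->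
  manyk d r (fun s => tiled s /\ P s) -> manyk d r (fun s => tiled s /\ P' s) ->
  (forall s s', P s -> P' s' -> forall i, (i < r)%N ->
     if i == j then reach d t x (nth x s i) /\ reach d t (nth x s' i) y
     else reach d t (nth x s' i) (nth x s i)) ->
  reach d (r.+1 * t).+1 x y.
Proof.
move=> t0 jr hP hP' hr; rewrite /reach.
have -> : ((r.+1 * t).+1 * r).-1 = (r + (r + r.+1 * (t * r).-1))%N.
  have : (0 < t * r)%N by rewrite muln_gt0 t0.
  by rewrite mulSn -mulnA; move: (t * r)%N => m; nia.
have key s s' : size s = r -> size s' = r -> P s -> P' s' ->
    manyk d (r.+1 * (t * r).-1) (fun u => tiled (x :: s' ++ u) /\ tiled (y :: s ++
      u)).
  move=> zs zs' Ps Ps'; have hij := hr _ _ Ps Ps'.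
  (* A rearrangement of [y :: s] in which entry [j] of [s] faces [x] and [y] faces entry [j] of
     [s']; all other entries keep their places. *)
  pose vs := nth x s j :: set_nth x s j y.
  have svs : size vs = r.+1.
    by rewrite /vs /= size_set_nth zs; congr _.+1; apply/maxn_idPr.
  have hz : size (x :: s') = size vs by rewrite svs /= zs'.
  have := reach_zip hz; rewrite [size (x :: s')]/= zs'; move=> hzz.
  apply: manyk_le (hzz d t _) => // [u _ [h1 h2]|].
    split=> //; apply: tiled_perm h2; rewrite /vs set_nthE zs jr.
    rewrite -[in X in perm_eq _ X](cat_take_drop j s) (@drop_nth _ x j) ?zs //.
    perm_count.
  move=> p /(nthP (x, x))[[|i]]; rewrite size_zip hz minnn svs /= => ir <-.
    by have := hij j jr; rewrite eqxx => -[].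
  rewrite nth_zip ?size_set_nth ?zs ?zs' /=; last by apply/esym/maxn_idPr.
  rewrite nth_set_nth /=; have := hij i ir.
  by case: eqP => [_ []|].
pose Q s u := exists s' u', [/\ u = s' ++ u',
    tiled s', tiled (x :: s' ++ u') & tiled (y :: s ++ u')].
apply: manyk_le (manyk_cat (Q := Q) hP _) => //.
  move=> _ _ [s [u [-> zs [ts _] [s' [u' [-> ts' t1 t2]]]]]]; split.
    by apply: tiled_perm (tiled_cat t1 ts); perm_count.
  by apply: tiled_perm (tiled_cat t2 ts'); perm_count.
move=> s zs [ts Ps].
apply: manyk_le (manyk_cat hP' (fun s' zs' h => key s s' zs zs' Ps h.2)) => // u _.
by move=> [s' [u' [-> _ [ts' _] [t1 t2]]]]; exists s', u'.
Qed.

End Tiling.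

(** * Partial copies *)

(** Induction on [k]. With enough indices, averaging yields a density [c / 2] of first vertices that
    are usable for at least as many indices as the induction hypothesis needs. It supplies two of
    them at each such vertex, and pigeonhole fixes the pair. *)
Lemma many_two (R : realType) (c : R) k : 0 < c -> exists M (d : R), 0 < d /\
  forall (V : finType) (P : 'I_M -> seq V -> Prop),
    (forall i, manyk c k (P i)) ->
    exists i j, i != j /\ manyk d k (fun s => P i s /\ P j s).
Proof.
move=> c0; elim: k => [|k [M [d [d0 IH]]]].
  exists 2%N, 1; split=> // V P /= h; exists ord0, ord_max; split=> //.
(* With [M <= c / 2 * N], the vertices usable for fewer than [M] indices account for at most half of
   the total [c * N]. *)
pose m := Num.bound (2 * M%:R / c); pose N := m.+1.
have hN : M%:R <= c / 2 * N%:R.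
  have h0 : 0 <= 2 * M%:R / c by rewrite divr_ge0 ?mulr_ge0 // ltW.
  have := archi_boundP h0; rewrite -/m ltr_pdivrMr // => hm.
  by have -> : N%:R = m%:R + 1 :> R; [rewrite natr1 | lra].
pose e := Num.min d (c / 2 / #|{: 'I_N * 'I_N}|%:R).
have e0 : 0 < e.
  by rewrite lt_min d0 !divr_gt0 // ltr0n card_prod !card_ord.
exists N, e; split=> // V P /= h.
pose A i := [set v : V | `[< manyk c k (fun s => P i (v :: s)) >]].
pose I v := [set i | v \in A i].
pose B := [set v | (M <= #|I v|)%N].
have sumA : \sum_i dens R (A i) = avg setT (fun v => #|I v|%:R).
  rewrite /avg /dens -mulr_suml; congr (_ / _); rewrite -!natr_sum; congr _%:R.
  under eq_bigr do rewrite -sum1_card.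
  rewrite (exchange_big_dep predT) //=.
  by apply: eq_big => [v|v _]; rewrite ?inE // -sum1_card; apply: eq_bigl => i;
    rewrite !inE.
have sum_ge : c * N%:R <= \sum_i dens R (A i).
  apply: le_trans (_ : \sum_(i < N) c <= _); last by apply: ler_sum => i _; apply: h.
  by rewrite sumr_const card_ord mulr_natr.
have sum_le : \sum_i dens R (A i) <= N%:R * dens R B + M%:R.
  rewrite sumA (avg_ID B) lerD //.
    rewrite -avg_const; apply: le_trans (_ : avg B (fun=> N%:R) <= _) => //.
    rewrite setTI; apply: avg_le => v _; rewrite ler_nat.
    by rewrite -[leqRHS]card_ord max_card.
  apply: le_trans (_ : avg (setT :\: B) (fun=> M%:R) <= _).
    by apply: avg_le => v; rewrite !inE andbT -ltnNge => /ltnW; rewrite ler_nat.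
  by rewrite avg_const ler_piMr ?dens_le1.
have hB : c / 2 <= dens R B.
  have N0 : 0 < N%:R :> R by rewrite ltr0n.
  by rewrite -(ler_pM2r N0); lra.
have hp : many (c / 2) (fun v : V => exists p : 'I_N * 'I_N, p.1 != p.2 /\
    manyk d k (fun s => P p.1 (v :: s) /\ P p.2 (v :: s))).
  apply: le_trans hB _; apply: dens_sub; apply/subsetP=> v; rewrite !inE => MI.
  apply/asboolP; pose g (i : 'I_M) : 'I_N := enum_val (widen_ord MI i).
  have [i|i [j [ij hij]]] := IH V (fun i s => P (g i) (v :: s)).
    by have := enum_valP (widen_ord MI i); rewrite !inE => /asboolP.
  exists (g i, g j); split=> //=; apply: contra ij => /eqP/enum_val_inj.
  by move=> /(congr1 val)/= /val_inj->.
have c20 : 0 < c / 2 by rewrite divr_gt0.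
have [[i j] hij] := many_pigeon c20 hp.
have [v [/= ij _]] := many_ex (divr_gt0 c20 (ltac:(by rewrite ltr0n card_prod
  !card_ord) : 0 < #|{: 'I_N * 'I_N}|%:R :> R)) hij.
exists i, j; split=> //; apply: many_le hij => [|u [_]].
  by rewrite /e ge_min lexx orbT.
by apply: manyk_le => //; rewrite /e ge_min lexx.
Qed.

Section Copies.
Variables (VT V : finType) (T : rel VT) (G : rel V).
Implicit Types (es todo : seq VT) (s : seq V).

(** In a tournament the failure of [T e e'] for distinct roles means [T e' e], so one test decides
    which edge of [G] is demanded. *)
Definition tadj (e e' : VT) (u v : V) : bool := if T e e' then G u v else G v u.

(* Partial copies of T are stacks: es lists the roles already played, the
   latest first, and s the vertices that play them. *)
Fixpoint cand es s (e : VT) : {set V} :=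
  match es, s with
  | e' :: es', u :: s' => [set v | tadj e' e u v] :&: cand es' s' e
  | _, _ => setT
  end.

Fixpoint pcopy es s : bool :=
  match es, s with
  | e :: es', v :: s' => (v \in cand es' s' e) && pcopy es' s'
  | _, _ => true
  end.

Lemma cand_catl es1 es2 s1 s2 e : size es1 = size s1 ->
  cand (es1 ++ es2) (s1 ++ s2) e = cand es1 s1 e :&: cand es2 s2 e.
Proof.
elim: es1 s1 => [|e1 es1 IH] [|u s1] //= => [_|[sz]]; first by rewrite setTI.
by rewrite IH // setIA.
Qed.

Lemma pcopy_catl es1 es2 s1 s2 : size es1 = size s1 ->
  pcopy (es1 ++ es2) (s1 ++ s2) -> pcopy es1 s1.
Proof.
elim: es1 s1 => [|e1 es1 IH] [|u s1] //= [sz] /andP[].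
by rewrite cand_catl // inE => /andP[-> _] /IH->.
Qed.

Lemma cand_nth es s e v j x0 e0 : size es = size s -> v \in cand es s e ->
  (j < size s)%N -> tadj (nth e0 es j) e (nth x0 s j) v.
Proof.
elim: es s j => [|e1 es IH] [|u s] //= j [sz]; rewrite !inE => /andP[h1 h2].
by case: j => [|j] //= js; apply: IH.
Qed.

Lemma pcopy_nth es s i j x0 e0 : size es = size s -> pcopy es s ->
  (i < j)%N -> (j < size s)%N ->
  tadj (nth e0 es j) (nth e0 es i) (nth x0 s j) (nth x0 s i).
Proof.
elim: es s i j => [|e1 es IH] [|u s] //= i [|j] //= [sz] /andP[h1 h2].
case: i => [|i] /= ij js; first exact: cand_nth sz h1 js.
exact: IH.
Qed.

Hypotheses (tourT : tournament T) (irrG : irreflexive G).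

(** Injectivity is automatic: two roles played by the same vertex are joined by an edge of [T],
    which would become a loop of [G]. *)
Lemma pcopy_tiled es s : uniq es -> size es = #|VT| -> size s = #|VT| ->
  pcopy es s -> tiled T G s.
Proof.
move=> ues ses ss ps.
have [r0|] := posnP #|VT|; first by rewrite (size0nil (etrans ss r0));
  apply: tiled_nil.
move=> r0; have [x0 _] : exists x, x \in s.
  by case: s ss {ps} => [ss|x s _]; [rewrite -ss in r0 | exists x; rewrite mem_head].
have mes e : e \in es.
  have ces : #|es| = #|VT| by rewrite (card_uniqP ues).
  by rewrite (subset_cardP ces (subset_predT _)).
have pes : perm_eq es (enum VT).
  by apply: uniq_perm; rewrite ?enum_uniq // => e; rewrite mes mem_enum.
pose f : {ffun VT -> V} := [ffun e => nth x0 s (index e es)].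
have fE : map f es = s.
  apply: (@eq_from_nth _ x0); rewrite size_map ?ses // => i ir.
  have [e0 _] : exists e0 : VT, true by case/card_gt0P: r0 => e _; exists e.
  by rewrite (nth_map e0) ?ses // ffunE index_uniq ?ses.
apply: tiled_perm (tiled_copy (f := f) _); first by rewrite -fE perm_sym perm_map.
have edge a b : T a b -> G (f a) (f b).
  move=> Tab; have nTba : T b a = false.
    have ab : a != b by apply: contraTneq Tab => ->; rewrite tourT.1.
    by have := tourT.2 a b ab; rewrite Tab; case: (T b a).
  have ia : (index a es < size s)%N by rewrite ss -ses index_mem.
  have ib : (index b es < size s)%N by rewrite ss -ses index_mem.
  have sz : size es = size s by rewrite ss.
  rewrite !ffunE; case: (ltngtP (index a es) (index b es)) => [lt|lt|eqi].
  - by have := pcopy_nth x0 a sz ps lt ib; rewrite !nth_index // /tadj nTba.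
  - by have := pcopy_nth x0 a sz ps lt ia; rewrite !nth_index // /tadj Tab.
  - have eab : a = b by rewrite -(nth_index a (mes a)) eqi nth_index.
    by move: Tab; rewrite eab tourT.1.
split=> // a b fab; apply/eqP/negPn/negP => ab.
move: (tourT.2 a b ab) (edge a b) (edge b a); rewrite fab irrG.
by case: (T a b); case: (T b a) => // _ h1 h2; [have := h1 isT | have := h2 isT].
Qed.

Variables (R : realType) (h : R).
Hypothesis V_gt0 : (0 < #|V|)%N.
Hypothesis degG :
  forall x, dens R (~: out G x) <= h /\ dens R (~: out (converse G) x) <= h.

Lemma tadj_dens e e' u (A : {set V}) :
  dens R A - h <= dens R ([set v | tadj e e' u v] :&: A).
Proof.
have sub E : dens R (~: out E u) <= h -> dens R A - h <= dens R (out E u :&: A).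
  move=> hE; have := densID (R := R) (out E u) A; rewrite setIC.
  by have := dens_sub (R := R) (subsetIr A (~: out E u)); rewrite setDE; lra.
have [h1 h2] := degG u; rewrite /tadj; case: (T e e').
  exact: (sub G).
exact: (sub (converse G)).
Qed.

Lemma densT1 : dens R [set: V] = 1.
Proof. by rewrite /dens cardsT divff // pnatr_eq0 -lt0n. Qed.

Lemma cand_dens es s e : 1 - (size s)%:R * h <= dens R (cand es s e).
Proof.
have [v0 _] : exists v : V, true by case/card_gt0P: V_gt0 => v; exists v.
have h0 : 0 <= h by apply: le_trans (dens_ge0 _) (degG v0).1.
elim: s es => [|u s IH] [|e' es] /=; rewrite ?densT1.
- by rewrite mul0r subr0.
- by rewrite mul0r subr0.
- by rewrite gerBl mulr_ge0.
have := tadj_dens e' e u (cand es s e); have := IH es.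
by rewrite -natr1; lra.
Qed.

Variable c : R.
Hypothesis c_small : (#|VT|.-1)%:R * h <= 1 - c.

Lemma cand_dens_c es s e : (size s < #|VT|)%N -> c <= dens R (cand es s e).
Proof.
move=> sr; have [v0 _] : exists v : V, true by case/card_gt0P: V_gt0 => v; exists v.
have h0 : 0 <= h by apply: le_trans (dens_ge0 _) (degG v0).1.
have : (size s)%:R * h <= (#|VT|.-1)%:R * h by rewrite ler_wpM2r // ler_nat; lia.
by have := cand_dens es s e; move: c_small; lra.
Qed.

Lemma many_copies todo es s : (size s + size todo <= #|VT|)%N ->
  pcopy es s ->
  manyk c (size todo) (fun s' => pcopy (catrev todo es) (catrev s' s)).
Proof.
elim: todo es s => [|e todo IH] es s //= sz ps.
have sr : (size s < #|VT|)%N by rewrite addnS in sz; apply: leq_ltn_trans sz;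
  apply: leq_addr.
apply: le_trans (cand_dens_c es e sr) _; apply: dens_sub.
apply/subsetP=> v; rewrite inE => vc; apply/asboolP; apply: IH => /=.
  by rewrite addSnnS.
by rewrite vc.
Qed.

Hypothesis VT_gt0 : (0 < #|VT|)%N.

Lemma many_tiled : manyk c #|VT| (tiled T G).
Proof.
rewrite cardE; apply: manyk_le (many_copies (todo := enum VT) (es := [::]) (s :=
  [::]) _ _) => //.
  move=> s zs; rewrite !catrevE !cats0 => /pcopy_tiled ht.
  apply: (@tiled_perm _ _ _ _ (rev s)); first by rewrite perm_rev.
  by apply: ht; rewrite ?rev_uniq ?enum_uniq // size_rev ?zs cardE.
by rewrite cardE.
Qed.

(** The role [e] lies at the bottom of the stack, so its vertex [x] can be prescribed and the other
    roles are filled afterwards. *)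
Lemma many_tiled_at (e : VT) : exists rest : seq VT,
  [/\ uniq (e :: rest), size rest = #|VT|.-1,
   (forall x : V, manyk c #|VT|.-1 (fun s => pcopy (rcons (rev rest) e) (rcons (rev
     s) x)))
 & (forall x s, size s = #|VT|.-1 ->
   pcopy (rcons (rev rest) e) (rcons (rev s) x) -> tiled T G (x :: s)) ].
Proof.
pose rest := rem e (enum VT).
have pr : perm_eq (enum VT) (e :: rest) by apply: perm_to_rem; rewrite mem_enum.
have sr : size rest = #|VT|.-1 by rewrite size_rem ?mem_enum // cardE.
exists rest; split=> //; first by rewrite -(perm_uniq pr) enum_uniq.
  move=> x; rewrite -sr.
  apply: manyk_le (many_copies (todo := rest) (es := [:: e]) (s := [:: x]) _ _) => //.
      by move=> s _; rewrite !catrevE !cats1.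
    by rewrite /= sr add1n prednK.
  by rewrite /= inE.
move=> x s zs /pcopy_tiled ht; apply: (@tiled_perm _ _ _ _ (rcons (rev s) x)).
  by rewrite -rev_cons perm_rev.
apply: ht; rewrite ?size_rcons ?size_rev ?zs ?sr ?prednK //.
by rewrite -rev_cons rev_uniq -(perm_uniq pr) enum_uniq.
Qed.

End Copies.

Definition dense_digraph (R : realType) (V : finType) (G : rel V) (h : R) :=
  [/\ (0 < #|V|)%N, irreflexive G & forall x,
    dens R (~: out G x) <= h /\ dens R (~: out (converse G) x) <= h].

(** For size 1 a connecting sequence is a copy of [T] with one vertex removed. Its missing role has
    at least [c] candidates, and swapping moves the replacement for [x] to the front; this gives the
    first claim. For the second one, [many_two] finds two vertices with many common completions. *)
Lemma reach1 (R : realType) r (c : R) : (0 < r)%N -> 0 < c ->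
  exists M (d : R), 0 < d <= c /\
  forall (VT V : finType) (T : rel VT) (G : rel V) (h : R),
    #|VT| = r -> tournament T -> dense_digraph G h -> r.-1%:R * h <= 1 - c ->
    (forall x, many d (fun z => reach T G d 1 x z)) /\
    (forall xs : 'I_M -> V, exists i j, i != j /\ reach T G d 1 (xs i) (xs j)).
Proof.
move=> r0 c0; have [d1 d10 swap] := manyk_swap r.-1 c0 c0.
have [M [d2 [d20 two]]] := many_two r.-1 c0.
pose d := Num.min c (Num.min d1 d2).
have dc : d <= c by rewrite ge_min lexx.
have dd1 : d <= d1 by rewrite !ge_min lexx orbT.
have dd2 : d <= d2 by rewrite !ge_min lexx !orbT.
exists M, d; split; first by rewrite dc !lt_min c0 d10 d20.
move=> VT V T G h VTr tT [V0 irrG degG] hc.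
have [e _] : exists e : VT, true
  by case/card_gt0P: (etrans (congr1 _ VTr) r0) => e; exists e.
have hc' : #|VT|.-1%:R * h <= 1 - c by rewrite VTr.
have r0' : (0 < #|VT|)%N by rewrite VTr.
have [rest [ur sr hx ht]] := many_tiled_at tT irrG V0 degG hc' r0' e.
split=> [x|xs].
  have hs : manyk c r.-1 (fun s => many c (fun z =>
      tiled T G (x :: s) /\ tiled T G (z :: s))).
    have := hx x; rewrite VTr; apply: manyk_le => // s zs ps.
    have szr : size (rev rest) = size (rev s) by rewrite !size_rev sr zs VTr.
    have ps' : pcopy T G (rev rest) (rev s).
      by move: ps; rewrite -!cats1; apply: pcopy_catl.
    apply: le_trans (cand_dens_c T V0 degG hc' (rev rest) e (_ : (size (rev s) <
      _)%N)) _.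
      by rewrite size_rev zs VTr prednK.
    apply: dens_sub; apply/subsetP=> z zc; rewrite inE; apply/asboolP; split.
      by apply: ht => //; rewrite zs VTr.
    apply: (@tiled_perm _ _ _ _ (z :: rev s)); first by rewrite perm_cons perm_rev.
    have urest : uniq (e :: rev rest) /\ size (e :: rev rest) = #|VT|.
      by move: ur; rewrite /= mem_rev rev_uniq size_rev sr prednK.
    case: urest => u1 u2; apply: (pcopy_tiled tT irrG u1 u2) => /=.
      by rewrite size_rev zs prednK.
    by rewrite zc ps'.
  apply: many_le (swap _ _ hs) => // z; rewrite /reach mul1n VTr.
  by apply: manyk_le.
have [i|i [j [ij hij]]] := two V (fun i s => tiled T G (xs i :: s)).
  have := hx (xs i); rewrite VTr; apply: manyk_le => // s zs.
  by apply: ht; rewrite zs VTr.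
exists i, j; split=> //; rewrite /reach mul1n VTr; by apply: manyk_le hij.
Qed.

(** * Colourings of dense bipartite digraphs *)

Section Colours.
Variables (R : realType) (V : finType) (col : V -> nat) (K : nat).
Hypothesis colK : forall v, (col v < K)%N.
Implicit Types (A B X Y Z : {set V}) (E : rel V).
Local Notation dens := (@dens R V).
Local Notation edens := (@edens R V).

Definition col_class t : {set V} := [set v | col v == t].
Local Notation cl := col_class.
Definition mono (th : R) Y : Prop := exists t, dens (Y :\: cl t) <= th.

(** Union bound over the colours for any subadditive set function, shared by [dens] and [edens]. *)
Lemma cols_le (f : {set V} -> R) A c : f set0 <= 0 ->
  (forall X Y Z, X \subset Y :|: Z -> f X <= f Y + f Z) ->
  (forall t, (t < K)%N -> f (A :&: cl t) <= c) -> f A <= K%:R * c.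
Proof.
move=> f0 fU fc.
have step k : (k <= K)%N -> f (A :&: [set v | (col v < k)%N]) <= k%:R * c.
  elim: k => [_|k IH kK].
    by rewrite mul0r (_ : _ :&: _ = set0) //; apply/setP=> v; rewrite !inE andbF.
  have := fU _ _ _ (_ : A :&: [set v | (col v < k.+1)%N] \subset
    A :&: [set v | (col v < k)%N] :|: A :&: cl k).
  have -> : A :&: [set v | (col v < k.+1)%N] \subset
    A :&: [set v | (col v < k)%N] :|: A :&: cl k.
    by apply/subsetP=> v; rewrite !inE ltnS leq_eqVlt orbC; case: (v \in A).
  move=> /(_ isT); have := IH (ltnW kK); have := fc k kK.
  by rewrite -natr1; lra.
have := step K (leqnn K); rewrite (_ : _ :&: _ = A) //.
by apply/setP=> v; rewrite inE [v \in [set _ | _]]inE colK andbT.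
Qed.

Lemma dens_cols A c :
  (forall t, (t < K)%N -> dens (A :&: cl t) <= c) -> dens A <= K%:R * c.
Proof. by apply: cols_le => [|X Y Z]; [rewrite dens0 | apply: dens_cover]. Qed.

Lemma edens_cols E A Z c :
  (forall t, (t < K)%N -> edens E A (Z :&: cl t) <= c) -> edens E A Z <= K%:R * c.
Proof.
apply: (cols_le (f := edens E A)) => [|X Y Z']; last exact: edens_coverr.
by apply: le_trans (edens_le_densr _ _ _) _; rewrite dens0.
Qed.

Lemma edens_other E A Z s c : 0 <= c ->
  (forall t, t <> s -> edens E A (Z :&: cl t) <= c) ->
  edens E A (Z :\: cl s) <= K%:R * c.
Proof.
move=> c0 h; apply: edens_cols => t _; have [->|/eqP ts] := eqVneq t s.
  apply: le_trans (edens_le_densr _ _ _) _; rewrite (_ : _ :&: _ = set0) ?dens0 //.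
  by apply/setP=> v; rewrite !inE; case: eqP; rewrite ?andbF.
by apply: le_trans (h t ts); apply: edens_sub => //; apply/setSI/subsetDl.
Qed.

Lemma big_other A s c th : K%:R * c <= th -> 0 <= c -> th < dens (A :\: cl s) ->
  exists2 t, t <> s & c < dens (A :&: cl t).
Proof.
move=> Kc c0 lt; apply: contrapT => no.
suff : dens (A :\: cl s) <= K%:R * c by lra.
apply: dens_cols => t _; have [->|/eqP ts] := eqVneq t s.
  rewrite (_ : _ :&: _ = set0) ?dens0 //.
  by apply/setP=> v; rewrite !inE; case: eqP; rewrite ?andbF.
apply: le_trans (_ : dens (A :&: cl t) <= _); first by apply/dens_sub/setSI/subsetDl.
by rewrite leNgt; apply/negP=> h; apply: no; exists t.
Qed.

Lemma edens_ge_deg E A W h : (forall y, y \in A -> dens (W :\: out E y) <= h) ->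
  (dens W - h) * dens A <= edens E A W.
Proof.
move=> deg; apply: edens_ge => y /deg; have := densID (R := R) (out E y) W; lra.
Qed.

(** The class of [t] sends few edges to any part of [Z] that avoids its partner colour. By the
    degrees, a part of density above [h + eta] would receive more than [tau * eta]. The same count
    applied to [Z] itself shows that a partner exists. *)
Lemma half_bipartite (F : nat -> nat -> Prop) E Y Z t (h sg tau eta : R) :
  0 < tau -> 0 <= sg -> K%:R * sg <= tau * eta ->
  (forall y, y \in Y -> dens (Z :\: out E y) <= h) ->
  (forall s, ~ F t s -> edens E (Y :&: cl t) (Z :&: cl s) <= sg) ->
  (forall s s', F t s -> F t s' -> s = s') ->
  h + eta < dens Z -> tau <= dens (Y :&: cl t) ->
  exists2 s, F t s & dens (Z :\: cl s) <= h + eta.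
Proof.
move=> tau0 sg0 hs deg nF Ff hZ hY.
have key (W : {set V}) : W \subset Z -> edens E (Y :&: cl t) W <= K%:R * sg ->
  dens W <= h + eta.
  move=> sW hW; rewrite leNgt; apply/negP => lt.
  have : (dens W - h) * dens (Y :&: cl t) <= edens E (Y :&: cl t) W.
    apply: edens_ge_deg => y; rewrite inE => /andP[/deg hy _].
    by apply: le_trans hy; apply/dens_sub/setSD.
  have eta0 : 0 <= eta.
    by rewrite -(pmulr_rge0 _ tau0); apply: le_trans hs; rewrite mulr_ge0.
  have l1 : tau * eta < tau * (dens W - h) by rewrite ltr_pM2l //; lra.
  have l2 : tau * (dens W - h) <= dens (Y :&: cl t) * (dens W - h).
    by rewrite ler_wpM2r //; lra.
  by lra.
have [[s Fs]|no] := pselect (exists s, F t s); last first.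
  suff : dens Z <= h + eta by rewrite leNgt hZ.
  apply: key => //; apply: edens_cols => s _; apply: nF => Fs; apply: no.
  by exists s.
exists s => //; apply: key; first exact: subsetDl.
apply: edens_other => // s' ss'; apply: nF => Fs'; apply: ss'; exact: Ff Fs' Fs.
Qed.

(* The sizes of the two classes are forced: each of them contains almost the
   whole non-neighbourhood of a vertex on the other side. *)
Record two_coloured (th q : R) E Y Z t1 t2 s1 s2 : Prop := TwoColoured {
  tc_t : t1 <> t2;
  tc_s : s1 <> s2;
  tc_Y1 : q - th <= dens (Y :&: cl t1) <= q + th;
  tc_Y2 : q - th <= dens (Y :&: cl t2) <= q + th;
  tc_Z1 : q - th <= dens (Z :&: cl s1) <= q + th;
  tc_Z2 : q - th <= dens (Z :&: cl s2) <= q + th;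
  tc_Y : dens ((Y :\: cl t1) :\: cl t2) <= th;
  tc_Z : dens ((Z :\: cl s1) :\: cl s2) <= th;
  tc_12 : edens E (Y :&: cl t1) (Z :&: cl s2) <= th;
  tc_21 : edens E (Y :&: cl t2) (Z :&: cl s1) <= th
}.

(** [F] is a partial matching of the colours of [Y] with those of [Z], and unmatched classes span
    few edges. Each class that is not tiny leaves at most about [q] of the other side outside its
    partner. As both sides have density about [2 * q] or more, a second matched pair pins all four
    classes to about [q]; without one both sides are almost monochromatic. *)
Lemma bipartite (F : nat -> nat -> Prop) E Y Z (q e sg th : R) :
  (0 < K)%N -> 0 < th -> th <= q / 4 -> 0 <= e <= th / 8 -> 0 <= sg ->
  64 * K%:R ^+ 2 * sg <= th ^+ 2 ->
  (forall y, y \in Y -> dens (Z :\: out E y) <= q + e) ->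
  (forall z, z \in Z -> dens (Y :\: out (converse E) z) <= q + e) ->
  (forall t s, ~ F t s -> edens E (Y :&: cl t) (Z :&: cl s) <= sg) ->
  (forall t s s', F t s -> F t s' -> s = s') ->
  (forall t t' s, F t s -> F t' s -> t = t') ->
  2 * q - th / 8 <= dens Y -> 2 * q - th / 8 <= dens Z ->
  (mono th Y /\ mono th Z) \/
  exists t1 t2 s1 s2, two_coloured th q E Y Z t1 t2 s1 s2.
Proof.
move=> K0 th0 thq e_th sg0 hsg degY degZ nF Ff Fi hY hZ.
have K1 : 1 <= K%:R :> R by rewrite ler1n.
(* All classes of density below [tau] together have density at most [th / 8]. *)
pose tau := th / (8 * K%:R).
have K8 : 0 < 8 * K%:R :> R by lra.
have tau0 : 0 < tau by rewrite divr_gt0.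
have Ktau : K%:R * tau = th / 8 by rewrite /tau; field; lra.
have hs : K%:R * sg <= tau * (th / 8).
  have : K%:R * (K%:R * sg) <= K%:R * (tau * (th / 8)).
    by rewrite [leRHS]mulrA Ktau; lra.
  by rewrite ler_pM2l //; lra.
have tau_le : tau <= th / 8 by rewrite -Ktau ler_peMl // ltW.
have halfY t : tau <= dens (Y :&: cl t) ->
    exists2 s, F t s & dens (Z :\: cl s) <= q + e + th / 8.
  move=> ht; apply: (half_bipartite (Y := Y) (E := E) (t := t) tau0 sg0 hs) => //.
  - by move=> s; apply: nF.
  - by move=> s s'; apply: Ff.
  - by lra.
have halfZ s : tau <= dens (Z :&: cl s) ->
    exists2 t, F t s & dens (Y :\: cl t) <= q + e + th / 8.
  move=> ht; apply: (half_bipartite (F := fun s t => F t s) (Y := Z) (E := converse E)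
    (t := s) tau0 sg0 hs) => //.
  - by move=> t nFt; rewrite -edens_converse; apply: nF.
  - by move=> t t'; apply: Fi.
  - by lra.
have [t1 ht1] : exists t1, tau <= dens (Y :&: cl t1).
  apply: contrapT => no; suff : dens Y <= K%:R * tau by lra.
  apply: dens_cols => t _; rewrite leNgt; apply/negP => /ltW ht; apply: no.
  by exists t.
have [s1 F11 hZ1] := halfY _ ht1.
have [[t2 [s2 [t12 s12 F22 ht2 hs2]]]|no] := pselect (exists t2 s2,
   [/\ t2 <> t1, s2 <> s1, F t2 s2, tau <= dens (Y :&: cl t2)
     & tau <= dens (Z :&: cl s2)]); last first.
  left; split.
    exists t1; rewrite leNgt; apply/negP => lt.
    have Kth : K%:R * tau <= th by lra.
    have [t2 t12 /ltW ht2] := big_other Kth (ltW tau0) lt.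
    have [s2 F22 hZ2] := halfY _ ht2; apply: no; exists t2, s2; split=> //.
      by move=> e12; apply: t12; apply: Fi F11; rewrite -e12.
    by have := densID (R := R) (cl s2) Z; lra.
  exists s1; rewrite leNgt; apply/negP => lt.
  have Kth : K%:R * tau <= th by lra.
  have [s2 s12 /ltW hs2] := big_other Kth (ltW tau0) lt.
  have [t2 F22 hY2] := halfZ _ hs2; apply: no; exists t2, s2; split=> //.
    by move=> e12; apply: s12; apply: Ff F11; rewrite -e12.
  by have := densID (R := R) (cl t2) Y; lra.
(* Once [half_bipartite] has been applied to all four classes, each class is bounded from below by
   the size of its side minus what may lie outside it, and from above because it lies outside the
   other class. *)
have [s2' F22' hZ2] := halfY _ ht2; have {F22'} ? := Ff _ _ _ F22 F22'; subst s2'.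
have hs1 : tau <= dens (Z :&: cl s1) by have := densID (R := R) (cl s1) Z; lra.
have [t1' F11' hY1] := halfZ _ hs1; have {F11'} ? := Fi _ _ _ F11' F11; subst t1'.
have [t2' F22' hY2] := halfZ _ hs2; have {F22'} ? := Fi _ _ _ F22' F22; subst t2'.
have sgth : sg <= th.
  have th1 : th * th <= th by rewrite ler_piMl ?ltW //;
    have := dens_le1 (R := R) Y; lra.
  have K2 : sg <= K%:R ^+ 2 * sg by rewrite ler_peMl // expr_ge1 // ltW // ltr0n.
  by rewrite expr2 in hsg; lra.
have sub A t u : u <> t -> A :&: cl u \subset A :\: cl t.
  move=> ut; apply/subsetP=> v; rewrite !inE => /andP[-> /eqP->].
  by rewrite andbT; apply/eqP.
have rest A t u : u <> t -> dens ((A :\: cl t) :\: cl u) = dens (A :\: cl t) - dens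
  (A :&: cl u).
  move=> ut; rewrite [dens (A :\: cl t)](densID (cl u));
    rewrite (_ : (A :\: cl t) :&: cl u = A :&: cl u).
    by lra.
  apply/setP=> v; rewrite !inE; case: (col v =P u) => [->|_]; rewrite ?andbF //.
  by rewrite !andbT; have -> : (u == t) = false by apply/eqP.
have := densID (R := R) (cl s1) Z; have := densID (R := R) (cl s2) Z.
have := densID (R := R) (cl t1) Y; have := densID (R := R) (cl t2) Y.
have := dens_sub (R := R) (sub Z s1 s2 s12).
have := dens_sub (R := R) (sub Z s2 s1 (nesym s12)).
have := dens_sub (R := R) (sub Y t1 t2 t12).
have := dens_sub (R := R) (sub Y t2 t1 (nesym t12)).
move=> *; right; exists t1, t2, s1, s2; split.
- exact/nesym.
- exact/nesym.
- by apply/andP; split; lra.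
- by apply/andP; split; lra.
- by apply/andP; split; lra.
- by apply/andP; split; lra.
- by rewrite rest //; lra.
- by rewrite rest //; lra.
- apply: le_trans sgth; apply: nF => F12; apply: s12; exact: Ff F12 F11.
- apply: le_trans sgth; apply: nF => F21; apply: s12; exact: Ff F22 F21.
Qed.

(** The fibre of [x] is its neighbourhood in [Y]. The class that fills one fibre has density at
    least about [2 * q], so it meets every other fibre in about [q] or more, and all fibres share
    one colour. The rest of [Y] then receives almost no edges from [X0], although each of its
    vertices has at least [q] in-neighbours there. *)
Lemma mono_fibres E X Y (X0 : {set V}) (q e be th : R) :
  0 < q -> 0 <= th -> 4 * (e + be + th) <= q -> 0 <= e -> 0 <= be ->
  X0 \subset X -> dens (X :\: X0) <= be ->
  3 * q - e <= dens X -> 3 * q - e <= dens Y ->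
  (forall x, x \in X -> dens (Y :\: out E x) <= q + e) ->
  (forall y, y \in Y -> dens (X :\: out (converse E) y) <= q + e) ->
  (forall x, x \in X0 -> mono th (Y :&: out E x)) ->
  exists t, dens (Y :\: cl t) * q <= th.
Proof.
move=> q0 th0 small e0 be0 sX hX0 hX hY degX degY hm.
have hX1 : 3 * q - e - be <= dens X0.
  have := densID (R := R) X0 X; rewrite (setIidPr sX); lra.
have [x0 x0X] : exists x, x \in X0 by apply: (@dens_gt0 R); lra.
have [t ht] := hm _ x0X; exists t.
have big : 2 * q - 2 * e - th <= dens (Y :&: cl t).
  have := densID (R := R) (cl t) (Y :&: out E x0).
  have := dens_sub (R := R) (_ : (Y :&: out E x0) :&: cl t \subset Y :&: cl t).
  rewrite setSI ?subsetIl // => /(_ isT).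
  have := densID (R := R) (out E x0) Y; have := degX x0 (subsetP sX _ x0X); lra.
have all_t x : x \in X0 -> dens ((Y :\: cl t) :&: out E x) <= th.
  move=> xX; have [t' ht'] := hm _ xX; have [tt'|/eqP tt'] := eqVneq t' t.
    by subst t'; rewrite setIDAC.
  exfalso.
  have := dens_sub (R := R) (_ : (Y :&: cl t) :&: out E x \subset (Y :&: out E x)
    :\: cl t').
  have -> : (Y :&: cl t) :&: out E x \subset (Y :&: out E x) :\: cl t'.
    apply/subsetP=> v; rewrite !inE => /andP[/andP[vY /eqP vt] vE].
    by rewrite vY vE vt !andbT; apply/eqP=> tt; apply: tt'.
  move=> /(_ isT).
  have := densID (R := R) (out E x) (Y :&: cl t).
  have := degX x (subsetP sX _ xX).
  have := dens_sub (R := R) (setSD (out E x) (subsetIl Y (cl t))).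
  by lra.
have h1 : edens E X0 (Y :\: cl t) <= th * dens X0 by apply: edens_le.
have h2 : (dens X0 - (q + e)) * dens (Y :\: cl t) <= edens E X0 (Y :\: cl t).
  rewrite edens_converse; apply: edens_ge_deg => y; rewrite inE => /andP[_ yY].
  by apply: le_trans (degY y yY); apply/dens_sub/setSD.
have := dens_le1 (R := R) X0; have := dens_ge0 (R := R) X0.
have := dens_ge0 (R := R) (Y :\: cl t); nra.
Qed.

End Colours.

(** * Transitive triples *)

(** [lh_noindep] is a robust form of the absence of sparse sets, valid for sets slightly smaller
    than [q]. The cubic bound on [th] is forced by [two_coloured_absurd], where [th] edges are
    divided by a degree [m / 16] and must stay below a fraction of [m ^+ 2]. *)
Record leaf_hyps (R : realType) (V : finType) (G : rel V) (q m th : R) : Prop :=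
  LeafHyps {
  lh_m0 : 0 < m;
  lh_mq : m <= q;
  lh_q1 : 3 * q <= 1;
  lh_th0 : 0 < th;
  lh_thm : 3000 * th <= m ^+ 3;
  lh_out : forall x, dens R (~: out G x) <= q + th;
  lh_in : forall x, dens R (~: out (converse G) x) <= q + th;
  lh_noindep : forall D : {set V}, q - m / 8 <= dens R D -> m / 2 <= edens R G D D
}.

Lemma leaf_deg_out (R : realType) (V : finType) (G : rel V) (q m th : R) (A : {set
  V}) x :
  leaf_hyps G q m th -> dens R (A :\: out G x) <= q + th.
Proof.
by move=> H; apply: le_trans (lh_out H x); rewrite setDE; apply/dens_sub/subsetIr.
Qed.

Lemma leaf_deg_in (R : realType) (V : finType) (G : rel V) (q m th : R) (A : {set
  V}) x :
  leaf_hyps G q m th -> dens R (A :\: out (converse G) x) <= q + th.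
Proof.
by move=> H; apply: le_trans (lh_in H x); rewrite setDE; apply/dens_sub/subsetIr.
Qed.

Lemma leaf_small (R : realType) (V : finType) (G : rel V) (q m th : R) : leaf_hyps
  G q m th ->
  [/\ 0 < q, 3 * m <= 1, 4000 * th <= m ^+ 2 & 4000 * th <= m].
Proof.
case=> m0 mq q1 th0 thm _ _ _; have m3 : 3 * m <= 1 by lra.
have h2 : m ^+ 2 * (3 * m) <= m ^+ 2 * 1 by rewrite ler_wpM2l // exprn_ge0 // ltW.
have th_m2 : 4000 * th <= m ^+ 2 by have := exprSr m 2; lra.
have h1 : m * (3 * m) <= m * 1 by rewrite ler_wpM2l // ltW.
by split => //; [lra | have := expr2 m; lra].
Qed.

(* The common non-neighbourhood D of x0 in Y and Z has size about q n, so it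
   spans edges. This excludes that a vertex x seeing enough of D is two-coloured,
   as some vertex of D would miss fewer than q n vertices of Z. So all these x
   have one and the same colour on D, and they miss one of the two classes of
   x0, which contradicts the indegrees of that class. *)
Lemma two_coloured_absurd (R : realType) (V : finType) (G : rel V) (col : V -> nat)
    (q m th : R) (X Y Z X0 : {set V}) x0 t1 t2 s1 s2 :
  leaf_hyps G q m th ->
  X0 \subset X -> dens R (X :\: X0) <= th ->
  3 * q - th <= dens R X -> 3 * q - th <= dens R Y -> 3 * q - th <= dens R Z ->
  (forall x, x \in X0 ->
    (mono col th (Y :&: out G x) /\ mono col th (Z :&: out G x)) \/
    exists t1 t2 s1 s2,
      two_coloured col th q G (Y :&: out G x) (Z :&: out G x) t1 t2 s1 s2) ->
  x0 \in X0 ->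
  two_coloured col th q G (Y :&: out G x0) (Z :&: out G x0) t1 t2 s1 s2 -> False.
Proof.
move=> H X0X lX0 lX lY lZ dichotomy.
have [m0' mq' q1' th0' thm' outG inG noindep] := H.
have [hq hm3 hth2 hth] := leaf_small H.
move=> x0X [t12 s12].
set Y1 := _ :&: col_class col t1; set Y2 := _ :&: col_class col t2.
set Z1 := _ :&: col_class col s1; set Z2 := _ :&: col_class col s2.
move=> /andP[Y1l Y1u] /andP[Y2l Y2u] /andP[Z1l Z1u] /andP[Z2l Z2u] Yr Zr e12 e21.
pose D := (Y :\: out G x0) :&: (Z :\: out G x0).
have sum3 (A : {set V}) t u : dens R A <= dens R (A :&: col_class col t) + dens R
  (A :&: col_class col u) +
    dens R ((A :\: col_class col t) :\: col_class col u).
  rewrite (densID (col_class col t) A) (densID (col_class col u) (A :\: col_class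
    col t)).
  have := dens_sub (R := R) (_ : (A :\: col_class col t) :&: col_class col u
    \subset A :&: col_class col u).
  by rewrite setSI ?subsetDl // => /(_ isT); clear; lra.
have Dq : q - 9 * th <= dens R D.
  have hY := densID (R := R) (out G x0) Y; have hZ := densID (R := R) (out G x0) Z.
  have hY' := sum3 (Y :&: out G x0) t1 t2; have hZ' := sum3 (Z :&: out G x0) s1 s2.
  have sub (A : {set V}) : A :\: out G x0 \subset ~: out G x0
    by rewrite setDE subsetIr.
  have := dens_capU (R := R) (sub Y) (sub Z); have := outG x0.
  move: hY hZ hY' hZ' Y1u Y2u Z1u Z2u Yr Zr lY lZ.
  by rewrite -/D -/Y1 -/Y2 -/Z1 -/Z2; clear; lra.
have eD : m / 2 <= edens R G D D by apply: noindep; move: Dq hth th0'; clear; lra.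
pose D1 := [set d in D | m / 4 <= dens R (D :&: out G d)].
have D1l : m / 4 <= dens R D1.
  have m4 : 0 <= m / 4 by move: m0'; clear; lra.
  by move: eD (edens_rich G D D m4); rewrite -/D1; clear; lra.
have D_Y (A : {set V}) : A \subset out G x0 -> D :&: A = set0.
  move=> /subsetP sA; apply/setP=> v; rewrite !inE.
  by apply/negbTE/negP => /andP[/andP[/andP[nv _] _] /sA]; rewrite inE (negbTE nv).
have sY1 : Y1 \subset out G x0 by apply: subset_trans (subsetIl _ _) (subsetIr _ _).
have sY2 : Y2 \subset out G x0 by apply: subset_trans (subsetIl _ _) (subsetIr _ _).
(* The class [Yi] sends few edges to [Zi], so it uses up the missing indegree of most of [Zi]; [D]
   is disjoint from [Yi] and is therefore almost completely joined to [Zi]. *)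
have neD (Yi Zi : {set V}) : Yi \subset out G x0 -> q - th <= dens R Yi ->
  edens R G Yi Zi <= th ->
    edens R (corel G) D Zi <= 3 * th.
  move=> sYi Yil e; have := @neg_outside R V (converse G) Zi Yi q th th inG _ Yil.
  rewrite -edens_converse => /(_ ltac:(by rewrite ltW //= lexx) e).
  rewrite edens_converse; apply: le_trans; apply: edens_sub => //.
  apply/subsetP=> v vD; rewrite inE; apply/negP => vY.
  by have /setP/(_ v) := D_Y _ sYi; rewrite in_setI vD vY inE.
have neD1 := neD _ _ sY2 Y2l e21; have neD2 := neD _ _ sY1 Y1l e12.
pose rho := m / 32.
pose bad (Zi : {set V}) := [set d in D | rho <= dens R (Zi :&: out (corel G) d)].
have badl (Zi : {set V}) : edens R (corel G) D Zi <= 3 * th ->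
  dens R (bad Zi) <= m / 32.
  move=> e; have := @edens_markov R V (corel G) D Zi rho; rewrite -/(bad Zi) => mk.
  have : rho * dens R (bad Zi) <= rho * (m / 32).
    by move: mk e hth2 th0'; rewrite /rho; clear; lra.
  by rewrite ler_pM2l // /rho; move: m0'; clear; lra.
pose D2 := (D1 :\: bad Z1) :\: bad Z2.
have D2l : m / 8 <= dens R D2.
  have := dens_cover (R := R) (_ : D1 \subset D2 :|: (bad Z1 :|: bad Z2)).
  have -> : D1 \subset D2 :|: (bad Z1 :|: bad Z2).
    by apply/subsetP=> v vD; rewrite /D2 in_setU in_setD in_setD vD in_setU;
      do 2!case: (v \in bad _).
  have := densU (R := R) (bad Z1) (bad Z2); have := badl _ neD1; have := badl _ neD2.
  by move=> + + + /(_ isT); move: D1l m0'; clear; lra.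
(* Such a [d] sees almost all of the two classes in the neighbourhood of [x0]; outside that
   neighbourhood [Z] has density at most about [q], of which [d] sees [m / 4] inside [D]. *)
have D2deg d : d \in D2 -> dens R (Z :\: out G d) <= q - m / 8.
  rewrite /D2 in_setD in_setD => /and3P[n2 n1 dD1].
  have [dD dl] : d \in D /\ m / 4 <= dens R (D :&: out G d) by move: dD1;
    rewrite inE => /andP[].
  have small (Zi : {set V}) : d \notin bad Zi -> dens R (Zi :\: out G d) <= rho.
    rewrite inE dD /= -ltNge => /ltW; congr (_ <= _); congr dens.
    by apply/setP=> v; rewrite !inE /corel andbC.
  pose Z3 := Z :\: out G x0; pose Zx := Z :&: out G x0.
  have h3 : dens R (Z3 :\: out G d) <= q + th - m / 4.
    have := leaf_deg_out Z x0 H; rewrite -/Z3 (densID (out G d) Z3).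
    have := dens_sub (R := R) (setSI (out G d) (subsetIr (Y :\: out G x0) Z3)).
    by rewrite -/D; move: dl; clear; lra.
  have hx : dens R (Zx :\: out G d) <= rho + rho + th.
    apply: le_trans (_ : dens R ((Z1 :\: out G d) :|: (Z2 :\: out G d)) + th <= _);
      last first.
      by rewrite lerD2r; apply: le_trans (densU _ _) _; rewrite lerD ?small.
    apply: le_trans (_ : dens R ((Z1 :\: out G d) :|: (Z2 :\: out G d)) +
      dens R ((Zx :\: col_class col s1) :\: col_class col s2) <= _); last first.
      by rewrite lerD2l.
    apply: dens_cover; apply/subsetP=> v; rewrite !inE.
    by do !case: (_ \in _); do !case: (_ == _); case: (G _ _); case: (G _ _).
  have := dens_cover (R := R) (_ : Z :\: out G d \subset (Zx :\: out G d) :|: (Z3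
    :\: out G d)).
  have -> : Z :\: out G d \subset (Zx :\: out G d) :|: (Z3 :\: out G d).
    by apply/subsetP=> v; rewrite !inE; case: (v \in Z); case: (G x0 v);
      case: (G d v).
  by move=> /(_ isT); move: h3 hx hth th0'; rewrite /rho; clear; lra.
pose lam := m ^+ 2 / 64.
have lam0 : 0 < lam by rewrite divr_gt0 // exprn_gt0.
(* If [x] were two-coloured, a vertex of [D2] in one of its classes would see at least [m / 16] of a
   class to which that class sends few edges. So [D2] would hardly meet the neighbourhood of [x]. *)
have D2_mono x : x \in X0 -> lam <= dens R (D2 :&: out G x) ->
    mono col th (Y :&: out G x).
  move=> xX hx; have [[] //|[u1 [u2 [v1 [v2 [_ _ _ _ V1 V2 Yr' _ f12 f21]]]]]] :=
    dichotomy _ xX.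
  exfalso.
  have few (Yi Zi : {set V}) : q - th <= dens R Zi -> Zi \subset Z ->
    edens R G Yi Zi <= th ->
      dens R (D2 :&: Yi) <= m ^+ 2 / 150.
    move=> hZi sZ e.
    have hm : m / 16 * dens R (D2 :&: Yi) <= edens R G (D2 :&: Yi) Zi.
      apply: edens_ge => d; rewrite inE => /andP[/D2deg hd _].
      have := densID (R := R) (out G d) Zi;
        have := dens_sub (R := R) (setSD (out G d) sZ).
      by move: hd hZi hth th0'; clear; lra.
    have := edens_sub (R := R) G (subsetIr D2 Yi) (subxx Zi) => hs.
    have : m / 16 * dens R (D2 :&: Yi) <= m / 16 * (m ^+ 2 / 150).
      by move: hm hs e thm' th0'; rewrite [m ^+ 3]exprS; clear; lra.
    by rewrite ler_pM2l //; move: m0'; clear; lra.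
  have sZ v : (Z :&: out G x) :&: col_class col v \subset Z.
    by apply: subset_trans (subsetIl _ _) (subsetIl _ _).
  have a1 := few _ _ (proj1 (andP V2)) (sZ _) f12.
  have a2 := few _ _ (proj1 (andP V1)) (sZ _) f21.
  pose P1 := (Y :&: out G x) :&: col_class col u1;
    pose P2 := (Y :&: out G x) :&: col_class col u2.
  pose P3 := ((Y :&: out G x) :\: col_class col u1) :\: col_class col u2.
  have : dens R (D2 :&: out G x) <= dens R ((D2 :&: P1) :|: (D2 :&: P2)) + dens R P3.
    apply: dens_cover; apply/subsetP=> w; rewrite in_setI => /andP[wD wx].
    have wY : w \in Y.
      by move: wD; rewrite in_setD in_setD => /and3P[_ _]; rewrite inE => /andP[];
        rewrite !inE => /andP[/andP[]].
    rewrite in_setU in_setU in_setI in_setI wD /= /P1 /P2 /P3 !(in_setI,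
      in_setD) wY wx /=.
    by case: (w \in col_class col u1); case: (w \in col_class col u2).
  have := densU (R := R) (D2 :&: P1) (D2 :&: P2).
  by move: Yr' a1 a2 hx hth2 th0'; rewrite -/P3 /lam; clear; lra.
pose X1 := [set x in X0 | lam <= dens R (D2 :&: out G x)].
(* The vertices of [X0] that see little of [D2] have density at most about [q], by the indegrees of
   [D2]. *)
have X1l : 2 * q - 3 * th - m / 8 <= dens R X1.
  pose Xb := X0 :\: X1.
  have hb : dens R Xb <= q + th + m / 8.
    rewrite leNgt; apply/negP => lt.
    have h1 : edens R G Xb D2 <= lam.
      apply: le_trans (edens_le (c := lam) _) _;
        last by rewrite ler_piMr ?dens_le1 // ltW.
      by move=> x; rewrite !inE => /andP[+ xX]; rewrite xX /= -ltNge => /ltW.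
    have h2 : (dens R Xb - (q + th)) * dens R D2 <= edens R G Xb D2.
      by rewrite edens_converse; apply: edens_ge_deg => y _; apply: leaf_deg_in H.
    have D20 : 0 < dens R D2 by move: D2l m0'; clear; lra.
    have l1 : m / 8 * dens R D2 < (dens R Xb - (q + th)) * dens R D2.
      by rewrite ltr_pM2r //; move: lt; clear; lra.
    have l2 : m / 8 * (m / 8) <= m / 8 * dens R D2.
      by rewrite ler_pM2l //; move: m0'; clear; lra.
    by move: h1 h2 l1 l2; rewrite /lam; clear; lra.
  have := densID (R := R) X1 X0; have -> : X0 :&: X1 = X1.
    by apply/setIidPr/subsetP=> x; rewrite inE => /andP[].
  have := densID (R := R) X0 X; rewrite (setIidPr X0X) -/Xb.
  by move: hb lX lX0; clear; lra.
have miss x t' ti : dens R ((Y :&: out G x) :\: col_class col t') <= th ->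
    t' <> ti -> dens R (((Y :&: out G x0) :&: col_class col ti) :&: out G x) <= th.
  move=> hx tt; apply: le_trans hx; apply: dens_sub; apply/subsetP=> v.
  rewrite !inE => /andP[/andP[/andP[vY _] /eqP vt] vx].
  by rewrite vY vx vt !andbT; apply/eqP => e; apply: tt.
(* At least one of the two classes of [x0] has a colour other than [t']. Missing nearly all of it
   uses up the non-neighbours of [x], so [x] sees almost all of [D], which thus has colour [t']. *)
have Dcol x t' : dens R ((Y :&: out G x) :\: col_class col t') <= th ->
    dens R (D :\: col_class col t') <= 4 * th.
  move=> hx.
  have key ti : t' <> ti -> q - th <= dens R ((Y :&: out G x0) :&: col_class col
    ti) ->
      dens R (D :\: col_class col t') <= 4 * th.
    move=> /(miss _ _ _ hx); set Yi := _ :&: col_class col ti => hm Yil.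
    have sYi : Yi \subset out G x0
      by apply: subset_trans (subsetIl _ _) (subsetIr _ _).
    have dis : (D :\: out G x) :&: (Yi :\: out G x) = set0.
      apply/setP=> v; rewrite in_setI !in_setD [in RHS]inE.
      by have /setP/(_ v) := D_Y _ sYi; rewrite in_setI in_set0; case: (v \in D);
        case: (v \in Yi); rewrite ?andbF.
    have sC (A : {set V}) : A :\: out G x \subset ~: out G x
      by rewrite setDE subsetIr.
    have := dens_disj (R := R) dis (sC _) (sC _).
    have := densID (R := R) (out G x) Yi; have := outG x.
    have := dens_cover (R := R) (_ : D :\: col_class col t' \subset
      (Y :&: out G x) :\: col_class col t' :|: D :\: out G x).
    have -> : D :\: col_class col t' \subset
      (Y :&: out G x) :\: col_class col t' :|: D :\: out G x.
      apply/subsetP=> v; rewrite /D !inE => /andP[-> /andP[/andP[-> ->] /andP[_ ->]]].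
      by case: (G x v).
    by move=> /(_ isT); move: hm Yil hx; clear; lra.
  have [e|/eqP n] := eqVneq t' t1; last exact: key n Y1l.
  by apply: key Y2l; rewrite e.
have [x1 x1X] : exists x, x \in X1.
  by apply: (@dens_gt0 R); move: X1l hq mq' hth th0'; clear; lra.
have X1mono x : x \in X1 -> mono col th (Y :&: out G x).
  by rewrite inE => /andP[xX hx]; apply: D2_mono.
have [t ht] := X1mono _ x1X.
have all_t x : x \in X1 -> dens R ((Y :&: out G x) :\: col_class col t) <= th.
  move=> /X1mono[t' ht']; have [<- //|/eqP tt] := eqVneq t' t; exfalso.
  have := dens_cover (R := R) (_ : D \subset (D :\: col_class col t) :|: (D :\:
    col_class col t')).
  have -> : D \subset (D :\: col_class col t) :|: (D :\: col_class col t').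
    apply/subsetP=> v vD; rewrite in_setU !in_setD vD !inE !andbT -negb_and.
    by apply/negP => /andP[/eqP e1 /eqP e2]; apply: tt; rewrite -e1 -e2.
  move=> /(_ isT); have := Dcol _ _ ht; have := Dcol _ _ ht'.
  by move: Dq hq mq' hth th0'; clear; lra.
(* All of [X1], of density nearly [2 * q], would miss almost the whole class of [ti], whose vertices
   lack only about [q] in-neighbours. *)
have fin ti : t <> ti -> q - th <= dens R ((Y :&: out G x0) :&: col_class col ti)
  -> False.
  set Yi := _ :&: _ => tti Yil.
  have h1 : edens R G X1 Yi <= th.
    apply: le_trans (edens_le (c := th) _) _;
      last by rewrite ler_piMr ?dens_le1 // ltW.
    by move=> x /all_t hx; apply: miss hx tti.
  have h2 : (dens R X1 - (q + th)) * dens R Yi <= edens R G X1 Yi.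
    by rewrite edens_converse; apply: edens_ge_deg => y _; apply: leaf_deg_in H.
  have h3 : (q / 2) * (q / 2) <= (dens R X1 - (q + th)) * dens R Yi.
    by apply: ler_pM; move: X1l Yil hq mq' hth th0'; clear; lra.
  have h4 : m * m <= q * q by apply: ler_pM => //; apply/ltW.
  by move: h1 h2 h3 h4 hth2 th0'; clear; lra.
have [e|/eqP n] := eqVneq t t1; last exact: fin n Y1l.
by apply: fin Y2l; rewrite e.
Qed.

Lemma leaf_transitive (R : realType) (V : finType) (G : rel V) (col : V -> nat)
    (q m th : R) (X Y Z X0 : {set V}) :
  leaf_hyps G q m th ->
  X0 \subset X -> dens R (X :\: X0) <= th ->
  3 * q - th <= dens R X -> 3 * q - th <= dens R Y -> 3 * q - th <= dens R Z ->
  (forall x, x \in X0 ->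
    (mono col th (Y :&: out G x) /\ mono col th (Z :&: out G x)) \/
    exists t1 t2 s1 s2,
      two_coloured col th q G (Y :&: out G x) (Z :&: out G x) t1 t2 s1 s2) ->
  exists t, dens R (Y :\: col_class col t) * q <= th.
Proof.
move=> H sX lX0 lX lY lZ dich.
have [q0 m3 th_m2 th_m] := leaf_small H.
have th0 := lh_th0 H; have mq := lh_mq H.
apply: (@mono_fibres _ _ _ G X Y X0 q th th th) => //; try exact: ltW.
- by move: th0 mq th_m; clear; lra.
- by move=> x _; apply: leaf_deg_out H.
- by move=> y _; apply: leaf_deg_in H.
- move=> x xX; have [[] //|[t1 [t2 [s1 [s2 tc]]]]] := dich x xX.
  by case: (two_coloured_absurd H sX lX0 lX lY lZ dich xX tc).
Qed.

(** Greedy choice: after discarding [B] and the vertices with many missing edges in a required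
    direction, each of the three choices still has density at least [l / 8]. *)
Lemma many_triangles (R : realType) (V : finType) (G : rel V) (A1 A2 A3 B : {set V})
    (l eta d : R) :
  0 < l -> 64 * eta <= l ^+ 2 -> dens R B <= l / 8 -> d <= l / 8 ->
  l <= dens R A1 -> l <= dens R A2 -> l <= dens R A3 ->
  edens R (corel G) A1 A2 <= eta -> edens R (corel G) A2 A3 <= eta ->
  edens R (corel G) A3 A1 <= eta ->
  many d (fun x => [/\ x \in A1, x \notin B & many d (fun y =>
    [/\ y \in A2, y \notin B, G x y & many d (fun z =>
      [/\ z \in A3, z \notin B, G y z & G z x])])]).
Proof.
move=> l0 hl hB hd h1 h2 h3 e12 e23 e31.
pose bad (E : rel V) (A C : {set V}) := [set x in A | l / 8 <= dens R (C :&: out E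
  x)].
have badl E A C : edens R E A C <= eta -> dens R (bad E A C) <= l / 8.
  move=> e; have := edens_markov E A C (l / 8); rewrite -/(bad E A C) => mk.
  have : l / 8 * dens R (bad E A C) <= l / 8 * (l / 8).
    by move: mk e hl; rewrite expr2; clear; lra.
  by rewrite ler_pM2l //; move: l0; clear; lra.
have good (E : rel V) (A C : {set V}) x : x \in A -> x \notin bad E A C ->
    dens R (C :&: out E x) <= l / 8.
  by rewrite inE => ->; rewrite -ltNge => /ltW.
have b12 := badl _ _ _ e12; have b23 := badl _ _ _ e23.
have b13 : dens R (bad (converse (corel G)) A1 A3) <= l / 8.
  by apply: badl; rewrite -edens_converse.
set B12 := bad _ _ _ in b12; set B23 := bad _ _ _ in b23; set B13 := bad _ _ _ in b13.
have cov (A C D : {set V}) : dens R A <= dens R ((A :\: C) :\: D) + dens R C + dens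
  R D.
  have := densID (R := R) C A; have := densID (R := R) D (A :\: C).
  have := dens_sub (R := R) (subsetIr A C);
    have := dens_sub (R := R) (subsetIr (A :\: C) D).
  by clear; lra.
apply: le_trans (_ : dens R (((A1 :\: B) :\: B12) :\: B13) <= _).
  have := cov (A1 :\: B) B12 B13; have := densID (R := R) B A1.
  have := dens_sub (R := R) (subsetIr A1 B).
  by move: h1 hB hd b12 b13 l0; clear; lra.
apply: dens_sub; apply/subsetP=> x.
rewrite 3!in_setD => /and4P[x13 x12 xB xA]; rewrite inE; apply/asboolP; split=> //.
have n12 := good _ _ _ _ xA x12; have n13 := good _ _ _ _ xA x13.
apply: le_trans (_ : dens R (((A2 :\: B) :\: B23) :\: out (corel G) x) <= _).
  have := densID (R := R) (out (corel G) x) ((A2 :\: B) :\: B23).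
  have := cov A2 B B23.
  have := dens_sub (R := R) (_ : ((A2 :\: B) :\: B23) :&: out (corel G) x \subset
    A2 :&: out (corel G) x).
  have -> : ((A2 :\: B) :\: B23) :&: out (corel G) x \subset A2 :&: out (corel G) x.
    by apply: setSI; apply: subset_trans (subsetDl _ _) (subsetDl _ _).
  by move=> /(_ isT); move: h2 hB hd b23 n12 l0; clear; lra.
apply: dens_sub; apply/subsetP=> y.
rewrite 3!in_setD [y \in out _ _]inE negbK => /and4P[yx y23 yB yA].
rewrite inE; apply/asboolP; split=> //; have n23 := good _ _ _ _ yA y23.
apply: le_trans (_ : dens R (((A3 :\: B) :\: out (corel G) y) :\: out (converse
  (corel G)) x) <= _).
  have := densID (R := R) (out (converse (corel G)) x) ((A3 :\: B) :\: out (corel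
    G) y).
  have := densID (R := R) (out (corel G) y) (A3 :\: B); have := densID (R := R) B A3.
  have := dens_sub (R := R) (subsetIr A3 B).
  have := dens_sub (R := R) (setSI (out (corel G) y) (subsetDl A3 B)).
  have := dens_sub (R := R) (setSI (out (converse (corel G)) x)
    (subset_trans (subsetDl (A3 :\: B) (out (corel G) y)) (subsetDl A3 B))).
  by move: h3 hB hd n23 n13 l0; clear; lra.
apply: dens_sub; apply/subsetP=> z.
rewrite 3!in_setD [z \in out _ x]inE [z \in out _ y]inE !negbK.
by move=> /and4P[zx yz zB zA]; rewrite inE; apply/asboolP; split.
Qed.

(** * Cyclic triangles *)

(* U1, U2 and W1, W2 are the two colour classes in the out- and in-neighbourhood
   of a vertex. *)
Record cyclic_classes (R : realType) (V : finType) (G : rel V) (col : V -> nat)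
    (q th : R) (U1 U2 W1 W2 : {set V}) u1 u2 : Prop := CyclicClasses {
  cc_u : u1 <> u2;
  cc_U1 : U1 \subset col_class col u1;
  cc_U2 : U2 \subset col_class col u2;
  cc_UU : U1 :&: U2 = set0;
  cc_WW : W1 :&: W2 = set0;
  cc_U1d : q - th <= dens R U1 <= q + th;
  cc_U2d : q - th <= dens R U2 <= q + th;
  cc_W1d : q - th <= dens R W1 <= q + th;
  cc_W2d : q - th <= dens R W2 <= q + th;
  cc_12 : edens R G U1 W2 <= th;
  cc_21 : edens R G U2 W1 <= th;
  cc_a1 : edens R (corel G) U1 (~: W2) <= 3 * th;
  cc_a2 : edens R (corel G) U2 (~: W1) <= 3 * th;
  cc_b1 : edens R (corel G) (~: U1) W2 <= 3 * th;
  cc_b2 : edens R (corel G) (~: U2) W1 <= 3 * th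
}.

Lemma cyclic_classes_sym (R : realType) (V : finType) (G : rel V) col (q th : R)
    (U1 U2 W1 W2 : {set V}) u1 u2 :
  cyclic_classes G col q th U1 U2 W1 W2 u1 u2 ->
  cyclic_classes G col q th U2 U1 W2 W1 u2 u1.
Proof. by case=> *; split=> //; [apply: nesym | rewrite setIC | rewrite setIC]. Qed.

(** A sparse pair of classes of density about [q] exhausts the missing degrees on both sides. By
    [neg_outside] each class is almost completely joined to everything outside its sparse
    partner. *)
Lemma two_coloured_cyclic (R : realType) (V : finType) (G : rel V) col
    (q m th : R) (Y Z : {set V}) t1 t2 s1 s2 :
  leaf_hyps G q m th -> two_coloured col th q G Y Z t1 t2 s1 s2 ->
  cyclic_classes G col q th (Y :&: col_class col t1) (Y :&: col_class col t2)
    (Z :&: col_class col s1) (Z :&: col_class col s2) t1 t2.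
Proof.
move=> H [t12 s12]; set U1 := _ :&: _; set U2 := _ :&: _; set W1 := _ :&: _;
  set W2 := _ :&: _.
move=> U1d U2d W1d W2d _ _ e12 e21.
have th0 := lh_th0 H; have tt : 0 <= th <= th by rewrite lexx ltW.
have dis (A : {set V}) u v : u <> v ->
    (A :&: col_class col u) :&: (A :&: col_class col v) = set0.
  move=> uv; apply/setP=> x; rewrite !inE; apply/negbTE/negP.
  by move=> /andP[/andP[_ /eqP xu] /andP[_ /eqP xv]]; apply: uv; rewrite -xu -xv.
have nin (A B : {set V}) : q - th <= dens R A -> edens R G A B <= th ->
    edens R (corel G) (~: A) B <= 3 * th.
  move=> Al e; have := @neg_outside R V (converse G) B A q th th (lh_in H) tt Al.
  by rewrite -edens_converse => /(_ e); rewrite edens_converse.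
have nout (A B : {set V}) : q - th <= dens R B -> edens R G A B <= th ->
    edens R (corel G) A (~: B) <= 3 * th.
  by apply: neg_outside (lh_out H) tt.
split=> //; try exact: subsetIr; try exact: dis.
- by apply: nout e12; case/andP: W2d.
- by apply: nout e21; case/andP: W1d.
- by apply: nin e12; case/andP: U1d.
- by apply: nin e21; case/andP: U2d.
Qed.

(* G almost contains Ex(n) with classes K, L, M. *)
Definition rotation (R : realType) (V : finType) (G : rel V) (q : R)
    (K L M : {set V}) (c : R) : Prop :=
  [/\ [/\ K :&: L = set0, L :&: M = set0 & M :&: K = set0],
      [/\ q - c <= dens R K, q - c <= dens R L & q - c <= dens R M],
      [/\ dens R K <= q + c, dens R L <= q + c & dens R M <= q + c],
      [/\ edens R (corel G) K K <= c, edens R (corel G) L L <= c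
        & edens R (corel G) M M <= c]
    & [/\ edens R (corel G) K L <= c, edens R (corel G) L M <= c
        & edens R (corel G) M K <= c]].

(** [Fr] abstracts the frequent patterns of cyclic triangles: [tx_tri] produces them from almost
    complete triples, and [tx_inj] forbids two that differ in the last entry only. The
    contradictions about colours below arise from this pair of rules. *)
Record triangle_ctx (R : realType) (V : finType) (G : rel V) (col : V ->
  nat) (K : nat)
    (q m th lam l1 : R) (Fr : nat -> nat -> nat -> Prop) : Prop := TriangleCtx {
  tx_col : forall v, (col v < K)%N;
  tx_hyps : leaf_hyps G q m th;
  tx_q3 : 3 * q = 1;
  tx_th : 10 * th <= lam;
  tx_lam : 40 * lam <= m;
  tx_K : K%:R * l1 <= lam;
  tx_l1 : l1 <= lam;
  tx_tri : forall (A1 A2 A3 : {set V}) p1 p2 p3,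
    A1 \subset col_class col p1 -> A2 \subset col_class col p2 ->
    A3 \subset col_class col p3 ->
    l1 <= dens R A1 -> l1 <= dens R A2 -> l1 <= dens R A3 ->
    edens R (corel G) A1 A2 <= 3 * th -> edens R (corel G) A2 A3 <= 3 * th ->
    edens R (corel G) A3 A1 <= 3 * th -> Fr p1 p2 p3;
  tx_inj : forall p1 p2 p3 p3', Fr p1 p2 p3 -> Fr p1 p2 p3' -> p3 = p3'
}.

(** There are few edges from [U1] to [W2], so [U1 :&: W2] is sparse and must be clearly smaller than
    [q]. The rest of [U1] lies outside [W2], hence is almost complete in itself and contains
    triangles of one colour. *)
Lemma cyclic_classes_diff (R : realType) (V : finType) (G : rel V) col K
    (q m th lam l1 : R) Fr (U1 U2 W1 W2 : {set V}) u1 u2 :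
  triangle_ctx G col K q m th lam l1 Fr ->
  cyclic_classes G col q th U1 U2 W1 W2 u1 u2 ->
  lam <= dens R (U1 :\: W2) /\ Fr u1 u1 u1.
Proof.
move=> T; have [m0 mq q1 th0 thm outG inG noindep] := tx_hyps T.
have [Hth Hlam Hl1] := And3 (tx_th T) (tx_lam T) (tx_l1 T).
case=> _ sU1 _ _ _ /andP[U1l _] _ _ _ e12 _ a1 _ _ _.
have lU : lam <= dens R (U1 :\: W2).
  rewrite leNgt; apply/negP => lt.
  have := noindep (U1 :&: W2).
  have := densID (R := R) W2 U1 => hID.
  have -> : q - m / 8 <= dens R (U1 :&: W2).
    by move: hID lt U1l Hth Hlam m0 th0; clear; lra.
  move=> /(_ isT).
  have := edens_sub (R := R) G (subsetIl U1 W2) (subsetIr U1 W2).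
  by move: e12 Hth Hlam m0 th0; clear; lra.
split=> //; have sub : U1 :\: W2 \subset col_class col u1.
  by apply: subset_trans sU1; apply: subsetDl.
have e : edens R (corel G) (U1 :\: W2) (U1 :\: W2) <= 3 * th.
  apply: le_trans a1; apply: edens_sub; first exact: subsetDl.
  by rewrite setDE subsetIr.
by apply: (tx_tri T (A1 := U1 :\: W2) (A2 := U1 :\: W2) (A3 := U1 :\: W2)) => //;
  apply: le_trans lU.
Qed.

Lemma edens_corel_sub (R : realType) (V : finType) (G : rel V) (A A' B B' : {set
  V}) (c : R) :
  edens R (corel G) A' B' <= c -> A \subset A' -> B \subset B' ->
  edens R (corel G) A B <= c.
Proof. by move=> h sA sB; apply: le_trans h; apply: edens_sub. Qed.

(** Otherwise [U1 :\: W1], [U1 :\: W2] and [U2 :\: W2] are cyclically almost complete by [cc_a1],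
    [cc_a1] and [cc_a2]. Their pattern differs from the constant pattern of [u1] in the last entry
    only. *)
Lemma cyclic_classes_close (R : realType) (V : finType) (G : rel V) col K
    (q m th lam l1 : R) Fr (U1 U2 W1 W2 : {set V}) u1 u2 :
  triangle_ctx G col K q m th lam l1 Fr ->
  cyclic_classes G col q th U1 U2 W1 W2 u1 u2 ->
  dens R (U1 :\: W1) < lam \/ dens R (U2 :\: W2) < lam.
Proof.
move=> T C; have [lU1 Fr1] := cyclic_classes_diff T C.
case: C => u12 sU1 sU2 dUU dWW _ _ _ _ _ _ a1 a2 b1 b2.
have hl := tx_l1 T.
apply: contrapT => /not_orP[/negP + /negP]; rewrite -!leNgt => h1 h2; apply: u12.
apply: (tx_inj T) Fr1 _.
have sC (A B : {set V}) : A :\: B \subset ~: B by rewrite setDE subsetIr.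
apply: (tx_tri T (A1 := U1 :\: W1) (A2 := U1 :\: W2) (A3 := U2 :\: W2)).
- by apply: subset_trans sU1; apply: subsetDl.
- by apply: subset_trans sU1; apply: subsetDl.
- by apply: subset_trans sU2; apply: subsetDl.
- exact: le_trans h1.
- exact: le_trans lU1.
- exact: le_trans h2.
- by apply: edens_corel_sub a1 _ _; rewrite ?subsetDl.
- by apply: edens_corel_sub a1 _ _; rewrite ?subsetDl.
- by apply: edens_corel_sub a2 _ _; rewrite ?subsetDl.
Qed.

Lemma disj_subC (V : finType) (A B : {set V}) : A :&: B = set0 -> A \subset ~: B.
Proof. by move=> d; rewrite -disjoints_subset -setI_eq0 d. Qed.

(** Here [U1] and [W1] nearly coincide, and the parts are [U1], [U2] and the bulk of [W2]. Once the
    overlaps are known to be small, each of the six almost complete pairs is an instance of [cc_a1],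
    [cc_a2], [cc_b1] or [cc_b2]. *)
Lemma cyclic_rotation (R : realType) (V : finType) (G : rel V) col K
    (q m th lam l1 : R) Fr (U1 U2 W1 W2 : {set V}) u1 u2 :
  triangle_ctx G col K q m th lam l1 Fr ->
  cyclic_classes G col q th U1 U2 W1 W2 u1 u2 ->
  dens R (U1 :\: W1) < lam -> exists K L M, rotation G q K L M (5 * lam).
Proof.
move=> T C UW1; have [lU1 Fr1] := cyclic_classes_diff T C.
have [m0 mq q1 th0 thm outG inG noindep] := tx_hyps T.
have [Hq Hth Hlam Hl1] := And4 (tx_q3 T) (tx_th T) (tx_lam T) (tx_l1 T).
case: C => u12 sU1 sU2 dUU dWW /andP[U1l U1u] /andP[U2l U2u] /andP[W1l W1u]
  /andP[W2l W2u] e12 e21 a1 a2 b1 b2.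
have lamth : 0 < lam by move: th0 Hth; clear; lra.
have hK : q - th - lam <= dens R (U1 :&: W1).
  by have := densID (R := R) W1 U1; move: U1l UW1; clear; lra.
(* If [U2] and [W2] overlapped more, then by [3 * q = 1] the set [E] outside all four classes would
   contain a popular colour [t]. Triangles with two vertices in [U1 :&: W1], or in [U2 :&: W2], and
   the third in [E] have patterns [u1, u1, t] and [u2, u2, t]; comparison with the constant patterns
   forces [u1 = t = u2]. *)
have hLM : dens R (U2 :&: W2) < 3 * lam.
  rewrite ltNge; apply/negP => hN; apply: u12.
  pose E := ~: ((U1 :|: W1) :|: (U2 :|: W2)).
  have hE : lam < dens R E.
    have V1 : 1 <= dens R ((U1 :|: W1) :|: (U2 :|: W2)) + dens R E.
      apply: le_trans (_ : dens R [set: V] <= _).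
        have [v _] : exists v, v \in U1.
          by apply: (@dens_gt0 R); move: U1l mq m0 Hth Hlam; clear; lra.
        by rewrite /dens cardsT divff // pnatr_eq0 -lt0n; apply/card_gt0P; exists v.
      by apply: dens_cover; rewrite /E setUCr.
    have h1 : dens R (U1 :|: W1) <= dens R W1 + dens R (U1 :\: W1).
      by apply: dens_cover; apply/subsetP=> v; rewrite !inE; case: (v \in W1);
        rewrite ?orbT ?orbF.
    have h2 : dens R (U2 :|: W2) + dens R (U2 :&: W2) <= dens R U2 + dens R W2.
      by rewrite /dens -!mulrDl -!natrD cardsUI.
    have := densU (R := R) (U1 :|: W1) (U2 :|: W2).
    by move: V1 h1 h2 hN UW1 U2u W1u W2u Hq Hth lamth; clear; lra.
  have [t ht] : exists t, l1 <= dens R (E :&: col_class col t).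
    apply: contrapT => no.
    have ltl t : dens R (E :&: col_class col t) < l1.
      by rewrite ltNge; apply/negP => h; apply: no; exists t.
    have := dens_cols (tx_col T) (fun t _ => ltW (ltl t)).
    by move: hE (tx_K T); clear; lra.
  pose Et := E :&: col_class col t.
  have sEt (A : {set V}) : A \subset (U1 :|: W1) :|: (U2 :|: W2) -> Et \subset ~: A.
    by move=> sA; apply: subset_trans (subsetIl _ _) _; rewrite /E setCS.
  have EU1 : Et \subset ~: U1 by apply: sEt; rewrite -setUA subsetUl.
  have EU2 : Et \subset ~: U2 by apply: sEt; rewrite setUC -setUA subsetUl.
  have EW1 : Et \subset ~: W1 by apply: sEt; rewrite [U1 :|: _]setUC -setUA subsetUl.
  have EW2 : Et \subset ~: W2 by apply: sEt;
    rewrite setUC [U2 :|: _]setUC -setUA subsetUl.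
  have sW12 := disj_subC dWW.
  have sW21 : W2 \subset ~: W1 by apply: disj_subC; rewrite setIC.
  have [I1 I2] : U1 :&: W1 \subset U1 /\ U1 :&: W1 \subset W1
    by rewrite subsetIl subsetIr.
  have [J1 J2] : U2 :&: W2 \subset U2 /\ U2 :&: W2 \subset W2
    by rewrite subsetIl subsetIr.
  have F1 : Fr u1 u1 t.
    apply: (tx_tri T (A1 := U1 :&: W1) (A2 := U1 :&: W1) (A3 := Et)) => //.
    - exact: subset_trans sU1.
    - exact: subset_trans sU1.
    - exact: subsetIr.
    - by move: hK Hl1 Hth Hlam mq lamth; clear; lra.
    - by move: hK Hl1 Hth Hlam mq lamth; clear; lra.
    - by apply: edens_corel_sub a1 _ _ => //; apply: subset_trans sW12.
    - exact: edens_corel_sub a1 _ _.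
    - exact: edens_corel_sub b2 _ _.
  have N1 : l1 <= dens R (U2 :&: W2) by move: hN Hl1 lamth; clear; lra.
  have F2 : Fr u2 u2 t.
    apply: (tx_tri T (A1 := U2 :&: W2) (A2 := U2 :&: W2) (A3 := Et)) => //.
    - exact: subset_trans sU2.
    - exact: subset_trans sU2.
    - exact: subsetIr.
    - by apply: edens_corel_sub a2 _ _ => //; apply: subset_trans sW21.
    - exact: edens_corel_sub a2 _ _.
    - exact: edens_corel_sub b1 _ _.
  have F3 : Fr u2 u2 u2.
    apply: (tx_tri T (A1 := U2 :&: W2) (A2 := U2 :&: W2) (A3 := U2 :&: W2)) => //;
      try exact: subset_trans sU2;
      by apply: edens_corel_sub a2 _ _ => //; apply: subset_trans sW21.
  by rewrite -(tx_inj T F1 Fr1) (tx_inj T F2 F3).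
pose M := W2 :\: (U1 :|: U2).
have W2U1 : dens R (U1 :&: W2) <= lam.
  apply: le_trans (ltW UW1); apply: dens_sub; apply/subsetP=> v; rewrite !inE.
  move=> /andP[-> vW2]; rewrite andbT; apply/negP => vW1.
  by have /setP/(_ v) := dWW; rewrite !inE vW1 vW2.
have U2W1 : dens R (U2 :&: W1) <= lam + 2 * th.
  have := densID (R := R) U1 W1; rewrite [W1 :&: U1]setIC.
  have := dens_sub (R := R) (_ : U2 :&: W1 \subset W1 :\: U1).
  have -> : U2 :&: W1 \subset W1 :\: U1.
    apply/subsetP=> v; rewrite !inE => /andP[vU2 ->]; rewrite andbT;
      apply/negP => vU1.
    by have /setP/(_ v) := dUU; rewrite !inE vU1 vU2.
  by move=> /(_ isT); move: hK W1u; clear; lra.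
have Ml : q - th - 4 * lam <= dens R M.
  have := dens_cover (R := R) (_ : W2 \subset M :|: (U1 :&: W2 :|: U2 :&: W2)).
  have -> : W2 \subset M :|: (U1 :&: W2 :|: U2 :&: W2).
    by apply/subsetP=> v vW; rewrite !inE vW !andbT; case: (v \in U1);
      case: (v \in U2).
  move=> /(_ isT); have := densU (R := R) (U1 :&: W2) (U2 :&: W2).
  by move: W2l W2U1 hLM; clear; lra.
have Mu : dens R M <= q + th by apply: le_trans W2u; apply/dens_sub/subsetDl.
have MU1 : M \subset ~: U1.
  by apply/subsetP=> v; rewrite !inE negb_or => /andP[/andP[->]].
have MU2 : M \subset ~: U2.
  by apply/subsetP=> v; rewrite !inE negb_or => /andP[/andP[_ ->]].
have MW2 : M \subset W2 by apply: subsetDl.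
have part (A B C : {set V}) c : edens R (corel G) A (~: C) <= 3 * th ->
    dens R (B :&: C) <= c -> edens R (corel G) A B <= 3 * th + c.
  move=> hA hB; apply: le_trans (edens_coverr (corel G) A (_ : B \subset ~: C :|: B
    :&: C)) _.
    by apply/subsetP=> v vB; rewrite !inE vB; case: (v \in C).
  by rewrite lerD // (le_trans (edens_le_densr _ _ _)).
have le5 c : c <= 3 * th + 3 * lam -> c <= 5 * lam.
  by move: Hth lamth; clear; lra.
exists U1, U2, M; split; split.
- exact: dUU.
- by apply/setP=> v; rewrite !inE; case: (v \in U2); rewrite ?orbT ?andbF.
- by apply/setP=> v; rewrite !inE; case: (v \in U1); rewrite ?orbT ?andbF.
- by move: U1l Hth lamth; clear; lra.
- by move: U2l Hth lamth; clear; lra.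
- by move: Ml Hth lamth; clear; lra.
- by move: U1u Hth lamth; clear; lra.
- by move: U2u Hth lamth; clear; lra.
- by move: Mu Hth lamth; clear; lra.
- by apply: le5; apply: part a1 _; move: W2U1 lamth; clear; lra.
- by apply: le5; apply: part a2 _; move: U2W1 lamth Hth; clear; lra.
- apply: le_trans (edens_corel_sub b1 MU1 MW2) _.
  by apply: le5; move: lamth; clear; lra.
- by apply: le5; apply: part a1 _; move: hLM; clear; lra.
- apply: le_trans (edens_corel_sub a2 (subxx _) (_ : M \subset ~: W1)) _.
    by apply: subset_trans MW2 _; apply: disj_subC; rewrite setIC.
  by apply: le5; move: lamth; clear; lra.
- apply: le_trans (edens_coverr (corel G) M (_ : U1 \subset (W1 :|: (U1 :\: W1)))) _.
    by apply/subsetP=> v; rewrite !inE => ->; rewrite andbT orbN.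
  apply: le5; rewrite lerD ?(edens_corel_sub b2 MU2) //.
  by apply: le_trans (edens_le_densr _ _ _) _; move: UW1 lamth; clear; lra.
Qed.

(** * Aligning a digraph with Ex(n) *)

Lemma bij_extend (V W : finType) (S : seq (V * W)) : #|V| = #|W| ->
  uniq (unzip1 S) -> uniq (unzip2 S) ->
  exists2 f : V -> W, bijective f & forall p, p \in S -> f p.1 = p.2.
Proof.
move=> VW u1 u2.
have sizeC (X : finType) (s : seq X) : uniq s ->
    size [seq x <- enum X | x \notin s] = (#|X| - size s)%N.
  move=> us; rewrite -(cardC (mem s)) (card_uniqP us) addKn.
  rewrite -(card_uniqP (filter_uniq _ (enum_uniq X))); apply: eq_card => x.
  by rewrite mem_filter mem_enum andbT.
pose sV := unzip1 S ++ [seq x <- enum V | x \notin unzip1 S].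
pose sW := unzip2 S ++ [seq x <- enum W | x \notin unzip2 S].
have usV : uniq sV.
  rewrite cat_uniq u1 filter_uniq ?enum_uniq // andbT.
  by apply/hasPn => x; rewrite mem_filter => /andP[].
have usW : uniq sW.
  rewrite cat_uniq u2 filter_uniq ?enum_uniq // andbT.
  by apply/hasPn => x; rewrite mem_filter => /andP[].
have inV x : x \in sV.
  by rewrite mem_cat mem_filter mem_enum andbT; case: (_ \in _).
have szVW : size sV = size sW.
  by rewrite !size_cat !sizeC // !size_map VW.
have szV : size sV = #|V| by rewrite -(card_uniqP usV); apply: eq_card => x;
  rewrite inV.
have [V0|/card_gt0P[v0 _]] := posnP #|V|.
  have VF (x : V) : False by have /card0_eq/(_ x) := V0.
  have WF (x : W) : False by have /card0_eq/(_ x) := etrans (esym VW) V0.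
  exists (fun x => False_rect W (VF x)); last by move=> [x y]; case: (VF x).
  by exists (fun x => False_rect V (WF x)) => x; [case: (VF x) | case: (WF x)].
have [w0 _] : exists w0 : W, w0 \in W.
  by apply/card_gt0P; rewrite -VW; apply/card_gt0P; exists v0.
have idx x : (index x sV < size sW)%N by rewrite -szVW index_mem.
exists (fun x => nth w0 sW (index x sV)).
  apply: inj_card_bij; last by rewrite VW.
  move=> x y /eqP; rewrite nth_uniq // => /eqP e.
  by rewrite -(nth_index v0 (inV x)) e nth_index.
move=> p pS; have [i iS <-] := nthP p pS.
have i1 : nth v0 (unzip1 S) i = (nth p S i).1 by rewrite (nth_map p).
have i2 : nth w0 (unzip2 S) i = (nth p S i).2 by rewrite (nth_map p).
rewrite -i1 index_cat mem_nth ?size_map // index_uniq ?size_map //.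
by rewrite nth_cat size_map iS.
Qed.

Lemma zip_classes (V W : finType) (A : {set V}) (B : {set W}) :
  exists S : seq (V * W), [/\ uniq (unzip1 S), uniq (unzip2 S),
    {subset unzip1 S <= A}, {subset unzip2 S <= B}
  & #|[set x in A | x \notin unzip1 S]| = #|A| - #|B|]%N.
Proof.
pose a := minn #|A| #|B|.
pose s := take a (enum A); pose t := take a (enum B).
have sA : size s = a by rewrite size_takel // -cardE geq_minl.
have sB : size t = a by rewrite size_takel // -cardE geq_minr.
have us : uniq s by rewrite take_uniq ?enum_uniq.
exists (zip s t); rewrite unzip1_zip ?unzip2_zip ?sA ?sB //; split=> //.
- by rewrite take_uniq ?enum_uniq.
- by move=> x /mem_take; rewrite mem_enum.
- by move=> x /mem_take; rewrite mem_enum.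
have sub : {subset s <= A} by move=> x /mem_take; rewrite mem_enum.
have -> : [set x in A | x \notin s] = A :\: [set x in s].
  by apply/setP=> x; rewrite !inE andbC.
rewrite cardsD (setIidPr _); last by apply/subsetP=> x; rewrite inE => /sub.
by rewrite cardsE (card_uniqP us) sA /a; lia.
Qed.

(** Each part is matched with its class as far as both last, and the partial matching is completed
    arbitrarily. The bounds are truncated differences: a part no larger than its class is placed
    correctly as a whole. *)
Lemma bij_align (V W : finType) (K L M : {set V}) (c : W -> 'I_3) (i j k : 'I_3) :
  #|V| = #|W| -> K :&: L = set0 -> L :&: M = set0 -> M :&: K = set0 ->
  i != j -> j != k -> k != i ->
  exists2 f : V -> W, bijective f &
   [/\ #|[set x in K | c (f x) != i]| <= #|K| - #|[set w | c w == i]|,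
       #|[set x in L | c (f x) != j]| <= #|L| - #|[set w | c w == j]|
     & #|[set x in M | c (f x) != k]| <= #|M| - #|[set w | c w == k]|]%N.
Proof.
move=> VW KL LM MK ij jk ki.
have [S1 [a1 b1 c1 d1 e1]] := zip_classes K [set w | c w == i].
have [S2 [a2 b2 c2 d2 e2]] := zip_classes L [set w | c w == j].
have [S3 [a3 b3 c3 d3 e3]] := zip_classes M [set w | c w == k].
have dV (A B : {set V}) (s t : seq V) : {subset s <= A} -> {subset t <= B} ->
  A :&: B = set0 ->
    ~~ has (mem s) t.
  move=> sA tB /setP d; apply/hasPn => x xt; apply/negP => xs.
  by have := d x; rewrite !inE (sA _ xs) (tB _ xt).
have dW (p q : 'I_3) (s t : seq W) : {subset s <= [set w | c w == p]} ->
    {subset t <= [set w | c w == q]} -> p != q -> ~~ has (mem s) t.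
  move=> sA tB pq; apply/hasPn => x xt; apply/negP => xs.
  have := sA _ xs; have := tB _ xt; rewrite !inE => /eqP-> /eqP e.
  by rewrite e eqxx in pq.
have [||f fb fS] := @bij_extend V W (S1 ++ (S2 ++ S3)) VW.
- rewrite /unzip1 !map_cat !cat_uniq a1 a2 a3 has_cat negb_or.
  rewrite (dV _ _ _ _ c1 c2 KL) (dV _ _ _ _ c2 c3 LM).
  by rewrite (dV _ _ _ _ c1 c3) // setIC.
- rewrite /unzip2 !map_cat !cat_uniq b1 b2 b3 has_cat negb_or.
  rewrite (dW _ _ _ _ d1 d2 ij) (dW _ _ _ _ d2 d3 jk).
  by rewrite (dW _ _ _ _ d1 d3) // eq_sym.
exists f => //.
have mis (S : seq (V * W)) (A : {set V}) p : {subset S <= S1 ++ (S2 ++ S3)} ->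
    {subset unzip2 S <= [set w | c w == p]} ->
    [set x in A | c (f x) != p] \subset [set x in A | x \notin unzip1 S].
  move=> sS sp; apply/subsetP=> x; rewrite !inE => /andP[-> ]; apply: contra.
  move=> /mapP[q qS ->]; rewrite fS ?sS //.
  by have := sp q.2 (map_f _ qS); rewrite inE.
split.
- rewrite -e1; apply/subset_leq_card/mis => // x; by rewrite !mem_cat => ->.
- rewrite -e2; apply/subset_leq_card/mis => // x; by rewrite !mem_cat => ->;
  rewrite orbT.
- rewrite -e3; apply/subset_leq_card/mis => // x; by rewrite !mem_cat => ->;
  rewrite !orbT.
Qed.

Lemma edens_card (R : realType) (V : finType) (E : rel V) (A B : {set V}) :
  edens R E A B =
  #|[set p : V * V | [&& p.1 \in A, p.2 \in B & E p.1 p.2]]|%:R / #|V|%:R ^+ 2.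
Proof.
rewrite /edens /avg /dens -mulr_suml -mulrA -invfM -expr2 -natr_sum; congr (_%:R / _).
rewrite -sum1_card (eq_bigr (fun x => \sum_(y in B :&: out E x) 1)%N); last first.
  by move=> x _; rewrite sum1_card.
rewrite pair_big_dep /=; apply: eq_bigl => -[x y]; rewrite !inE /=.
by case: (x \in A).
Qed.

Lemma card_Ex_class n (i : 'I_3) :
  #|[set w : Ex_vertex n | tag w == i]| = ((n + i) %/ 3)%N.
Proof.
have -> : [set w : Ex_vertex n | tag w == i] =
    (fun x : 'I_(Ex_class_size n i) => Tagged (fun i => 'I_(Ex_class_size n i)) x)
      @: setT.
  apply/setP=> -[j x]; rewrite inE /=; apply/eqP/imsetP => [ji|[y _ e]].
    by subst j; exists x.
  by case: e.
rewrite card_imset; last by move=> x y /eqP; rewrite eq_Tagged /= => /eqP.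
by rewrite cardsT card_ord.
Qed.

Lemma card_Ex n : #|Ex_vertex n| = n.
Proof.
rewrite card_tagged sumnE big_map big_enum /= !big_ord_recl big_ord0 !card_ord.
by rewrite /Ex_class_size /= /bump /=; lia.
Qed.

Lemma third_nat (n k M : nat) (i : 'I_3) :
  (M <= k - (n + i) %/ 3 -> 3 * M <= 3 * k - n + 3)%N.
Proof. by have := ltn_ord i; lia. Qed.

(** Of the nine ordered pairs of aligned parts, six miss at most [c] each and three contain no edge
    of [Ex]. The misplaced vertices have density at most [6 * c + 3 / n] and are charged once as
    first and once as second ends; this adds up to [18 * c + 6 / n]. *)
Lemma rotation_contains (R : realType) (V : finType) (G : rel V) (q c alpha : R)
    (K L M : {set V}) n :
  #|V| = n -> (0 < n)%N -> 3 * q = 1 -> rotation G q K L M c ->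
  18 * c + 6 / n%:R <= alpha -> alpha_contains alpha G (@Ex n).
Proof.
move=> Vn n0 q3 [[KL LM MK] [Kl Ll Ml] [Ku Lu Mu] [eKK eLL eMM] [eKL eLM eMK]] hal.
have VW : #|V| = #|Ex_vertex n| by rewrite card_Ex.
have i01 : inord 0 != inord 1 :> 'I_3 by rewrite -val_eqE /= !inordK.
have i12 : inord 1 != inord 2 :> 'I_3 by rewrite -val_eqE /= !inordK.
have i20 : inord 2 != inord 0 :> 'I_3 by rewrite -val_eqE /= !inordK.
have [f fb [fK fL fM]] := bij_align (fun w : Ex_vertex n => tag w) VW KL LM MK i01
  i12 i20.
have [g fK' gK'] := fb.
exists (fun a b => G (g a) (g b)); first by exists f => // x y; rewrite !fK'.
pose E x y := Ex (f x) (f y) && ~~ G x y.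
have n0R : 0 < n%:R :> R by rewrite ltr0n.
have -> : #|[set p : Ex_vertex n * Ex_vertex n | Ex p.1 p.2 && ~~ G (g p.1) (g
  p.2)]| =
    #|[set p : V * V | [&& p.1 \in setT, p.2 \in setT & E p.1 p.2]]|.
  have hinj : injective (fun p : V * V => (f p.1, f p.2)).
    by move=> [a b] [a' b'] /= [/(bij_inj fb)-> /(bij_inj fb)->].
  rewrite -(card_imset _ hinj); apply: eq_card => -[a b]; rewrite inE.
  apply/idP/imsetP => [h|[[x y]]].
    by exists (g a, g b); rewrite ?inE /E /= ?gK'.
  by rewrite !inE /E /= => h [-> ->]; rewrite !fK'.
rewrite card_Ex -ler_pdivrMr ?exprn_gt0 //.
have := edens_card R E setT setT; rewrite Vn => <-.
pose P (A : {set V}) i := [set x in A | tag (f x) == i].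
have small (A : {set V}) i : dens R A <= q + c -> q - c <= dens R A ->
    (#|[set x in A | tag (f x) != i]| <= #|A| - #|[set w : Ex_vertex n | tag w ==
      i]|)%N ->
    q - 2 * c - 1 / n%:R <= dens R (P A i).
  move=> Au Al; rewrite card_Ex_class => h.
  have := densID (R := R) [set x in A | tag (f x) == i] A.
  have -> : A :&: [set x in A | tag (f x) == i] = P A i.
    by apply/setIidPr/subsetP=> x; rewrite inE => /andP[].
  have -> : A :\: [set x in A | tag (f x) == i] = [set x in A | tag (f x) != i].
    by apply/setP=> x; rewrite !inE; case: (x \in A); rewrite ?andbF ?andbT.
  have c0 : 0 <= c by apply: le_trans (edens_ge0 _ _ _) eKK.
  have : dens R [set x in A | tag (f x) != i] <= c + 1 / n%:R; last by move: Al c0;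
    clear; lra.
  have Au' : #|A|%:R <= (q + c) * n%:R by move: Au; rewrite /dens Vn ler_pdivrMr.
  rewrite /dens Vn ler_pdivrMr // mulrDl mulfVK ?gt_eqF //.
  have := third_nat h; have [hn|hn] := leqP n (3 * #|A|).
    rewrite -(ler_nat R) !natrM natrD natrB // natrM => h3.
    have q3n : 3 * (q * n%:R) = n%:R by rewrite mulrA q3 mul1r.
    by move: Au' h3 q3n; rewrite mulrDl; clear; lra.
  rewrite (eqP (ltnW hn : 3 * #|A| - n == 0)%N) add0n -[leqRHS](muln1 3) leq_pmul2l
    //.
  rewrite -(ler_nat R) => h1; have := mulr_ge0 c0 (ltW n0R).
  by move: h1; clear; lra.
have lK := small _ _ Ku Kl fK; have lL := small _ _ Lu Ll fL;
  have lM := small _ _ Mu Ml fM.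
set K' := P K _ in lK; set L' := P L _ in lL; set M' := P M _ in lM.
have sub (A : {set V}) i : P A i \subset A by apply/subsetP=> x;
  rewrite inE => /andP[].
pose Bd := ~: (K' :|: L' :|: M').
have Bdl : dens R Bd <= 6 * c + 3 / n%:R.
  have d1 : K' :&: L' = set0.
    by apply/eqP; rewrite -subset0 -KL setISS ?sub.
  have d2 : (K' :|: L') :&: M' = set0.
    apply/eqP; rewrite -subset0 setIUl subUset; apply/andP; split.
      by rewrite setIC -MK setISS ?sub.
    by rewrite -LM setISS ?sub.
  have := dens_disj (R := R) d1 (subsetUl _ _) (subsetUr _ _).
  have := dens_disj (R := R) d2 (subsetUl _ _) (subsetUr _ _).
  have := dens_disj (R := R) (setICr (K' :|: L' :|: M')) (subsetT _) (subsetT _).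
  by have := dens_le1 (R := R) [set: V]; rewrite -/Bd; lra.
have exP (A B : {set V}) i j x y : x \in P A i -> y \in P B j -> E x y ->
    (j == i) || (j == ordS i).
  by rewrite !inE => /andP[_ /eqP <-] /andP[_ /eqP <-] /andP[/andP[]].
have full (X Y A B : {set V}) c' : edens R (corel G) A B <= c' -> X \subset A ->
  Y \subset B ->
    edens R E X Y <= c'.
  move=> h sX sY; apply: le_trans h; apply: le_trans (edens_sub _ sX sY).
  apply: avg_le => x _; apply: dens_sub; apply: setIS; apply/subsetP=> y.
  by rewrite !inE => /andP[].
have zero (A B : {set V}) i j : ~~ ((j == i) || (j == ordS i)) ->
  edens R E (P A i) (P B j) <= 0.
  move=> ij; apply: le_trans (edens_le (c := 0) _) _; last by rewrite mul0r.
  move=> x xA; rewrite (_ : _ :&: _ = set0) ?dens0 //; apply/setP=> y; rewrite !inE.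
  apply/negbTE/negP => /andP[yB Exy]; move/negP: ij; apply.
  by apply: (exP A B i j x y) => //; rewrite inE.
have s0 : ordS (inord 0 : 'I_3) = inord 1 by apply/val_inj; rewrite /= !inordK.
have s1 : ordS (inord 1 : 'I_3) = inord 2 by apply/val_inj; rewrite /= !inordK.
have s2 : ordS (inord 2 : 'I_3) = inord 0 by apply/val_inj; rewrite /= !inordK.
have row (A : {set V}) : edens R E A setT <= edens R E A K' + edens R E A L' +
  edens R E A M' +
    edens R E A Bd.
  apply: le_trans (edens_coverr E A (_ : setT \subset (K' :|: L' :|: M') :|: Bd)) _.
    by rewrite /Bd setUCr.
  rewrite lerD2r; apply: le_trans (edens_coverr E A (subxx _)) _.
  by rewrite lerD2r; apply: edens_coverr.
have colB (A B D F : {set V}) : edens R E (A :|: B :|: D) F <=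
    edens R E A F + edens R E B F + edens R E D F.
  apply: le_trans (edens_coverl E F (subxx _)) _.
  by rewrite lerD2r; apply: edens_coverl.
have hB1 : edens R E setT setT <= edens R E (K' :|: L' :|: M') setT + dens R Bd.
  apply: le_trans (edens_coverl E _ (_ : setT \subset (K' :|: L' :|: M') :|: Bd)) _.
    by rewrite /Bd setUCr.
  by rewrite lerD2l; apply: edens_le_densl.
have hB2 := row (K' :|: L' :|: M');
  have hB3 := edens_le_densr (R := R) E (K' :|: L' :|: M') Bd.
have := colB K' L' M' K'; have := colB K' L' M' L'; have := colB K' L' M' M'.
have := full K' K' _ _ _ eKK (sub _ _) (sub _ _).
have := full L' L' _ _ _ eLL (sub _ _) (sub _ _).
have := full M' M' _ _ _ eMM (sub _ _) (sub _ _).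
have := full K' L' _ _ _ eKL (sub _ _) (sub _ _).
have := full L' M' _ _ _ eLM (sub _ _) (sub _ _).
have := full M' K' _ _ _ eMK (sub _ _) (sub _ _).
have := zero K M (inord 0) (inord 2); rewrite s0 -/K' -/M'.
have := zero L K (inord 1) (inord 0); rewrite s1 -/L' -/K'.
have := zero M L (inord 2) (inord 1); rewrite s2 -/M' -/L'.
have n10 : (inord 1 == inord 0 :> 'I_3) = false by rewrite eq_sym (negbTE i01).
have n21 : (inord 2 == inord 1 :> 'I_3) = false by rewrite eq_sym (negbTE i12).
have n02 : (inord 0 == inord 2 :> 'I_3) = false by rewrite eq_sym (negbTE i20).
rewrite !(n10, n21, n02, negbTE i01, negbTE i12, negbTE i20) /=.
move=> /(_ isT) + /(_ isT) + /(_ isT).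
move: hB1 hB2 hB3 Bdl hal; clear; lra.
Qed.

(** * Colour patterns *)

Section Freq.
Variables (R : realType) (VT V : finType) (T : rel VT) (G : rel V).
Variables (col : V -> nat) (B : {set V}) (d : R).

(* The colour pattern psi is frequent among the extensions of the partial copy
   (es, s) by vertices outside B in the roles todo, in this order. *)
Fixpoint freq (todo : seq VT) (psi : seq nat) es s : Prop :=
  match todo, psi with
  | e :: todo', p :: psi' => many d (fun v =>
      [/\ v \in cand T G es s e, v \notin B, col v = p
        & freq todo' psi' (e :: es) (v :: s)])
  | [::], [::] => True
  | _, _ => False
  end.

Definition good todo es s : Prop := forall a p p' b,
  freq todo (a ++ p :: b) es s -> freq todo (a ++ p' :: b) es s -> p = p'.

Lemma freq_size todo psi es s : 0 < d -> freq todo psi es s -> size psi = size todo.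
Proof.
move=> d0; elim: todo psi es s => [|e todo IH] [|p psi] es s //=.
by move=> /(many_ex d0)[v [_ _ _ /IH->]].
Qed.

Lemma freq_lt K todo psi es s : 0 < d -> (forall v, (col v < K)%N) ->
  freq todo psi es s -> all (fun p => p < K)%N psi.
Proof.
move=> d0 colK; elim: todo psi es s => [|e todo IH] [|p psi] es s //=.
by move=> /(many_ex d0)[v [_ _ <- /IH->]]; rewrite colK.
Qed.

(** A bad [v] carries two frequent patterns that differ in one role. With too many bad [v],
    pigeonhole over the colour of [v] and the two patterns gives more than [d] of them the same
    data; prefixing the colour yields two frequent patterns that contradict goodness before the
    choice. *)
Lemma good_step K e todo es s : 0 < d -> (forall v, (col v < K)%N) ->
  good (e :: todo) es s ->
  dens R [set v in cand T G es s e | (v \notin B) && ~~ `[< good todo (e :: es) (v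
    :: s) >]]
    <= (K * (K ^ size todo * K ^ size todo))%:R * d.
Proof.
move=> d0 colK gd; rewrite leNgt; apply/negP => lt.
set k := size todo in lt; set A := [set v in _ | _] in lt.
pose P (I : 'I_K * (k.-tuple 'I_K * k.-tuple 'I_K)) v :=
  [/\ v \in cand T G es s e, v \notin B, col v = I.1
   & [/\ freq todo (map val I.2.1) (e :: es) (v :: s),
         freq todo (map val I.2.2) (e :: es) (v :: s)
       & exists a p p' b, [/\ map val I.2.1 = a ++ p :: b,
           map val I.2.2 = a ++ p' :: b & p <> p']]].
have enc psi : all (fun p => p < K)%N psi -> size psi = k ->
    exists t : k.-tuple 'I_K, map val t = psi.
  elim: psi (k) => [|p psi IH] k' /=.
    by move=> _ <-; exists [tuple].
  move=> /andP[pK /IH h] <-; have [t ht] := h _ erefl.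
  by exists [tuple of Ordinal pK :: t]; rewrite /= ht.
have AP v : v \in A -> exists I, P I v.
  rewrite inE => /and3P[vc vB /asboolPn nG].
  have [[a [p [p' [b [f1 f2 pp]]]]]|no] := pselect (exists a p p' b,
      [/\ freq todo (a ++ p :: b) (e :: es) (v :: s),
          freq todo (a ++ p' :: b) (e :: es) (v :: s) & p <> p']); last first.
    case: nG => a p p' b f1 f2; apply: contrapT => pp; apply: no.
    by exists a, p, p', b.
  have [t1 e1] := enc _ (freq_lt d0 colK f1) (freq_size d0 f1).
  have [t2 e2] := enc _ (freq_lt d0 colK f2) (freq_size d0 f2).
  exists (Ordinal (colK v), (t1, t2)); rewrite /P /= e1 e2; split=> //.
  by split=> //; exists a, p, p', b.
have dA0 : 0 < dens R A by apply: le_lt_trans lt; rewrite mulr_ge0 // ltW.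
have mA : many (dens R A) (fun v => exists I, P I v).
  by apply: dens_sub; apply/subsetP=> v /AP; rewrite inE => /asboolP.
have [I] := many_pigeon dA0 mA.
have cI : #|{: 'I_K * (k.-tuple 'I_K * k.-tuple 'I_K)}| = (K * (K ^ k * K ^ k))%N.
  by rewrite !card_prod !card_tuple card_ord.
rewrite cI => mI; set N := (K * _)%N in mI lt.
have N0 : 0 < N%:R :> R.
  rewrite ltr0n lt0n; apply/negP => /eqP N0; move: mI; rewrite N0 invr0 mulr0 => _.
  have [v vA] : exists v, v \in A by apply: (@dens_gt0 R).
  by have K0 : (0 < K)%N := leq_ltn_trans (leq0n _) (colK v); move: N0; rewrite /N;
    apply/eqP; rewrite -lt0n !muln_gt0 K0 expn_gt0 K0.
have dN : d < dens R A / N%:R by rewrite ltr_pdivlMr // mulrC.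
have mIv := many_ex (lt_trans d0 dN) mI;
  case: mIv => v [_ _ _ [_ _ [a [p [p' [b [e1 e2 pp]]]]]]].
apply: pp; apply: (gd (val I.1 :: a) _ _ b).
  rewrite /= -e1; apply: many_le mI; first exact: ltW.
  by move=> u [? ? ? []].
rewrite /= -e2; apply: many_le mI; first exact: ltW.
by move=> u [? ? ? []].
Qed.

End Freq.

(** Edges are sorted by their first end. Admissible ends that see many admissible partners have
    density below [d], any other end sees fewer than [d] of them, and [B] is charged on both
    sides. *)
Lemma nonfreq_edens (R : realType) (V : finType) (E : rel V) (col : V -> nat)
    (Y Z B : {set V}) (d : R) t s : 0 <= d ->
  ~ many d (fun u => [/\ u \in Y, u \notin B, col u = t & many d (fun w =>
       [/\ w \in Z, w \notin B, col w = s & E u w])]) ->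
  edens R E (Y :&: col_class col t) (Z :&: col_class col s) <= 2 * d + 2 * dens R B.
Proof.
move=> d0 /negP; rewrite -ltNge; set A := [set u | _] => dA.
set Y' := _ :&: _; set Z' := Z :&: _.
apply: le_trans (edens_coverl E Z' (_ : Y' \subset (A :|: B) :|: (Y' :\: (A :|:
  B)))) _.
  by apply/subsetP=> v vY; rewrite in_setU in_setD vY andbT orbN.
have h1 : edens R E (A :|: B) Z' <= dens R A + dens R B.
  by apply: le_trans (edens_le_densl _ _ _) (densU _ _).
have h2 : edens R E (Y' :\: (A :|: B)) Z' <= d + dens R B.
  apply: le_trans (edens_le (c := d + dens R B) _) _; last first.
    by rewrite ler_piMr ?dens_le1 // addr_ge0 // dens_ge0.
  move=> u; rewrite !inE negb_or => /andP[/andP[nA uB] /andP[uY /eqP ut]].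
  have := dens_cover (R := R) (_ : Z' :&: out E u \subset
     [set w | `[< [/\ w \in Z, w \notin B, col w = s & E u w] >]] :|: B).
  have -> : Z' :&: out E u \subset
     [set w | `[< [/\ w \in Z, w \notin B, col w = s & E u w] >]] :|: B.
    apply/subsetP=> w; rewrite !inE => /andP[/andP[wZ /eqP ws] Euw].
    by have [wB|wB] := boolP (w \in B); rewrite ?orbT // orbF; apply/asboolP.
  move=> /(_ isT) h; apply: le_trans h _; rewrite lerD2r leNgt; apply/negP => lt.
  by move/asboolP: nA; apply; split=> //; apply: ltW.
by move: h1 h2 dA; clear; lra.
Qed.

(** [kx_sg] is the condition of [bipartite] for the sparsity that [nonfreq_edens] supplies, and
    [kx_be] bounds by [th] the loss of [good_step] together with [B]. *)
Record colouring_ctx (R : realType) (VT V : finType) (G : rel V) (col : V -> nat)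
    (K : nat) (B : {set V}) (q m th e d : R) : Prop := ColouringCtx {
  kx_V : (0 < #|V|)%N;
  kx_r : (3 <= #|VT|)%N;
  kx_q : #|VT|%:R * q = 1;
  kx_d : 0 < d;
  kx_col : forall v, (col v < K)%N;
  kx_leaf : leaf_hyps G q m th;
  kx_e : 0 <= e;
  kx_deg : forall x, dens R (~: out G x) <= q + e /\
                     dens R (~: out (converse G) x) <= q + e;
  kx_eth : 8 * (#|VT|%:R * e) <= th;
  kx_sg : 64 * K%:R ^+ 2 * (2 * d + 2 * dens R B) <= th ^+ 2;
  kx_be : (K * (K ^ #|VT| * K ^ #|VT|))%:R * d + dens R B <= th
}.

Section Climb.
Variables (R : realType) (VT V : finType) (T : rel VT) (G : rel V) (col : V -> nat).
Variables (K : nat) (B : {set V}) (q m th e d : R).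
Hypothesis C : colouring_ctx VT G col K B q m th e d.
Local Notation good := (good T G col B d).
Local Notation cand := (cand T G).

Lemma ctx_small : [/\ 0 < q, 3 * q <= 1, 0 < th, 4000 * th <= q & e <= th / 8].
Proof.
have [q0 _ _ thm] := leaf_small (kx_leaf C); have mq := lh_mq (kx_leaf C).
have q3 := lh_q1 (kx_leaf C); have th0 := lh_th0 (kx_leaf C).
have e0 := kx_e C; have eth := kx_eth C; split=> //; first by lra.
have : 1 * e <= #|VT|%:R * e.
  by rewrite ler_wpM2r // ler1n; apply: leq_trans (kx_r C).
by lra.
Qed.

Lemma K_gt0 : (0 < K)%N.
Proof. by case/card_gt0P: (kx_V C) => v _; apply: leq_ltn_trans (kx_col C v). Qed.

Lemma good_large a todo es s : (size todo <= #|VT|)%N -> good (a :: todo) es s ->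
  dens R (cand es s a :\: [set v in cand es s a | `[< good todo (a :: es) (v :: s)
    >]]) <= th.
Proof.
move=> sz /(good_step (kx_d C) (kx_col C)) h.
apply: le_trans (dens_cover (_ : _ \subset
  [set v in cand es s a | (v \notin B) && ~~ `[< good todo (a :: es) (v :: s) >]]
    :|: B)) _.
  apply/subsetP=> v; rewrite !inE => /andP[+ vc]; rewrite vc /= => ->.
  by rewrite andbT orNb.
apply: le_trans (kx_be C); rewrite lerD2r; apply: le_trans h _.
rewrite ler_wpM2r ?(ltW (kx_d C)) // ler_nat leq_mul2l leq_mul ?orbT //.
  by rewrite leq_pexp2l ?K_gt0.
by rewrite leq_pexp2l ?K_gt0.
Qed.

Lemma cand_large es s b : (size s <= #|VT|)%N ->
  1 - (size s)%:R * q - th / 8 <= dens R (cand es s b).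
Proof.
move=> sz; apply: le_trans (cand_dens T (kx_V C) (kx_deg C) es s b).
have e0 := kx_e C; have eth := kx_eth C.
have : (size s)%:R * e <= #|VT|%:R * e by rewrite ler_wpM2r // ler_nat.
by rewrite mulrDr; lra.
Qed.

Lemma cand_large3 es s b : (size s + 3 <= #|VT|)%N ->
  3 * q - th / 8 <= dens R (cand es s b).
Proof.
move=> sz; apply: le_trans (cand_large es b (leq_trans (leq_addr _ _) sz)).
rewrite lerD2r lerBrDr -mulrDl -natrD -[leRHS](kx_q C) ler_wpM2r ?ler_nat //.
  by have [/ltW] := ctx_small.
by rewrite addnC.
Qed.

Lemma deg_diff (A : {set V}) x :
  dens R (A :\: out G x) <= q + e /\ dens R (A :\: out (converse G) x) <= q + e.
Proof.
have [h1 h2] := kx_deg C x; split; [apply: le_trans h1|apply: le_trans h2].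
  by rewrite setDE; apply/dens_sub/subsetIr.
by rewrite setDE; apply/dens_sub/subsetIr.
Qed.

Lemma cand_large2 es s b : (size s + 2 = #|VT|)%N ->
  2 * q - th / 8 <= dens R (cand es s b).
Proof.
move=> sz; apply: le_trans (cand_large es b _); last by rewrite -sz leq_addr.
by rewrite lerD2r lerBrDr -mulrDl -natrD -[leRHS](kx_q C) -sz addnC.
Qed.

Lemma cand_cons x y v es s (E : rel V) : (forall u, tadj T G x y v u = E v u) ->
  cand (x :: es) (v :: s) y = cand es s y :&: out E v.
Proof. by move=> tE; rewrite /= setIC; congr setI; apply/setP=> u; rewrite !inE. Qed.

(** [bipartite] for the relation of frequent colour pairs: goodness in either of the two roles makes
    this relation a partial matching. *)
Lemma good_dichotomy y z es s (E : rel V) : (size s + 2 = #|VT|)%N ->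
  (forall u w, tadj T G y z u w = E u w) -> E = G \/ E = converse G ->
  good [:: y; z] es s ->
  (mono col th (cand es s y) /\ mono col th (cand es s z)) \/
  exists t1 t2 s1 s2, two_coloured col th q E (cand es s y) (cand es s z) t1 t2 s1 s2.
Proof.
move=> sz tE EG gd; have [q0 q3 th0 thq eth] := ctx_small.
pose F t p := freq T G col B d [:: y; z] [:: t; p] es s.
have degE (A : {set V}) x : dens R (A :\: out E x) <= q + e /\
    dens R (A :\: out (converse E) x) <= q + e.
  by have [h1 h2] := deg_diff A x; case: EG => ->; split.
apply: (@bipartite R V col K (kx_col C) F E _ _ q e (2 * d + 2 * dens R B) th).
- exact: K_gt0.
- exact: th0.
- by move: thq th0; lra.
- by rewrite (kx_e C).
- by rewrite addr_ge0 // mulr_ge0 ?dens_ge0 // ltW ?(kx_d C).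
- exact: kx_sg C.
- by move=> u _; have [] := degE (cand es s z) u.
- by move=> u _; have [] := degE (cand es s y) u.
- move=> t p nF; apply: nonfreq_edens; first exact/ltW/(kx_d C).
  move=> h; apply: nF; apply: many_le h => // u [uc uB ut h]; split=> //.
  apply: many_le h => // w [wc wB wp Euw]; split=> //.
  by rewrite !inE tE Euw.
- by move=> t p p' h1 h2; apply: (gd [:: t] p p' [::]).
- by move=> t t' p h1 h2; apply: (gd [::] t t' [:: p]).
- exact: cand_large2.
- exact: cand_large2.
Qed.

Definition goodset a todo es s :=
  [set v in cand es s a | `[< good todo (a :: es) (v :: s) >]].

Lemma goodsetP a todo es s v : v \in goodset a todo es s ->
  v \in cand es s a /\ good todo (a :: es) (v :: s).
Proof. by rewrite inE => /andP[? /asboolP]. Qed.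

Lemma goodset_sub a todo es s : goodset a todo es s \subset cand es s a.
Proof. by apply/subsetP=> v /goodsetP[]. Qed.

Lemma leaf_mono_transitive x y z es s : T x y -> T x z -> T y z ->
  (size s + 3 = #|VT|)%N -> good [:: x; y; z] es s ->
  exists t, dens R (cand es s y :\: col_class col t) * q <= th.
Proof.
move=> Txy Txz Tyz sz gd; have [q0 q3 th0 thq eth] := ctx_small.
have s2 : (size [:: y; z] <= #|VT|)%N by rewrite -sz (leq_trans _ (leq_addl _ _)).
have l3 b : 3 * q - th <= dens R (cand es s b).
  by apply: le_trans (cand_large3 es b _); [move: th0; lra | rewrite sz].
apply: (leaf_transitive (X := cand es s x) (X0 := goodset x [:: y; z] es s)
  (Z := cand es s z) (kx_leaf C)) => //.
- exact: goodset_sub.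
- exact: good_large.
move=> v /goodsetP[vc gv].
have hy := @cand_cons x y v es s G (fun u => _).
have hz := @cand_cons x z v es s G (fun u => _).
rewrite -hy; last by rewrite /tadj Txy.
rewrite -hz; last by rewrite /tadj Txz.
apply: good_dichotomy gv; [by rewrite -sz /= addSnnS | | by left].
by move=> u w; rewrite /tadj Tyz.
Qed.

(* If almost all choices in role a leave a monochromatic candidate set for
   role b, then the candidate set before that choice is monochromatic too. *)
Lemma climb b todo : (forall es s, (size es + 3 = #|VT|)%N ->
  (size s + 3 = #|VT|)%N ->
    good todo es s -> exists t, dens R (cand es s b :\: col_class col t) * q <= th) ->
  size todo = 3%N -> 12 * th <= q ^+ #|VT|.+1 ->
  forall pre es s, (size pre + size es + 3 = #|VT|)%N -> size s = size es ->
  good (pre ++ todo) es s ->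
  exists t, dens R (cand es s b :\: col_class col t) * q ^+ (size pre).+1 <= th.
Proof.
move=> leaf sz3 thqr; have [q0 q3 th0 thq eth] := ctx_small.
have q1 : q <= 1 by move: q0 q3; lra.
elim=> [|a pre IH] es s sz ses gd; first by rewrite expr1; apply: leaf; rewrite ?ses.
(* Each released role divides the error by [q]; the bound [12 * th <= q ^+ #|VT|.+1] keeps [th']
   small enough for [mono_fibres] all the way. *)
pose th' := th / q ^+ (size pre).+1.
have qp : 0 < q ^+ (size pre).+1 by rewrite exprn_gt0.
have th'0 : 0 < th' by rewrite divr_gt0.
have th'q : 12 * th' <= q.
  rewrite /th' mulrA ler_pdivrMr // -exprS; apply: le_trans thqr _.
  by rewrite ler_wiXn2l // ?ltW // -sz /= ltnS -addnA leq_addr.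
have thth' : th <= th'.
  by rewrite ler_pdivlMr // ler_piMr ?exprn_ile1 // ltW.
pose E : rel V := if T a b then G else converse G.
have [t ht] : exists t, dens R (cand es s b :\: col_class col t) * q <= th'.
  have degE (A : {set V}) x : dens R (A :\: out E x) <= q + th /\
      dens R (A :\: out (converse E) x) <= q + th.
    have [h1 h2] := deg_diff A x; rewrite /E.
    by case: ifP => _; split; [move: h1|move: h2|move: h2|move: h1]; move: eth th0;
      lra.
  have lc c : 3 * q - th <= dens R (cand es s c).
    by apply: le_trans (cand_large3 es c _); [move: th0;
      lra | rewrite ses -sz leq_add2r leq_addl].
  apply: (@mono_fibres _ _ _ E (cand es s a) _ (goodset a (pre ++ todo) es s) q th
    th th') => //.
  - exact: ltW.
  - by move: th'q thth'; lra.
  - exact: ltW.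
  - exact: ltW.
  - exact: goodset_sub.
  - by apply: good_large => //; rewrite size_cat sz3 -sz leq_add2r (leq_trans
    (leqnSn _) (leq_addr _ _)).
  - by move=> x _; have [] := degE (cand es s b) x.
  - by move=> x _; have [] := degE (cand es s a) x.
  move=> v /goodsetP[vc gv].
  have [||t ht] := IH (a :: es) (v :: s) _ _ gv; rewrite /= ?ses //.
    by rewrite -sz /= addSnnS.
  exists t; rewrite -(cand_cons (x := a)); last by move=> u; rewrite /tadj /E;
    case: (T a b).
  by rewrite /th' ler_pdivlMr.
by exists t; rewrite exprS mulrA -ler_pdivlMr.
Qed.

(** With only three roles the candidate sets after choosing [v] for [x] are its whole out- and
    in-neighbourhood. One two-coloured [v] already produces the rotation; if there is none,
    [mono_fibres] applies to the out-neighbourhoods. *)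
Lemma leaf_cyclic x y z lam l1 : T x y -> T y z -> T z x -> T x z = false ->
  #|VT| = 3%N -> good [:: x; y; z] [::] [::] ->
  10 * th <= lam -> 40 * lam <= m -> K%:R * l1 <= lam -> l1 <= lam -> 0 < l1 ->
  192 * th <= l1 ^+ 2 -> dens R B <= l1 / 8 -> d <= l1 / 8 ->
  (exists t, dens R (~: col_class col t) * q <= th) \/
  exists X Y Z, rotation G q X Y Z (5 * lam).
Proof.
move=> Txy Tyz Tzx Txz r3 gd thlam lamm Kl1 l1lam l10 thl1 Bl1 dl1.
have [q0 q3 th0 thq eth] := ctx_small.
pose X0 := goodset x [:: y; z] [::] [::].
have dich v : v \in X0 -> (mono col th (out G v) /\ mono col th (out (converse G)
  v)) \/
    exists t1 t2 s1 s2, two_coloured col th q G (out G v) (out (converse G) v) t1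
      t2 s1 s2.
  move=> /goodsetP[vc gv].
  have hy := @cand_cons x y v [::] [::] G (fun u => _).
  have hz := @cand_cons x z v [::] [::] (converse G) (fun u => _).
  have [] := @good_dichotomy y z [:: x] [:: v] G _ _ _ gv.
  - by rewrite r3.
  - by move=> u w; rewrite /tadj Tyz.
  - by left.
  - rewrite hy ?hz; last 2 first.
    + by rewrite /tadj ?Txy ?Txz.
    + by rewrite /tadj ?Txy ?Txz.
    by rewrite /= !setTI; left.
  rewrite hy ?hz; last 2 first.
  + by rewrite /tadj ?Txy ?Txz.
  + by rewrite /tadj ?Txy ?Txz.
  by rewrite /= !setTI; right.
have [[v vX [t1 [t2 [s1 [s2 tc]]]]]|no] := pselect (exists2 v, v \in X0 &
    exists t1 t2 s1 s2, two_coloured col th q G (out G v) (out (converse G) v) t1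
      t2 s1 s2).
  right; have cc := two_coloured_cyclic (kx_leaf C) tc.
  have tx : triangle_ctx G col K q m th lam l1
      (fun p1 p2 p3 => freq T G col B d [:: x; y; z] [:: p1; p2; p3] [::] [::]).
    split=> //; [exact: kx_col C | exact: kx_leaf C | by have := kx_q C;
      rewrite r3 | | ].
      move=> A1 A2 A3 p1 p2 p3 s_1 s_2 s_3 a1 a2 a3 e12 e23 e31.
      have hl : 64 * (3 * th) <= l1 ^+ 2 by move: thl1; lra.
      apply: many_le (many_triangles l10 hl Bl1 dl1 a1 a2 a3 e12 e23 e31) => //.
      move=> u [uA uB h]; split; rewrite ?inE //.
        by move: (subsetP s_1 u uA); rewrite inE => /eqP.
      apply: many_le h => // w [wA wB uw h]; split; rewrite ?inE /tadj ?Txy ?uw //.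
        by move: (subsetP s_2 w wA); rewrite inE => /eqP.
      apply: many_le h => // w' [w'A w'B ww' w'u].
      split; rewrite ?inE /tadj ?Txz ?Tyz ?ww' ?w'u //.
      by move: (subsetP s_3 w' w'A); rewrite inE => /eqP.
    by move=> p1 p2 p3 p3' h1 h2; apply: (gd [:: p1; p2] p3 p3' [::]).
  have [c1|c2] := cyclic_classes_close tx cc.
    exact: cyclic_rotation tx cc c1.
  exact: cyclic_rotation tx (cyclic_classes_sym cc) c2.
left; have T1 : dens R [set: V] = 1 by apply: densT1 (kx_V C).
have q3' : 3 * q = 1 by have := kx_q C; rewrite r3.
suff [t ht] : exists t, dens R (setT :\: col_class col t) * q <= th.
  by exists t; rewrite -setTD.
apply: (@mono_fibres R V col G setT setT X0 q th th th) => //.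
- exact: ltW.
- by move: thq th0; lra.
- exact: ltW.
- exact: ltW.
- by apply: (@good_large x [:: y; z] [::] [::]) gd; rewrite r3.
- by rewrite T1 q3'; move: th0; lra.
- by rewrite T1 q3'; move: th0; lra.
- by move=> v _; have [h _] := deg_diff setT v; move: h eth th0; lra.
- by move=> v _; have [_ h] := deg_diff setT v; move: h eth th0; lra.
- move=> v vX; rewrite setTI; have [[] //|tc] := dich v vX.
  by case: no; exists v.
Qed.

End Climb.

(** * Transitive and cyclic triples in tournaments *)

Section Triples.
Variables (VT : finType) (T : rel VT).
Hypothesis tT : tournament T.

Lemma tour_irr x y : T x y -> x != y.
Proof. by apply: contraTneq => ->; rewrite tT.1. Qed.

Lemma tour_asym x y : T x y -> T y x = false.
Proof.
move=> xy; have := tT.2 x y (tour_irr xy); rewrite xy.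
by case: (T y x).
Qed.

Lemma tour_total x y : x != y -> T x y \/ T y x.
Proof. by move=> /tT.2; case: (T x y); [left | right]. Qed.

Lemma transitive_triple x y z : T x y -> T x z -> y != z ->
  exists a b c, [/\ uniq [:: a; b; c], T a b, T a c & T b c].
Proof.
move=> xy xz yz; have [yz'|zy] := tour_total yz.
  by exists x, y, z; rewrite /= !inE negb_or yz !tour_irr.
by exists x, z, y; rewrite /= !inE negb_or eq_sym [z == x]eq_sym [z == y]eq_sym yz
  !tour_irr.
Qed.

(** Without a transitive triple all outdegrees are at most 1, so three distinct vertices always form
    a cycle. A fourth vertex would have to dominate both [a] and [b], whose single out-neighbours
    lie on the cycle. *)
Lemma tournament_triple : (3 <= #|VT|)%N ->
  (exists a b c, [/\ uniq [:: a; b; c], T a b, T a c & T b c]) \/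
  (exists a b c, [/\ #|VT| = 3%N, uniq [:: a; b; c], T a b, T b c & T c a]).
Proof.
move=> r3.
have [x [y [z u]]] : exists x y z : VT, uniq [:: x; y; z].
  move: (enum_uniq VT); have : (3 <= size (enum VT))%N by rewrite -cardE.
  case: (enum VT) => [|x [|y [|z s]]] //= _.
  by rewrite !inE !negb_or => /and3P[/and3P[h1 h2 _] /andP[h3 _] _];
     exists x, y, z; rewrite /= !inE negb_or h1 h2 h3.
have [tr|no] := pselect (exists a b c, [/\ uniq [:: a; b; c], T a b, T a c & T b c]).
  by left.
have out1 a b c : T a b -> T a c -> b = c.
  by move=> ab ac; apply/eqP/negPn/negP => bc; apply: no;
    apply: transitive_triple ab ac bc.
have cyc a b c : uniq [:: a; b; c] -> T a b -> T b c /\ T c a.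
  rewrite /= !inE negb_or => /and3P[/andP[nab nac] nbc _] ab.
  have ca : T c a.
    have [ac|//] := tour_total nac; by rewrite (out1 _ _ _ ab ac) eqxx in nbc.
  split=> //; have [//|cb] := tour_total nbc.
  by rewrite (out1 _ _ _ ca cb) eqxx in nab.
have [a [b [c [u' ab]]]] : exists a b c, uniq [:: a; b; c] /\ T a b.
  have : x != y by move: u; rewrite /= !inE negb_or => /and3P[/andP[]].
  move=> /tour_total[xy|yx]; first by exists x, y, z.
  exists y, x, z; split=> //; move: u; rewrite /= !inE !negb_or [y == x]eq_sym.
  by move=> /and3P[/andP[-> ->] -> _].
have [bc ca] := cyc _ _ _ u' ab.
right; exists a, b, c; split=> //; apply/eqP; rewrite eqn_leq r3 andbT leqNgt.
apply/negP => r4; have [w] : exists w, w \notin [:: a; b; c].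
  apply: contrapT => nw; move: r4; rewrite ltnNge => /negP; apply.
  have -> : #|VT| = #|[:: a; b; c]|; last by rewrite (card_uniqP u').
  apply: eq_card => w; rewrite [RHS]inE; apply/esym/negPn/negP => h.
  by apply: nw; exists w.
rewrite !inE !negb_or => /and3P[wa wb wc].
have wa' : T w a.
  by have [//|aw] := tour_total wa; rewrite (out1 _ _ _ ab aw) eqxx in wb.
have wb' : T w b.
  by have [//|bw] := tour_total wb; rewrite (out1 _ _ _ bc bw) eqxx in wc.
by have := tour_irr ab; rewrite (out1 _ _ _ wa' wb') eqxx.
Qed.

Lemma cyclic_iso_C3 a b c : #|VT| = 3%N -> uniq [:: a; b; c] ->
  T a b -> T b c -> T c a -> digraph_iso T C3.
Proof.
move=> r3 u ab bc ca.
have mem x : x \in [:: a; b; c].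
  have ces : #|[:: a; b; c]| = #|VT| by rewrite (card_uniqP u) r3.
  by rewrite (subset_cardP ces (subset_predT _)).
pose f x : 'I_3 := inord (index x [:: a; b; c]).
have idx x : (index x [:: a; b; c] < 3)%N by rewrite -[3%N]/(size [:: a; b;
  c]) index_mem.
exists f.
  apply: inj_card_bij; last by rewrite card_ord r3.
  move=> x y /(congr1 val); rewrite /= !inordK // => e.
  by rewrite -(nth_index a (mem x)) e nth_index.
have nT x : T x x = false := tT.1 x.
move: (u); rewrite /= !inE negb_or => /and3P[/andP[/negbTE nab /negbTE nac] /negbTE
  nbc _].
have nba : (b == a) = false by rewrite eq_sym.
have nca : (c == a) = false by rewrite eq_sym.
have ncb : (c == b) = false by rewrite eq_sym.
move=> x y; have := mem x; have := mem y; rewrite !inE /C3 -val_eqE /= !inordK //.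
have fa : index a [:: a; b; c] = 0%N by rewrite /= eqxx.
have fb : index b [:: a; b; c] = 1%N by rewrite /= nab eqxx.
have fc : index c [:: a; b; c] = 2%N by rewrite /= nac nbc eqxx.
by move=> /or3P[] /eqP-> /or3P[] /eqP->;
  rewrite ?fa ?fb ?fc ?nT ?ab ?bc ?ca ?(tour_asym ab) ?(tour_asym bc) ?(tour_asym ca).
Qed.

End Triples.

(** * From the hypotheses on the digraph to one dominant colour *)

Lemma superset_of_size (V : finType) (D : {set V}) k : (#|D| <= k <= #|V|)%N ->
  exists S : {set V}, D \subset S /\ #|S| = k.
Proof.
move=> /andP[Dk kV]; exists (D :|: [set x in take (k - #|D|) (enum (~: D))]).
split; first exact: subsetUl.
have sz : (k - #|D| <= size (enum (~: D)))%N.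
  by rewrite -cardE [leqRHS]cardsCs setCK leq_sub2r.
rewrite cardsU (_ : _ :&: _ = set0) ?cards0 ?subn0; last first.
  apply/setP=> x; rewrite !inE; apply/negbTE/negP => /andP[xD /mem_take].
  by rewrite mem_enum inE xD.
rewrite cardsE (card_uniqP _) ?take_uniq ?enum_uniq // size_takel //.
by rewrite subnKC.
Qed.

(** A set that is slightly too small is enlarged to size [#|V| / r] rounded up. This adds density at
    most [m / 4], half for the deficit and half for rounding, so at most [m / 2] of the edge density
    [m] of the larger set is due to added vertices. *)
Lemma noindep_edens (R : realType) (V : finType) (G : rel V) (m : R) r (D : {set V}) :
  (0 < #|V|)%N -> (0 < r)%N -> #|V|%:R^-1 <= m / 8 ->
  ~ (exists S : {set V}, #|V|%:R / r%:R <= #|S|%:R :> R /\ gamma_independent G m S) ->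
  r%:R^-1 - m / 8 <= dens R D -> m / 2 <= edens R G D D.
Proof.
move=> V0 r0 Vm no Dl.
have V0R : 0 < #|V|%:R :> R by rewrite ltr0n.
have r0R : 0 < r%:R :> R by rewrite ltr0n.
have big (S : {set V}) : (#|V| <= r * #|S|)%N -> m <= edens R G S S.
  move=> hS; rewrite leNgt; apply/negP => lt; apply: no; exists S; split.
    by rewrite ler_pdivrMr // -natrM ler_nat mulnC.
  move: lt; rewrite edens_card ltr_pdivrMr ?exprn_gt0 // => /ltW; congr (_%:R <= _).
have m0 : 0 <= m by have := invr_ge0 (#|V|%:R : R); rewrite (ltW V0R); lra.
have [hD|hD] := leqP #|V| (r * #|D|).
  by have := big D hD; lra.
pose k := ((#|V| + r.-1) %/ r)%N.
have hk : (#|V| <= r * k /\ r * k <= #|V| + r.-1)%N.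
  rewrite /k; have := divn_eq (#|V| + r.-1) r; have := ltn_pmod (#|V| + r.-1) r0.
  by lia.
have Dk : (#|D| <= k)%N by rewrite -(leq_pmul2l r0); lia.
have kV : (k <= #|V|)%N by rewrite -(leq_pmul2l r0); nia.
have [S [sDS cS]] : exists S : {set V}, D \subset S /\ #|S| = k.
  by apply: superset_of_size; rewrite Dk kV.
have SD : dens R (S :\: D) <= m / 4.
  have := densID (R := R) D S; rewrite (setIidPr sDS).
  have : dens R S <= r%:R^-1 + #|V|%:R^-1.
    rewrite /dens cS ler_pdivrMr // mulrDl mulVf ?gt_eqF //.
    rewrite -(ler_pM2l r0R) mulrDr mulr1 mulrA mulfV ?gt_eqF // mul1r.
    by rewrite -natrM -natrD ler_nat; lia.
  by lra.
have := big S (_ : (#|V| <= r * #|S|)%N); rewrite cS => /(_ (proj1 hk)).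
have := edens_coverr (R := R) G S (_ : S \subset D :|: (S :\: D)).
have := edens_coverl (R := R) G D (_ : S \subset D :|: (S :\: D)).
have -> : S \subset D :|: (S :\: D).
  by apply/subsetP=> x xS; rewrite !inE xS andbT orbN.
move=> /(_ isT) + /(_ isT).
have := edens_le_densr (R := R) G S (S :\: D).
have := edens_le_densl (R := R) G (S :\: D) D.
by move: SD; clear; lra.
Qed.

(** The constants [lam], [l1], [th] and [d0] are fixed in this order before any digraph. The roles
    are ordered with the triple last, so that the triple is the leaf and [climb] releases all the
    others. *)
Lemma colour_structure (R : realType) r K (m tau : R) :
  (3 <= r)%N -> (0 < K)%N -> 0 < m -> m <= r%:R^-1 -> 0 < tau ->
  exists2 d0 : R, 0 < d0 &
  forall (VT V : finType) (T : rel VT) (G : rel V) (col : V ->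
    nat) (B : {set V}) (e d : R),
    #|VT| = r -> tournament T -> (0 < #|V|)%N ->
    (forall x, dens R (~: out G x) <= r%:R^-1 + e /\
               dens R (~: out (converse G) x) <= r%:R^-1 + e) ->
    ~ (exists S : {set V}, #|V|%:R / r%:R <= #|S|%:R :> R /\ gamma_independent G m
      S) ->
    (digraph_iso T C3 -> ~ alpha_contains m G (@Ex #|V|)) ->
    0 <= e <= d0 -> 0 < d <= d0 -> dens R B <= d0 -> #|V|%:R^-1 <= d0 ->
    (forall v, (col v < K)%N) ->
    (forall es, perm_eq es (enum VT) -> good T G col B d es [::] [::]) ->
    exists t, dens R (~: col_class col t) <= tau.
Proof.
move=> r3 K0 m0 mr tau0; set q : R := r%:R^-1.
have r0R : 0 < r%:R :> R by rewrite ltr0n; apply: leq_trans r3.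
have q0 : 0 < q by rewrite invr_gt0.
have rq : r%:R * q = 1 by rewrite mulfV ?gt_eqF.
have q3 : 3 * q <= 1.
  by apply: le_trans (_ : r%:R * q <= _); [rewrite ler_pM2r // ler_nat | rewrite rq].
have q1 : q <= 1 by move: q0 q3; clear; lra.
have K1 : 1 <= K%:R :> R by rewrite ler1n.
have KR : 0 < K%:R :> R by rewrite ltr0n.
pose lam := m / 200; pose l1 := lam / K%:R.
have lam0 : 0 < lam by rewrite divr_gt0.
have l10 : 0 < l1 by rewrite divr_gt0.
have Kl1 : K%:R * l1 <= lam by rewrite mulrC mulfVK ?gt_eqF.
have l1lam : l1 <= lam by rewrite ler_pdivrMr // ler_peMr // ltW.
have min4 (a b c x : R) : 0 < a -> 0 < b -> 0 < c -> 0 < x ->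
    exists2 y, 0 < y & [/\ y <= a, y <= b, y <= c & y <= x].
  move=> a0 b0 c0 x0; exists (Num.min (Num.min a b) (Num.min c x)).
    by rewrite !lt_min a0 b0 c0 x0.
  by rewrite !ge_min !lexx !orbT.
(* In turn: the bound in [leaf_hyps], the bound in [climb], the reduction of the climbed error to
   [tau], and [tx_th]. *)
have [th1 th10 [tha thb thc thd]] : exists2 y, 0 < y & [/\ y <= m ^+ 3 / 3000,
    y <= q ^+ r.+1 / 12, y <= tau * q ^+ r & y <= lam / 10].
  by apply: min4; rewrite ?divr_gt0 ?mulr_gt0 ?exprn_gt0.
pose th := Num.min th1 (l1 ^+ 2 / 192).
have th0 : 0 < th by rewrite lt_min th10 divr_gt0 // exprn_gt0.
have thth1 : th <= th1 by rewrite ge_min lexx.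
have the : th <= l1 ^+ 2 / 192 by rewrite ge_min lexx orbT.
pose N := (K * (K ^ r * K ^ r))%N.
have N1 : 0 < N%:R + 1 :> R by rewrite ltr_wpDl.
(* In turn these serve [kx_eth], [kx_sg], [kx_be] and the size conditions of [many_triangles]. *)
have [d1 d10 [da db dc dd]] : exists2 y, 0 < y & [/\ y <= th / (8 * r%:R),
    y <= th ^+ 2 / (256 * K%:R ^+ 2), y <= th / (N%:R + 1) & y <= l1 / 8].
  by apply: min4; rewrite ?divr_gt0 ?mulr_gt0 ?exprn_gt0.
pose d0 := Num.min d1 (m / 16).
have d00 : 0 < d0 by rewrite lt_min d10 divr_gt0.
have d0d1 : d0 <= d1 by rewrite ge_min lexx.
have d0m : d0 <= m / 16 by rewrite ge_min lexx orbT.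
exists d0 => // VT V T G col B e d VTr tT V0 degG no noEx /andP[e0 ed0] /andP[d_0
  dd0] Bd Vd colK gd.
have ethr : 8 * (r%:R * e) <= th.
  rewrite mulrA -ler_pdivlMl ?mulr_gt0 // mulrC.
  by apply: le_trans ed0 _; apply: le_trans d0d1 _.
have thm : 3000 * th <= m ^+ 3 by move: tha thth1; clear; lra.
have eth : e <= th.
  have : 1 * e <= r%:R * e by rewrite ler_wpM2r // ler1n; apply: leq_trans r3.
  by move: ethr th0 e0; clear; lra.
have leaf : leaf_hyps G q m th.
  split=> //.
  - by move=> x; have [h _] := degG x; move: h eth; rewrite -/q; clear; lra.
  - by move=> x; have [_ h] := degG x; move: h eth; rewrite -/q; clear; lra.
  - move=> D hD; apply: (noindep_edens (r := r)) => //; first exact: leq_trans r3.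
    by move: Vd d0m m0; clear; lra.
have C : colouring_ctx VT G col K B q m th e d.
  split=> //; rewrite ?VTr //.
  - have hk : 0 < 256 * K%:R ^+ 2 :> R by rewrite mulr_gt0 // exprn_gt0.
    have h1 : d <= th ^+ 2 / (256 * K%:R ^+ 2)
      by apply: le_trans dd0 (le_trans d0d1 db).
    have h2 : dens R B <= th ^+ 2 / (256 * K%:R ^+ 2)
      by apply: le_trans Bd (le_trans d0d1 db).
    move: h1 h2; rewrite !ler_pdivlMr //.
    by move=> h1 h2; rewrite mulrDr; move: h1 h2; clear; lra.
  - rewrite -/N.
    have h1 : d <= th / (N%:R + 1) by apply: le_trans dd0 (le_trans d0d1 dc).
    have h2 : dens R B <= th / (N%:R + 1) by apply: le_trans Bd (le_trans d0d1 dc).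
    have h3 : N%:R * d <= N%:R * (th / (N%:R + 1)) by rewrite ler_wpM2l.
    apply: le_trans (lerD h3 h2) _;
      rewrite -[X in _ + X]mul1r -mulrDl mulrC mulfVK ?gt_eqF //.
have rest a b c : uniq [:: a; b; c] -> exists pre, perm_eq (pre ++ [:: a; b;
  c]) (enum VT)
    /\ (size pre + 3 = r)%N.
  move=> u; exists [seq x <- enum VT | x \notin [:: a; b; c]].
  set pre := [seq x <- _ | _].
  have hp : perm_eq (pre ++ [:: a; b; c]) (enum VT).
    apply: uniq_perm; rewrite ?enum_uniq //.
      rewrite cat_uniq u filter_uniq ?enum_uniq // andbT; apply/hasPn => x xabc.
      by rewrite mem_filter xabc.
    by move=> x; rewrite mem_cat mem_filter mem_enum andbT orbC orbN.
  by split=> //; have := perm_size hp; rewrite size_cat -cardE VTr.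
have qr k : (k <= r)%N -> forall x : R, 0 <= x -> x * q ^+ k <= th -> x <= tau.
  move=> kr x x0 hx; have : x * q ^+ r <= tau * q ^+ r.
    apply: le_trans (_ : x * q ^+ k <= _).
      by rewrite ler_wpM2l // ler_wiXn2l // ltW.
    by apply: le_trans hx _; apply: le_trans thc.
  by rewrite ler_pM2r // exprn_gt0.
have r3' : (3 <= #|VT|)%N by rewrite VTr.
have [[a [b [c [u Tab Tac Tbc]]]]|[a [b [c [VT3 u Tab Tbc Tca]]]]] :=
  tournament_triple tT r3'.
  have [pre [hp sp]] := rest _ _ _ u.
  have [t ht] : exists t,
      dens R (cand T G [::] [::] b :\: col_class col t) * q ^+ (size pre).+1 <= th.
    apply: (climb C (todo := [:: a; b; c])) => //.
    - by move=> es s _ ss gs; apply: leaf_mono_transitive C _ _ _ _ _ Tab Tac Tbc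
      ss gs.
    - by rewrite VTr; move: thb thth1; clear; lra.
    - by rewrite addn0 VTr.
    - exact: gd.
  exists t; rewrite -setTD; apply: (qr (size pre).+1) ht; last exact: dens_ge0.
  by rewrite -sp addn3 ltnS leqW.
have [pre [hp sp]] := rest _ _ _ u.
have pre0 : pre = [::] by apply: size0nil; apply/eqP;
  rewrite -(eqn_add2r 3) sp -VTr VT3.
have gabc : good T G col B d [:: a; b; c] [::] [::] by apply: gd; rewrite pre0 in hp.
have [[t ht]|[X [Y [Z rot]]]] : (exists t, dens R (~: col_class col t) * q <= th) \/
    exists X Y Z, rotation G q X Y Z (5 * lam).
  apply: (leaf_cyclic C (l1 := l1) Tab Tbc Tca) => //.
  - exact: tour_asym.
  - by move: thd thth1; clear; lra.
  - by rewrite /lam; move: m0; clear; lra.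
  - by move: the; clear; lra.
  - by apply: le_trans Bd (le_trans d0d1 dd).
  - by apply: le_trans dd0 (le_trans d0d1 dd).
  exists t; apply: (qr 1%N _ _ _ ht); last exact: dens_ge0.
  exact: leq_trans r3.
case: (noEx (cyclic_iso_C3 tT VT3 u Tab Tbc Tca)).
apply: rotation_contains rot _ => //.
  by have := rq; rewrite -VTr VT3.
by rewrite /lam; move: Vd d0m m0; clear; lra.
Qed.

(** * Merging the colour classes *)

(* Exchanging vertices through two copies of T whose colour patterns differ in
   one role multiplies the size of a connecting set by about r + 1. *)
Fixpoint level (r i : nat) : nat :=
  if i is j.+1 then (r.+1 * level r j).+1 else 1%N.

Lemma level_gt0 r i : (0 < level r i)%N.
Proof. by case: i. Qed.

Lemma level_leS r i : (level r i <= level r i.+1)%N.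
Proof. by rewrite /= leqW // mulSn leq_addr. Qed.

Lemma level_le r i j : (i <= j)%N -> (level r i <= level r j)%N.
Proof.
move=> /subnK <-; elim: (j - i)%N => // k IH; rewrite addSn.
exact: leq_trans IH (level_leS r _).
Qed.

Lemma level_double r i : (0 < r)%N -> (2 * level r i <= level r i.+1)%N.
Proof. by move=> r0; rewrite /= leqW // leq_mul2r ltnS r0 orbT. Qed.

Lemma freq_manyk (R : realType) (VT V : finType) (T : rel VT) (G : rel V)
    (col : V -> nat) (B : {set V}) (d : R) todo psi es s :
  pcopy T G es s -> freq T G col B d todo psi es s ->
  manyk d (size todo) (fun s' => [/\ pcopy T G (catrev todo es) (catrev s' s),
    map col s' = psi & all (fun v => v \notin B) s']).
Proof.
elim: todo psi es s => [|e todo IH] [|p psi] es s //= ps.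
move=> h0; apply: (many_le (lexx d) _ h0) => v [vc vB vp hf].
have h := IH psi (e :: es) (v :: s) (introT andP (conj vc ps)) hf.
apply: manyk_le h => // s' _ [h1 h2 h3]; split=> //=; first by rewrite vp h2.
by rewrite vB.
Qed.

Section Levels.
Variables (R : realType) (VT V : finType) (T : rel VT) (G : rel V) (d : R).
Hypotheses (tT : tournament T) (irrG : irreflexive G) (r0 : (0 < #|VT|)%N) (d0 : 0
  < d).
Hypothesis many_tiledT : manyk d #|VT| (tiled T G).
Local Notation Rl i x y := (reach T G d (level #|VT| i) x y).
Local Notation nR i := (fun x y => ~~ `[< reach T G d (level #|VT| i) x y >]).

Lemma Rl_le i j x y : (i <= j)%N -> Rl i x y -> Rl j x y.
Proof.
move=> ij; apply: reach_pad => //; rewrite level_gt0; exact: level_le.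
Qed.

Lemma Rl_comp i x y : many d (fun z => Rl i x z /\ Rl i z y) -> Rl i.+1 x y.
Proof.
move=> /(reach_comp r0 (level_gt0 _ i)); apply: reach_pad => //.
by rewrite muln_gt0 level_gt0 level_double.
Qed.

(* xs is a family of pairwise unconnected vertices, of maximal size in the
   sense that no longer family is pairwise unconnected even one level down. *)
Variables (xs : seq V) (l K : nat).
Hypotheses (xs_far : pairwise (nR l.+1) xs) (xs_K : (size xs <= K)%N).
Hypothesis max_xs : forall ys, size ys = (size xs).+1 -> ~ pairwise (nR l) ys.

Lemma nth_far x0 i j : (i < size xs)%N -> (j < size xs)%N -> i <> j ->
  ~ Rl l.+1 (nth x0 xs i) (nth x0 xs j).
Proof.
move=> ix jx ij; have /(pairwiseP x0) far := xs_far.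
case: (ltngtP i j) => [lt|lt|//] h.
  by have /asboolPn := far i j ix jx lt; apply.
by have /asboolPn := far j i jx ix lt; apply; apply: reach_sym.
Qed.

Definition colour v := find (fun x => `[< Rl l v x >]) xs.

Lemma far_le (ys : seq V) : pairwise (nR l.+1) ys -> pairwise (nR l) ys.
Proof.
by apply: sub_pairwise => x y /=; apply: contra => /asboolP h;
  apply/asboolP/(Rl_le (leqnSn l)).
Qed.

Lemma has_colour v : has (fun x => `[< Rl l v x >]) xs.
Proof.
apply/negPn/negP => no; apply: (@max_xs (v :: xs)) => //=.
by rewrite far_le // andbT all_predC.
Qed.

Lemma colour_lt v : (colour v < size xs)%N.
Proof. by rewrite /colour -has_find has_colour. Qed.

Lemma colour_reach x0 v : Rl l v (nth x0 xs (colour v)).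
Proof. by have /(nth_find x0)/asboolP := has_colour v. Qed.

(** Indices below [K] keep the pigeonhole constant independent of [xs]. The default [v] of [nth] is
    never returned, as both indices are in range. *)
Definition ambiguous : {set V} := [set v | `[< exists I : 'I_K * 'I_K,
  [/\ I.1 <> I.2, (I.1 < size xs)%N, (I.2 < size xs)%N, Rl l v (nth v xs I.1)
    & Rl l v (nth v xs I.2)] >]].

(** Otherwise pigeonhole joins one fixed pair of members through a density [d] of middle vertices,
    which connects them at level [l.+1]. *)
Lemma ambiguous_small : dens R ambiguous <= (K * K)%:R * d.
Proof.
rewrite leNgt; apply/negP => lt.
have A0 : 0 < dens R ambiguous by apply: le_lt_trans lt; rewrite mulr_ge0 // ltW.
have [I] := many_pigeon A0 (lexx _).
have cI : #|{: 'I_K * 'I_K}| = (K * K)%N by rewrite card_prod card_ord.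
have K0 : 0 < (K * K)%:R :> R.
  have [v] := dens_gt0 A0; rewrite inE => /asboolP[J _].
  by rewrite -cI ltr0n; apply/card_gt0P; exists J.
rewrite cI => mI; have hd : d <= dens R ambiguous / (K * K)%:R.
  by rewrite ler_pdivlMr // mulrC ltW.
have [v [I12 I1 I2 _ _]] := many_ex (divr_gt0 A0 K0) mI.
apply: (@nth_far v I.1 I.2 I1 I2) => [e|]; first by apply: I12; apply: val_inj.
apply: Rl_comp; apply: many_le mI => // u [_ _ _ h1 h2].
rewrite (set_nth_default u v) // in h1 *; rewrite (set_nth_default u v) // in h2 *.
by split=> //; apply: reach_sym.
Qed.

(** If [u] and [v] were unconnected, both could replace the member of their colour: being
    unambiguous, they are unconnected to all other members, and the family would grow at level
    [l]. *)
Lemma same_colour u v : u \notin ambiguous -> v \notin ambiguous ->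
  colour u = colour v -> Rl l u v.
Proof.
move=> uA vA uv; apply: contrapT => nuv.
pose i := colour u; have ix : (i < size xs)%N := colour_lt u.
pose rest := take i xs ++ drop i.+1 xs.
have far_rest w : w \notin ambiguous -> colour w = i ->
  all (fun y => ~~ `[< Rl l w y >]) rest.
  rewrite inE => wA wi; apply/allP => y yr; apply/asboolPn => Rwy.
  have [j [jx ji jy]] : exists j, [/\ (j < size xs)%N, j <> i & nth w xs j = y].
    move: yr; rewrite mem_cat => /orP[] /(nthP w)[j].
      rewrite (size_takel (ltnW ix)) => ji <-; exists j; rewrite nth_take //.
      by split=> //; [apply: ltn_trans ji ix | move=> e; rewrite e ltnn in ji].
    rewrite size_drop ltn_subRL => jx <-; exists (i.+1 + j)%N; rewrite nth_drop.
    by split=> // /eqP; rewrite -[X in _ == X]addn0 addSnnS eqn_add2l.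
  move/asboolPn: wA; apply.
  exists (Ordinal (leq_trans jx xs_K), Ordinal (leq_trans ix xs_K)); split=> //=.
  - by move=> [].
  - by rewrite jy.
  - by rewrite -wi; apply: colour_reach.
apply: (@max_xs (u :: v :: rest)).
  by rewrite /= size_cat (size_takel (ltnW ix)) size_drop -addnS -subSn // subSS
    subnKC // ltnW.
have nuv' : ~~ `[< Rl l u v >] by apply/asboolPn.
have far_xs := far_le xs_far.
rewrite /= nuv' !far_rest //=.
move: far_xs; rewrite -{1}(cat_take_drop i.+1 xs) (take_nth u) // -cats1.
rewrite !pairwise_cat !allrel_catl /rest.
by move=> /and3P[/andP[-> _] /and3P[_ -> _] ->].
Qed.

(** Two frequent patterns that differ in one role supply the copies for [reach_transfer]. In the
    other roles [same_colour] connects the vertices; in the exceptional role the colours lead to two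
    distinct members of [xs], which would become connected at level [l.+1]. *)
Lemma good_root es : perm_eq es (enum VT) -> good T G colour ambiguous d es [::] [::].
Proof.
move=> hes a p p' b f1 f2; apply: contrapT => pp.
have ses : size es = #|VT| by rewrite (perm_size hes) cardE.
have ues : uniq es by rewrite (perm_uniq hes) enum_uniq.
have sz1 : size (a ++ p :: b) = #|VT| by rewrite (freq_size d0 f1).
have ja : (size a < #|VT|)%N by rewrite -sz1 size_cat /= addnS ltnS leq_addr.
have lt psi : freq T G colour ambiguous d es psi [::] [::] ->
    all (fun c => (c < size xs)%N) psi.
  by apply: freq_lt => // v; apply: colour_lt.
have [px p'x] : (p < size xs)%N /\ (p' < size xs)%N.
  by move: (lt _ f1) (lt _ f2); rewrite !all_cat /= => /and3P[_ -> _] /and3P[_ -> _].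
pose P psi s := [/\ size s = #|VT|, map colour s = psi &
   all (fun v => v \notin ambiguous) s].
have mP psi : freq T G colour ambiguous d es psi [::] [::] ->
    manyk d #|VT| (fun s => tiled T G s /\ P psi s).
  move=> f; have := freq_manyk (isT : pcopy T G [::] [::]) f; rewrite ses.
  apply: manyk_le => // s ss [ps cs As]; split=> //.
  apply: (@tiled_perm _ _ _ _ (rev s)); first by rewrite perm_rev.
  apply: (@pcopy_tiled _ _ T G tT irrG (rev es)).
  - by rewrite rev_uniq.
  - by rewrite size_rev.
  - by rewrite size_rev.
  - by move: ps; rewrite !catrevE !cats0.
have [x0 _] : exists x0, x0 \in xs.
  by case: (xs) px => // x ? _; exists x; rewrite mem_head.
apply: (@nth_far x0 p p' px p'x pp).
rewrite [level _ _]/=; apply: (reach_transfer r0 (level_gt0 _ l) ja (mP _ f1) (mP _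
  f2)).
move=> s s' [ss cs As] [ss' cs' As'] i ir.
have ci := congr1 (fun t => nth 0%N t i) cs.
have ci' := congr1 (fun t => nth 0%N t i) cs'.
rewrite /= (nth_map (nth x0 xs p)) ?ss // in ci.
rewrite /= (nth_map (nth x0 xs p)) ?ss' // in ci'.
case: eqP => [ia|/eqP nia].
  subst i; rewrite nth_cat ltnn subnn /= in ci; rewrite nth_cat ltnn subnn /= in ci'.
  split.
    by have h := colour_reach x0 (nth (nth x0 xs p) s (size a)); rewrite ci in h;
      apply: reach_sym.
  by have h := colour_reach x0 (nth (nth x0 xs p) s' (size a)); rewrite ci' in h.
apply: same_colour.
- by apply: (allP As'); rewrite mem_nth ?ss'.
- by apply: (allP As); rewrite mem_nth ?ss.
rewrite ci ci' !nth_cat; case: ltnP => // ai.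
have : (0 < i - size a)%N by rewrite subn_gt0 ltn_neqAle eq_sym nia ai.
by case: (i - size a)%N.
Qed.

Lemma one_colour_absurd (d1 tau : R) t :
  (1 < size xs)%N -> 0 <= tau -> tau + d <= d1 -> 
  (forall x, many d1 (fun z => reach T G d 1 x z)) ->
  dens R (~: col_class colour t) <= tau -> False.
Proof.
move=> xs2 tau0 hd hm ht.
have [x0 _] : exists x0, x0 \in xs by case: (xs) xs2 => // x ? _; exists x;
  rewrite mem_head.
have [u [qx qt]] : exists u, (u < size xs)%N /\ u <> t.
  have [->|/eqP t0] := eqVneq t 0%N; first by exists 1%N.
  by exists 0%N; split; [apply: ltnW | apply: nesym].
have mt : many d (fun z => reach T G d 1 (nth x0 xs u) z /\ colour z = t).
  have := hm (nth x0 xs u); rewrite /many; set A := [set v | _] => hA.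
  have := densID (R := R) (col_class colour t) A.
  have := dens_sub (R := R) (_ : A :\: col_class colour t \subset ~: col_class
    colour t).
  rewrite setDE subsetIr => /(_ isT) h1 h2.
  apply: le_trans (_ : dens R (A :&: col_class colour t) <= _).
    by move: hA h1 h2 hd ht; lra.
  apply: dens_sub; apply/subsetP=> z; rewrite !inE => /andP[/asboolP h /eqP zt].
  by apply/asboolP.
have [z [_ zt]] := many_ex d0 mt.
have tx : (t < size xs)%N by rewrite -zt colour_lt.
apply: (@nth_far x0 u t qx tx qt); apply: Rl_comp; apply: many_le mt => // y [h yt].
split; last by rewrite -yt; apply: colour_reach.
by apply: (@Rl_le 0).
Qed.

End Levels.

Lemma all_reach (R : realType) r (m : R) : (3 <= r)%N -> 0 < m -> m <= r%:R^-1 ->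
  exists t (d d0 : R), (0 < d /\ 0 < d0) /\
  forall (VT V : finType) (T : rel VT) (G : rel V) (e : R),
    #|VT| = r -> tournament T -> (0 < #|V|)%N -> irreflexive G ->
    (forall x, dens R (~: out G x) <= r%:R^-1 + e /\
               dens R (~: out (converse G) x) <= r%:R^-1 + e) ->
    ~ (exists S : {set V}, #|V|%:R / r%:R <= #|S|%:R :> R /\ gamma_independent G m
      S) ->
    (digraph_iso T C3 -> ~ alpha_contains m G (@Ex #|V|)) ->
    0 <= e <= d0 -> #|V|%:R^-1 <= d0 ->
    manyk d r (tiled T G) /\ forall x y, reach T G d t x y.
Proof.
move=> r3 m0 mr; have r0 : (0 < r)%N by apply: leq_trans r3.
have r0R : 0 < r%:R :> R by rewrite ltr0n.
set q : R := r%:R^-1; have q0 : 0 < q by rewrite invr_gt0.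
have rq : r%:R * q = 1 by rewrite mulfV ?gt_eqF.
pose c := q / 2; have c0 : 0 < c by rewrite divr_gt0.
have [M [d1 [/andP[d10 d1c] hM]]] := reach1 r0 c0.
pose K := M.+1; pose tau := d1 / 2.
have tau0 : 0 < tau by rewrite divr_gt0.
have [D0 D00 struct] := colour_structure r3 (isT : (0 < K)%N) m0 mr tau0.
have KK : 0 < (K * K)%:R :> R by rewrite ltr0n.
have K1 : 1 <= (K * K)%:R :> R by rewrite ler1n.
(* The first bound gives [tau + d <= d1] for [one_colour_absurd]; the second one makes the ambiguous
   set small enough for [colour_structure]. *)
pose d := Num.min tau (D0 / (K * K)%:R).
have d_0 : 0 < d by rewrite lt_min tau0 divr_gt0.
have dtau : d <= tau by rewrite ge_min lexx.
have dD' : d <= D0 / (K * K)%:R by rewrite ge_min lexx orbT.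
have dD : (K * K)%:R * d <= D0 by rewrite mulrC -ler_pdivlMr.
have dD0 : d <= D0.
  by apply: le_trans dD; rewrite ler_peMl // ltW.
pose d0 := Num.min D0 (c / r%:R).
have d00 : 0 < d0 by rewrite lt_min D00 divr_gt0.
have dd1 : d <= d1 by move: dtau d10; rewrite /tau; clear; lra.
exists (level r M), d, d0; split=> //.
move=> VT V T G e VTr tT V0 irrG degG no noEx /andP[e0 ed0] Vd.
have eD : e <= D0 by apply: le_trans ed0 _; rewrite ge_min lexx.
have VD : #|V|%:R^-1 <= D0 by apply: le_trans Vd _; rewrite ge_min lexx.
have hc : r.-1%:R * (q + e) <= 1 - c.
  have er : r%:R * e <= c.
    by rewrite mulrC -ler_pdivlMr //; apply: le_trans ed0 _; rewrite ge_min lexx orbT.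
  have -> : r.-1%:R = r%:R - 1 :> R by rewrite -[in RHS](prednK r0) -natr1 addrK.
  by move: er rq e0; rewrite /c; clear; lra.
have [hm hp] := hM VT V T G (q + e) VTr tT (And3 V0 irrG degG) hc.
have mt : manyk d r (tiled T G).
  have hcT : #|VT|.-1%:R * (q + e) <= 1 - c by rewrite VTr.
  have h := many_tiled tT irrG V0 degG hcT; rewrite VTr in h.
  by apply: manyk_le h => //; apply: le_trans dd1 d1c.
have hm' x : many d1 (fun z => reach T G d 1 x z).
  by apply: many_le (hm x) => // z; apply: manyk_le.
split=> // x y; apply: contrapT => nxy.
have mtT : manyk d #|VT| (tiled T G) by rewrite VTr.
have r0T : (0 < #|VT|)%N by rewrite VTr.
pose nR i := (fun u v => ~~ `[< reach T G d (level #|VT| i) u v >]).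
have [xs sxs far] : exists2 xs : seq V, size xs = M.+2 & pairwise (nR 0%N) xs;
  last first.
  have [i [j [ij hij]]] := hp (fun i : 'I_M => nth x xs i).
  have hij' : reach T G d 1 (nth x xs i) (nth x xs j) by apply: manyk_le hij.
  have ix (k : 'I_M) : (k < size xs)%N by rewrite sxs (leq_trans (ltn_ord k)) // leqW.
  move/(pairwiseP x): far => far.
  case: (ltngtP i j) => [lt|lt|e']; last by move: ij; rewrite (val_inj e') eqxx.
    by have /asboolPn := far i j (ix i) (ix j) lt; apply.
  by have /asboolPn := far j i (ix j) (ix i) lt; apply; apply: reach_sym.
(* The descent, which would end with [M.+2] members at level 0. If a step fails, the current family
   has at most [M.+1] members and satisfies [max_xs], so the colouring argument refutes it. *)
suff main i : (i <= M)%N -> exists2 xs : seq V,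
  size xs = i.+2 & pairwise (nR (M - i)%N) xs.
  by have := main M (leqnn M); rewrite subnn.
elim: i => [|i IH] iM.
  by exists [:: x; y] => //=; rewrite subn0 !andbT /nR VTr; apply/asboolPn.
have [xs sxs far] := IH (ltnW iM); apply: contrapT => nomax.
pose l := (M - i.+1)%N.
have el : (M - i)%N = l.+1 by rewrite /l subnSK.
rewrite el in far.
have xsK : (size xs <= K)%N by rewrite sxs /K ltnS.
have max_xs (ys : seq V) : size ys = (size xs).+1 -> ~ pairwise (nR l) ys.
  by rewrite sxs => sys hys; apply: nomax; exists ys.
have gr es (hes : perm_eq es (enum VT)) :=
  good_root tT irrG r0T d_0 mtT far xsK max_xs hes.
have colK v : (colour T G d xs l v < K)%N.
  by apply: leq_trans xsK; apply: (colour_lt r0T mtT far max_xs).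
have Bs := ambiguous_small r0T d_0 mtT K far.
have [t ht] := struct VT V T G (colour T G d xs l) (ambiguous T G d xs l K) e d
  VTr tT V0 degG no noEx (introT andP (conj e0 eD)) (introT andP (conj d_0 dD0))
  (le_trans Bs dD) VD colK gr.
apply: (one_colour_absurd r0T d_0 mtT far max_xs _ (ltW tau0) _ hm' ht).
  by rewrite sxs.
by move: dtau; rewrite /tau; clear; lra.
Qed.

(** * The absorbing set *)

Lemma manyk_card (R : realType) (V : finType) (d : R) k (P : seq V -> Prop) :
  0 <= d -> (0 < #|V|)%N -> manyk d k P ->
  d ^+ k * (#|V| ^ k)%:R <= #|[set s : k.-tuple V | `[< P s >]]|%:R.
Proof.
move=> d0 V0; have V0R : 0 < #|V|%:R :> R by rewrite ltr0n.
elim: k P => [|k IH] P /= hP.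
  rewrite expr0 mul1r ler_nat; apply/card_gt0P; exists [tuple].
  by rewrite inE; apply/asboolP.
pose S (v : V) := [set s : k.-tuple V | `[< P (v :: s) >]].
have : d * #|V|%:R <= #|[set v | `[< manyk d k (fun s => P (v :: s)) >]]|%:R.
  by move: hP; rewrite /many /dens ler_pdivlMr.
set A' := [set v | _] => hA.
pose X := [set p : V * k.-tuple V | (p.1 \in A') && (p.2 \in S p.1)].
have hX : (#|X| <= #|[set s : k.+1.-tuple V | `[< P s >]]|)%N.
  have inj : injective (fun p : V * k.-tuple V => [tuple of p.1 :: p.2]).
    by move=> [u a] [v b] /(congr1 val) /= [-> /val_inj->].
  rewrite -(card_imset _ inj); apply/subset_leq_card/subsetP=> s /imsetP[[v a]].
  by rewrite !inE /= => /andP[_ h] ->.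
apply: le_trans (_ : #|X|%:R <= _); last by rewrite ler_nat.
have -> : #|X| = (\sum_(v in A') #|S v|)%N.
  rewrite -sum1_card (eq_bigr (fun v => \sum_(s in S v) 1)%N); last by move=> v _;
    rewrite sum1_card.
  by rewrite pair_big_dep /=; apply: eq_bigl => -[v s]; rewrite !inE.
rewrite natr_sum; apply: le_trans (_ : \sum_(v in A') d ^+ k * (#|V| ^ k)%:R <= _);
  last first.
  by apply: ler_sum => v; rewrite inE => /asboolP; apply: IH.
rewrite sumr_const -[(_ * _) *+ _]mulr_natr exprSr expnSr natrM.
have -> : d ^+ k * d * ((#|V| ^ k)%:R * #|V|%:R) = d ^+ k * (#|V| ^ k)%:R * (d *
  #|V|%:R) by ring.
by rewrite ler_wpM2l // mulr_ge0 // exprn_ge0.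
Qed.

(** * Selecting disjoint absorbers for all tuples *)

Section Selection.
Variables (R : realType) (VT V : finType) (T : rel VT) (G : rel V) (r k : nat) (d :
  R).
Hypotheses (V0 : (0 < #|V|)%N) (d0 : 0 < d) (d1 : d <= 1).
Local Notation n := #|V|.
Hypothesis absorbers : forall Q : r.-tuple V,
  manyk d k (fun s => tiled T G s /\ tiled T G (Q ++ s)).
Local Notation eta := ((d / 2) ^+ k).

Definition absorbs (Q s : seq V) : bool := `[< tiled T G (Q ++ s) >].

(* Derandomised selection: with weight 2^-h for an r-tuple that already has h
   absorbers, an average choice lowers the potential by a constant factor. *)
Definition potential (Ss : seq (seq V)) : R :=
  \sum_(Q : r.-tuple V) (1 / 2) ^+ (count (absorbs Q) Ss).

(** Half of [d] pays for distinctness and for avoiding earlier choices, so [eta] bounds the fraction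
    of usable sequences that absorb a given [Q]. Averaging over the usable sequences multiplies the
    weight of each [Q] by at most [1 - eta / 2], and some sequence does as well as the average. *)
Lemma potential_step Ss :
  ((size (flatten Ss))%:R + k%:R) / n%:R <= d / 2 -> exists s,
  [/\ size s = k, uniq s, {in s, forall v, v \notin flatten Ss}, tiled T G s
    & potential (s :: Ss) <= (1 - eta / 2) * potential Ss].
Proof.
move=> small; pose F := [set x in flatten Ss].
pose ok (s : seq V) := [/\ uniq s, [disjoint s & F] & tiled T G s].
pose U := [set s : k.-tuple V | `[< ok s >]].
pose A (Q : r.-tuple V) := [set s : k.-tuple V | (s \in U) && absorbs Q s].
have nR : 0 < n%:R :> R by rewrite ltr0n.
have cA Q : eta * (n ^ k)%:R <= #|A Q|%:R.
  have hF : dens R F + k%:R / n%:R <= d - d / 2.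
    apply: le_trans (_ : d / 2 <= _); last by lra.
    apply: le_trans small; rewrite mulrDl lerD2r ler_wpM2r ?invr_ge0 //.
    by rewrite ler_nat cardsE; apply: leq_trans (card_size _) _.
  have d20 : 0 <= d / 2 by move: d0; lra.
  apply: le_trans (manyk_card d20 V0 (manyk_avoid hF (absorbers Q))) _;
    rewrite ler_nat.
  apply/subset_leq_card/subsetP=> s; rewrite !inE => /asboolP[[h1 h2] us ds].
  by apply/andP; split; apply/asboolP.
have eta0 : 0 < eta by rewrite exprn_gt0 // divr_gt0.
have nk0 : 0 < (n ^ k)%:R :> R by rewrite ltr0n expn_gt0 V0.
have cU : #|U|%:R <= (n ^ k)%:R :> R.
  by rewrite ler_nat -card_tuple; apply: max_card.
have [v0 _] : exists v : V, v \in V by apply/card_gt0P.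
have [s0 s0U] : exists s, s \in U.
  have := cA [tuple of nseq r v0]; have := mulr_gt0 eta0 nk0 => h1 h2.
  have : 0 < #|A [tuple of nseq r v0]|%:R :> R by apply: lt_le_trans h2.
  by rewrite ltr0n => /card_gt0P[s]; rewrite inE => /andP[sU _]; exists s.
have [[s sU hs]|no] := pselect (exists2 s, s \in U &
    potential (val s :: Ss) <= (1 - eta / 2) * potential Ss).
  exists s; move: sU; rewrite inE => /asboolP[us ds ts]; split=> //.
    by rewrite size_tuple.
  by move=> v vs; have := disjointFr ds vs; rewrite inE => ->.
exfalso; pose w Q := (1 / 2 : R) ^+ count (absorbs Q) Ss.
have w0 Q : 0 <= w Q by rewrite exprn_ge0 // divr_ge0.
have : \sum_(s in U) (1 - eta / 2) * potential Ss < \sum_(s in U) potential (val s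
  :: Ss).
  apply: ltr_sum; first by apply/hasP; exists s0; rewrite ?mem_index_enum.
  by move=> s sU; rewrite ltNge; apply/negP => h; apply: no; exists s.
apply/negP; rewrite -leNgt /potential exchange_big /= sumr_const -[(_ * _) *+
  _]mulr_natr.
rewrite [_ * _ * _]mulrAC mulr_sumr; apply: ler_sum => Q _; rewrite -/(w Q).
have -> : \sum_(s in U) (1 / 2 : R) ^+ (absorbs Q (val s) + count (absorbs Q) Ss) =
    (#|U|%:R - #|A Q|%:R / 2) * w Q.
  rewrite (eq_bigr (fun s : k.-tuple V => (1 - (absorbs Q s)%:R / 2) * w Q));
    last first.
    move=> s _; rewrite exprD -/(w Q); congr (_ * _).
    by case: (absorbs Q s) => /=; rewrite ?expr1 ?expr0; lra.
  rewrite -mulr_suml sumrB sumr_const -mulr_suml -natr_sum;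
    congr ((_ - _%:R / _) * _).
  rewrite -sum1_card [RHS](eq_bigl (fun s => (s \in U) && absorbs Q s)); last first.
    by move=> s; rewrite inE.
  by rewrite [RHS]big_mkcondr /=; apply: eq_bigr => s _; case: (absorbs Q s).
rewrite ler_wpM2r //; have := cA Q.
have : eta * #|U|%:R <= eta * (n ^ k)%:R by rewrite ler_wpM2l // ltW.
by move: (eta) => E h1 h2; lra.
Qed.

Lemma selection N : (k%:R * (N%:R + 1)) / n%:R <= d / 2 -> exists Ss : seq (seq V),
  [/\ size (flatten Ss) = (k * N)%N, uniq (flatten Ss),
      forall s, s \in Ss -> tiled T G s
    & potential Ss <= (1 - eta / 2) ^+ N * (n ^ r)%:R].
Proof.
have nR : 0 < n%:R :> R by rewrite ltr0n.
elim: N => [_|N IH hN].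
  exists [::]; split=> //; first by rewrite muln0.
  rewrite /potential expr0 /=; under eq_bigr do rewrite expr0.
  by rewrite sumr_const card_tuple mul1r.
have [|Ss [sz us ts pot]] := IH.
  apply: le_trans hN; rewrite ler_wpM2r ?invr_ge0 // ler_wpM2l // lerD2r ler_nat.
  exact: leqnSn.
have [|s [ss us' dis tS pot']] := potential_step (Ss := Ss).
  apply: le_trans hN; rewrite ler_wpM2r ?invr_ge0 // sz natrM.
  have -> : N.+1%:R = N%:R + 1 :> R by rewrite natr1.
  by have := ler0n R k; lra.
exists (s :: Ss); split=> /=.
- by rewrite size_cat ss sz mulnS.
- rewrite cat_uniq us' us andbT; apply/hasPn => v vS; apply/negP => /dis.
  by rewrite vS.
- by move=> s'; rewrite inE => /predU1P[->|/ts].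
apply: le_trans pot' _; rewrite exprS -mulrA ler_wpM2l //.
have : eta <= 1 by rewrite exprn_ile1 // ?divr_ge0 ?ltW //; move: d1 d0; lra.
by move: (eta) => E; lra.
Qed.

End Selection.

(** Greedy: serving one tuple removes one absorber, which lowers every other count by at most one.
    Leftover absorbers are tiled by themselves. *)
Lemma absorb_all (VT V : finType) (T : rel VT) (G : rel V) (Qs Ss : seq (seq V)) :
  (forall s, s \in Ss -> tiled T G s) ->
  (forall Q, Q \in Qs -> (size Qs <= count (absorbs T G Q) Ss)%N) ->
  tiled T G (flatten Qs ++ flatten Ss).
Proof.
elim: Qs Ss => [|Q Qs IH] Ss tS hQ /=.
  elim: Ss tS {hQ} => [|s Ss IHs] tS /=; first exact: tiled_nil.
  apply: tiled_cat; first by apply: tS; rewrite mem_head.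
  by apply: IHs => s' h; apply: tS; rewrite inE h orbT.
have : has (absorbs T G Q) Ss.
  by rewrite has_count (leq_trans _ (hQ Q (mem_head _ _))).
move=> /hasP[s sS /asboolP ts]; have p := perm_to_rem sS.
have pf : perm_eq (flatten Ss) (s ++ flatten (rem s Ss)) by exact: perm_flatten p.
have := IH (rem s Ss) (fun s' h => tS s' (mem_rem h)).
have h0 Q' : Q' \in Qs -> (size Qs <= count (absorbs T G Q') (rem s Ss))%N.
  move=> QQ; have := hQ Q'; rewrite inE QQ orbT => /(_ isT) /=.
  by rewrite (permP p) /=; case: (absorbs _ _ _ _);
    rewrite ?add1n ?ltnS // add0n => /ltnW.
move=> /(_ h0) h; apply: tiled_perm (tiled_cat ts h).
rewrite -!catA perm_cat2l perm_sym;
  apply: perm_trans (_ : perm_eq _ (flatten Qs ++ (s ++ flatten (rem s Ss)))) _.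
  by rewrite perm_cat2l.
by rewrite perm_catCA.
Qed.

(** An absorber consists of a copy [z] and of [u], which exchanges [Q] for [z] entry by entry.
    Without [Q], [u] is tiled together with [z]; with [Q], it is tiled together with [Q], and [z] on
    its own. *)
Lemma reach_absorbers (R : realType) (VT V : finType) (T : rel VT) (G : rel V)
    (t : nat) (d : R) (Q : seq V) :
  (forall x y, reach T G d t x y) -> manyk d #|VT| (tiled T G) -> size Q = #|VT| ->
  manyk d (#|VT| + #|VT| * (t * #|VT|).-1)
    (fun s => tiled T G s /\ tiled T G (Q ++ s)).
Proof.
move=> hr mt sQ.
pose P z u := tiled T G (Q ++ u) /\ tiled T G (z ++ u).
apply: manyk_le (manyk_cat (Q := P) mt _) => //.
  move=> s _ [z [u [-> sz tz [t1 t2]]]]; split=> //.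
  by apply: tiled_perm (tiled_cat t1 tz); rewrite -catA perm_cat2l perm_catC.
move=> z sz tz; rewrite -{1}sQ; apply: reach_zip; first by rewrite sQ.
by move=> p _; apply: hr.
Qed.

(** The product of [(1 - a) ^+ L] and [(1 + a) ^+ L] is at most 1, and Bernoulli's inequality makes
    the second factor at least 2. *)
Lemma half_power (R : realType) (a : R) : 0 < a -> a <= 1 ->
  exists L, (1 - a) ^+ L <= 1 / 2.
Proof.
move=> a0 a1; pose L := (Num.trunc (1 / a)).+1; exists L.
have La : 1 <= L%:R * a by rewrite -ler_pdivrMr // ltW // truncnS_gt.
have bern k : 1 + k%:R * a <= (1 + a) ^+ k.
  elim: k => [|k IH]; first by rewrite mul0r addr0 expr0.
  have a10 : 0 <= 1 + a by move: a0; lra.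
  rewrite exprS; apply: le_trans (ler_wpM2l a10 IH); rewrite -natr1.
  have : 0 <= k%:R * (a * a) by rewrite mulr_ge0 // mulr_ge0 // ltW.
  by lra.
have h1 : (1 - a) ^+ L * (1 + a) ^+ L <= 1.
  rewrite -exprMn exprn_ile1 //.
    by rewrite mulr_ge0; move: a0 a1; lra.
  by have : 0 <= a * a; [rewrite mulr_ge0 // ltW | lra].
have h2 : (1 - a) ^+ L * 2 <= (1 - a) ^+ L * (1 + a) ^+ L.
  rewrite ler_wpM2l ?exprn_ge0 //; first by move: a1; lra.
  by apply: le_trans (bern L); move: La; lra.
by move: h1 h2; lra.
Qed.

Lemma square_le_expn j : (j ^ 2 <= 4 * 2 ^ j)%N.
Proof.
have [|j3] := leqP j 3; first by case: j => [|[|[|[|]]]].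
rewrite -(subnKC j3); elim: (j - 4)%N => // i IH.
rewrite addnS [(2 ^ _.+1)%N]expnS -mulnn; move: IH; rewrite -mulnn.
by move: (2 ^ _)%N => E; nia.
Qed.

(** After squaring, the left side is at most [4 * n], and [xi ^+ 4 * n >= 4] follows from the two
    conditions on [xi]. *)
Lemma log_small (R : realType) (xi : R) n : 0 < xi -> 4 * xi <= 1 ->
  xi ^- 5 <= n%:R -> (trunc_log 2 n)%:R <= xi ^+ 2 * n%:R.
Proof.
move=> xi0 xi1 hn; have n0R : 0 < n%:R :> R by apply: lt_le_trans hn;
  rewrite invr_gt0 exprn_gt0.
have n0 : (0 < n)%N by rewrite -(ltr0n R).
set j := trunc_log 2 n.
have h1 : j%:R ^+ 2 <= 4 * n%:R :> R.
  rewrite -natrX -natrM ler_nat; apply: leq_trans (square_le_expn j) _.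
  by rewrite leq_mul2l /= trunc_logP.
have h2 : 1 <= xi ^+ 5 * n%:R by rewrite -ler_pdivrMl ?exprn_gt0 // mulr1.
have h3 : 4 * n%:R <= (xi ^+ 2 * n%:R) ^+ 2.
  have -> : (xi ^+ 2 * n%:R) ^+ 2 = xi ^+ 4 * n%:R * n%:R by ring.
  rewrite ler_pM2r //; have : 4 * (xi ^+ 5 * n%:R) <= xi ^+ 4 * n%:R.
    have -> : 4 * (xi ^+ 5 * n%:R) = 4 * xi * (xi ^+ 4 * n%:R) by ring.
    by rewrite ler_piMl // mulr_ge0 // ?exprn_ge0 // ltW.
  by move: h2; lra.
rewrite -(@ler_pXn2r _ 2) ?nnegrE //; first exact: le_trans h1 h3.
by rewrite mulr_ge0 // ?exprn_ge0 // ltW.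
Qed.

Lemma absorbing_set (R : realType) r t (d : R) : (0 < r)%N -> 0 < d ->
  exists2 c : R, 0 < c &
  forall (xi : R) (VT V : finType) (T : rel VT) (G : rel V),
    0 < xi -> xi <= c -> #|VT| = r -> manyk d r (tiled T G) ->
    (forall x y, reach T G d t x y) -> xi ^- 5 <= #|V|%:R ->
    exists M : {set V}, #|M|%:R <= xi * #|V|%:R /\
      forall W : {set V}, W \subset ~: M -> (r %| #|W|)%N ->
        #|W|%:R <= xi ^+ 2 * #|V|%:R -> absorbing T G M W.
Proof.
move=> r0 d0; pose k := (r + r * (t * r).-1)%N.
have k0 : (0 < k)%N by rewrite addn_gt0 r0.
pose d' := Num.min d 1.
have d'0 : 0 < d' by rewrite lt_min d0 ltr01.
have d'1 : d' <= 1 by rewrite ge_min lexx orbT.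
have d'd : d' <= d by rewrite ge_min lexx.
pose eta := (d' / 2) ^+ k.
have eta0 : 0 < eta by rewrite exprn_gt0 // divr_gt0.
have eta1 : eta <= 1 by rewrite exprn_ile1 // ?divr_ge0 ?ltW //; move: d'1 d'0; lra.
have e20 : 0 < eta / 2 by rewrite divr_gt0.
have e21 : eta / 2 <= 1 by move: eta1 eta0; clear; lra.
have [L hL] := half_power e20 e21.
(* The first summand turns a size bound of order [xi ^+ 2 * n] into [xi * n]; the 4 provides
   [4 * xi <= 1] for [log_small]. *)
pose A : R := 2 * (k * (L * (2 * r + 3) + 1))%:R + 4.
have A0 : 0 < A by rewrite ltr_wpDl // mulr_ge0.
exists (Num.min A^-1 (d' / 2)); first by rewrite lt_min invr_gt0 A0 divr_gt0.
move=> xi VT V T G xi0; rewrite le_min => /andP[xiA xid] VTr mt hr hn.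
set n := #|V| in hn *.
have xiA1 : xi * A <= 1 by rewrite -ler_pdivlMr // div1r.
have n0R : 0 < n%:R :> R by apply: lt_le_trans hn; rewrite invr_gt0 exprn_gt0.
have n0 : (0 < n)%N by rewrite -(ltr0n R).
pose S : R := (k * (L * (2 * r + 3) + 1))%:R.
have S0 : 0 <= S by rewrite ler0n.
have xiS : xi * S * 2 + xi * 4 <= 1 by move: xiA1; rewrite /A -/S; clear; lra.
have xi4 : 4 * xi <= 1.
  have := mulr_ge0 (ltW xi0) S0; move: xiS; clear; lra.
pose H := (Num.trunc (xi ^+ 2 * n%:R)).+1.
pose j := (trunc_log 2 n).+1.
have x2n : 0 <= xi ^+ 2 * n%:R by rewrite mulr_ge0 // exprn_ge0 // ltW.
have hH : xi ^+ 2 * n%:R <= H%:R by rewrite ltW // truncnS_gt.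
have H_le : H%:R <= xi ^+ 2 * n%:R + 1.
  by rewrite /H -natr1 lerD2r truncn_le.
have j_le : j%:R <= xi ^+ 2 * n%:R + 1.
  by rewrite /j -natr1 lerD2r; apply: log_small.
(* Every [L] choices halve the potential, which starts at [n ^ r], at most [2 ^ (r * j)]. After [N]
   choices it is below [2 ^- H], so every tuple has at least [H] absorbers, and [H] exceeds the
   number of tuples that [W] is cut into. *)
pose N := (L * (H + r * j + 1))%N.
have X1 : 1 <= xi ^+ 2 * n%:R.
  have : 1 <= xi ^+ 5 * n%:R by rewrite -ler_pdivrMl ?exprn_gt0 // mulr1.
  have -> : xi ^+ 5 * n%:R = xi ^+ 3 * (xi ^+ 2 * n%:R) by ring.
  move=> h; apply: le_trans h _; rewrite ler_piMl // exprn_ile1 // ?ltW //.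
  by move: xi4 xi0; clear; lra.
have kN : k%:R * (N%:R + 1) <= xi * n%:R.
  have Nle : N%:R <= L%:R * ((r%:R + 1) * (xi ^+ 2 * n%:R + 1) + 1).
    rewrite /N natrM ler_wpM2l // !natrD natrM.
    have : r%:R * j%:R <= r%:R * (xi ^+ 2 * n%:R + 1) by rewrite ler_wpM2l.
    by move: H_le; clear; lra.
  have h1 : k%:R * (N%:R + 1) <= S * 2 * (xi ^+ 2 * n%:R).
    move: X1 Nle; set X := xi ^+ 2 * n%:R => X1 Nle.
    have h0 : L%:R * ((r%:R + 1) * (X + 1) + 1) + 1 <= (L%:R * (2 * r%:R + 3) + 1)
      * 2 * X.
      have hL0 : 0 <= L%:R * (X - 1) by rewrite mulr_ge0 // subr_ge0.
      have hLr : 0 <= L%:R * r%:R * (X - 1)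
        by rewrite mulr_ge0 // ?subr_ge0 // mulr_ge0.
      have hLX : 0 <= L%:R * r%:R * X by rewrite mulr_ge0 // ?mulr_ge0 //;
        move: X1; clear; lra.
      have hLX' : 0 <= L%:R * X by rewrite mulr_ge0 //; move: X1; clear; lra.
      by move: hL0 hLr hLX hLX' X1; clear; lra.
    have -> : S * 2 * X = k%:R * ((L%:R * (2 * r%:R + 3) + 1) * 2 * X).
      by rewrite /S natrM natrD natrM natrD natrM; ring.
    by rewrite ler_wpM2l //; move: h0 Nle; clear; lra.
  apply: le_trans h1 _.
  have -> : S * 2 * (xi ^+ 2 * n%:R) = (xi * S * 2) * (xi * n%:R) by ring.
  rewrite ler_piMl //; first by rewrite mulr_ge0 // ltW.
  by move: xiS xi0; clear; lra.
have hr' : forall Q : r.-tuple V,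
    manyk d' k (fun s => tiled T G s /\ tiled T G (Q ++ s)).
  move=> Q; have sQ : size Q = #|VT| by rewrite size_tuple VTr.
  have mtT : manyk d #|VT| (tiled T G) by rewrite VTr.
  have := reach_absorbers hr mtT sQ; rewrite VTr; exact: manyk_le.
have [|Ss [sz us ts pot]] := selection n0 d'0 d'1 hr' (N := N).
  by rewrite ler_pdivrMr //; apply: le_trans kN _; rewrite ler_pM2r.
exists [set x in flatten Ss]; split.
  rewrite cardsE (card_uniqP us) sz natrM; apply: le_trans kN.
  by rewrite ler_wpM2l // lerDl.
have hits (Q : r.-tuple V) : (H <= count (absorbs T G Q) Ss)%N.
  rewrite leqNgt; apply/negP => lt.
  have h1 : (1 / 2 : R) ^+ H <= potential R T G r Ss.
    apply: le_trans (_ : (1 / 2) ^+ count (absorbs T G Q) Ss <= _).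
      by rewrite ler_wiXn2l ?divr_ge0 // 1?ltnW // ler_pdivrMr // mul1r ler1n.
    rewrite /potential (bigD1 Q) //= lerDl sumr_ge0 // => Q' _.
    by rewrite exprn_ge0 // divr_ge0.
  have h2 : (n ^ r)%:R <= (2 : R) ^+ (r * j).
    rewrite -natrX ler_nat mulnC expnM leq_exp2r //.
    by rewrite ltnW // trunc_log_ltn.
  have h3 : (1 - eta / 2) ^+ N <= (1 / 2) ^+ (H + r * j + 1).
    rewrite /N exprM; apply: lerXn2r => //; rewrite nnegrE ?exprn_ge0 //; lra.
  have : potential R T G r Ss <= (1 / 2) ^+ (H + r * j + 1) * 2 ^+ (r * j).
    apply: le_trans pot _; apply: ler_pM => //; rewrite exprn_ge0 //.
    by move: e21; rewrite /eta; clear; lra.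
  have h4 : (1 / 2 : R) ^+ (r * j) * 2 ^+ (r * j) = 1.
    by rewrite -exprMn (_ : 1 / 2 * 2 = 1) ?expr1n //; field.
  have -> : (1 / 2 : R) ^+ (H + r * j + 1) * 2 ^+ (r * j) = (1 / 2) ^+ H * (1 / 2).
    rewrite !exprD expr1.
    transitivity ((1 / 2 : R) ^+ H * (1 / 2) * ((1 / 2) ^+ (r * j) * 2 ^+ (r *
      j))); first by ring.
    by rewrite h4 mulr1.
  have h5 : 0 < (1 / 2 : R) ^+ H by rewrite exprn_gt0 // divr_gt0.
  by move: h1 h5; clear; lra.
move=> W sW rW Wl; have [l lW] : exists l, #|W| = (l * r)%N
  by case/dvdnP: rW => l ->; exists l.
pose Qs := reshape (nseq l r) (enum W).
have sumW : sumn (nseq l r) = size (enum W) by rewrite sumn_nseq -cardE lW mulnC.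
have fW : flatten Qs = enum W by rewrite reshapeKr // sumW.
have hQ Q : Q \in Qs -> (size Qs <= count (absorbs T G Q) Ss)%N.
  move=> QQ; have sQ : size Q = r.
    have : size Q \in shape Qs by rewrite /shape map_f.
    by rewrite reshapeKl ?sumW // mem_nseq => /andP[_ /eqP].
  have := hits (tcast sQ (in_tuple Q)); rewrite val_tcast /= => h.
  apply: leq_trans h; rewrite size_reshape size_nseq.
  apply: leq_trans (_ : (#|W| <= _)%N); first by rewrite lW leq_pmulr.
  by rewrite -(ler_nat R); apply: le_trans Wl hH.
have tall := absorb_all ts hQ; rewrite fW in tall.
have tS := absorb_all (Qs := [::]) ts (fun Q h => False_ind _ (notF h)).
split; first exact: tiled_packing.
have -> : [set x in flatten Ss] :|: W = [set x in enum W ++ flatten Ss].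
  by apply/setP=> x; rewrite !inE mem_cat mem_enum orbC.
apply: tiled_packing tall; rewrite cat_uniq enum_uniq us andbT; apply/hasPn => x xS.
apply/negP; rewrite /= mem_enum => /(subsetP sW); rewrite !inE.
by rewrite xS.
Qed.

Lemma absorbing_core (R : realType) r (m : R) : (3 <= r)%N -> 0 < m -> m <= r%:R^-1 ->
  exists2 c : R, 0 < c &
  forall (xi eps : R) (VT V : finType) (T : rel VT) (G : rel V),
    0 < xi -> xi <= c -> xi <= 1 -> 0 <= eps -> eps <= xi -> xi ^- 5 <= #|V|%:R ->
    #|VT| = r -> tournament T -> irreflexive G ->
    (1 - r%:R^-1 - eps) * #|V|%:R <= (min_semidegree G)%:R ->
    ~ (exists S : {set V}, #|V|%:R / r%:R <= #|S|%:R :> R /\ gamma_independent G m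
      S) ->
    (digraph_iso T C3 -> ~ alpha_contains m G (@Ex #|V|)) ->
    exists M : {set V}, #|M|%:R <= xi * #|V|%:R /\
      forall W : {set V}, W \subset ~: M -> (r %| #|W|)%N ->
        #|W|%:R <= xi ^+ 2 * #|V|%:R -> absorbing T G M W.
Proof.
move=> r3 m0 mr; have r0 : (0 < r)%N by apply: leq_trans r3.
have [t [d [d0 [[d_0 d00] reachP]]]] := all_reach r3 m0 mr.
have [c c0 absP] := absorbing_set t r0 d_0.
exists (Num.min c d0); first by rewrite lt_min c0.
move=> xi eps VT V T G xi0; rewrite le_min => /andP[xic xid0] xi1 eps0 epsxi hn VTr
  tT irrG degG no noEx.
have n0R : 0 < #|V|%:R :> R by apply: lt_le_trans hn; rewrite invr_gt0 exprn_gt0.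
have n0 : (0 < #|V|)%N by rewrite -(ltr0n R).
have deg x : (min_semidegree G <= minn (outdegree G x) (indegree G x))%N.
  rewrite /min_semidegree; have := mem_index_enum x;
    elim: (index_enum V) => // y s IH.
  rewrite inE big_cons => /predU1P[->|/IH h]; first exact: geq_minl.
  exact: leq_trans (geq_minr _ _) h.
have codeg (E : rel V) x : (min_semidegree G <= #|out E x|)%N ->
  dens R (~: out E x) <= r%:R^-1 + eps.
  rewrite -(ler_nat R) => h; rewrite /dens ler_pdivrMr //.
  have e : #|out E x|%:R + #|~: out E x|%:R = #|V|%:R :> R by rewrite -natrD cardsC.
  by move: degG h e; clear; lra.
have vn : #|V|%:R^-1 <= d0.
  apply: le_trans xid0; rewrite invf_ple ?posrE //; apply: le_trans hn.
  by rewrite lef_pV2 ?posrE ?exprn_gt0 // exprS ler_piMr ?exprn_ile1 // ltW.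
have [||mt hr] := reachP VT V T G eps VTr tT n0 irrG _ no noEx _ vn.
- move=> x; have := deg x; rewrite leq_min => /andP[h1 h2].
  by split; apply: codeg.
- by rewrite eps0; apply: le_trans epsxi xid0.
exact: absP mt hr hn.
Qed.

(** * Hierarchy functions from constants with discrete parameters *)

Fixpoint running_min (R : realType) (f : nat -> R) k : R :=
  if k is k'.+1 then Num.min (f k) (running_min f k') else Num.min 1 (f 0%N).

Lemma running_min_gt0 (R : realType) (f : nat -> R) k :
  (forall i, 0 < f i) -> 0 < running_min f k.
Proof. by move=> f0; elim: k => [|k IH] /=; rewrite lt_min f0 ?ltr01. Qed.

Lemma running_min_le (R : realType) (f : nat -> R) i k :
  (i <= k)%N -> running_min f k <= running_min f i.
Proof.
move=> /subnK <-; elim: (k - i)%N => // j IH.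
by rewrite addSn /= ge_min IH orbT.
Qed.

Lemma running_min_leE (R : realType) (f : nat -> R) i k :
  (i <= k)%N -> running_min f k <= f i.
Proof.
move=> /running_min_le h; apply: le_trans (h _ f) _.
by case: i {h} => [|i] /=; rewrite ge_min lexx ?orbT.
Qed.

Lemma running_min_le1 (R : realType) (f : nat -> R) k : running_min f k <= 1.
Proof.
by apply: le_trans (running_min_le f (leq0n k)) _; rewrite /= ge_min lexx.
Qed.

(** An integer above [x^-1]: the real parameter [x] is replaced by the slightly smaller reciprocal
    of an integer, for which a constant can be tabulated. *)
Definition scale (R : realType) (x : R) : nat := (Num.trunc x^-1).+1.

Lemma scale_homo (R : realType) (x y : R) : 0 < x -> x < y -> (scale y <= scale x)%N.
Proof.
move=> x0 xy; rewrite ltnS; apply: le_truncn.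
by rewrite lef_pV2 ?posrE ?ltW // (lt_trans x0).
Qed.

Lemma scale_lt (R : realType) (x : R) : 0 < x -> (scale x)%:R^-1 < x.
Proof. by move=> x0; rewrite invf_plt ?posrE ?ltr0n // truncnS_gt. Qed.

Lemma hierarchy_id (R : realType) : hierarchy_fun (fun x : R => x).
Proof. by split=> // x; rewrite posrE. Qed.

Lemma hierarchy_exp (R : realType) k : hierarchy_fun (fun x : R => x ^+ k.+1).
Proof.
split=> [x|x y]; rewrite posrE; first by move=> x0; rewrite exprn_gt0.
by move=> /[!posrE] x0 y0 xy; rewrite ltr_pXn2r // nnegrE ltW.
Qed.

(** The running minimum at [scale x] is only weakly increasing in [x]; the factor [x] makes the
    product strictly increasing. *)
Lemma hierarchy_scale (R : realType) (f : nat -> R) : (forall i, 0 < f i) ->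
  hierarchy_fun (fun x => x * running_min f (scale x)).
Proof.
move=> f0; split=> [x|x y]; rewrite !posrE.
  by move=> x0; rewrite mulr_gt0 // running_min_gt0.
move=> x0 y0 xy; apply: lt_le_trans (_ : y * running_min f (scale x) <= _).
  by rewrite ltr_pM2r // running_min_gt0.
by rewrite ler_pM2l // running_min_le // scale_homo.
Qed.

Theorem theorem5p1 (R : realType) :
  exists f1 f2 f3 f4 : R -> R,
    [/\ hierarchy_fun f1, hierarchy_fun f2, hierarchy_fun f3
      & hierarchy_fun f4] /\
    forall (n r : nat) (eps xi gamma alpha : R),
      (0 < n)%N -> (3 <= r)%N ->
      0 < eps -> 0 < xi -> 0 < gamma -> 0 < alpha ->
      gamma <= f1 r%:R^-1 -> alpha <= f1 r%:R^-1 ->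
      xi <= f2 gamma -> xi <= f2 alpha ->
      eps <= f3 xi ->
      n%:R^-1 <= f4 eps ->
    forall (VT : finType) (T : rel VT),
      #|VT| = r -> tournament T ->
    forall (V : finType) (G : rel V),
      #|V| = n -> irreflexive G ->
      (1 - r%:R^-1 - eps) * n%:R <= (min_semidegree G)%:R ->
      ~ (exists S : {set V},
           n%:R / r%:R <= #|S|%:R :> R /\ gamma_independent G gamma S) ->
      (digraph_iso T C3 -> ~ alpha_contains alpha G (@Ex n)) ->
    exists M : {set V},
      #|M|%:R <= xi * n%:R /\
      forall W : {set V},
        W \subset ~: M -> (r %| #|W|)%N -> #|W|%:R <= xi ^+ 2 * n%:R ->
        absorbing T G M W.
Proof.
pose P (r k : nat) (c : R) := 0 < c /\ forall (m : R), m = k%:R^-1 ->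
  (3 <= r <= k)%N -> 
  forall (xi eps : R) (VT V : finType) (T : rel VT) (G : rel V),
    0 < xi -> xi <= c -> xi <= 1 -> 0 <= eps -> eps <= xi -> xi ^- 5 <= #|V|%:R ->
    #|VT| = r -> tournament T -> irreflexive G ->
    (1 - r%:R^-1 - eps) * #|V|%:R <= (min_semidegree G)%:R ->
    ~ (exists S : {set V}, #|V|%:R / r%:R <= #|S|%:R :> R /\ gamma_independent G m
      S) ->
    (digraph_iso T C3 -> ~ alpha_contains m G (@Ex #|V|)) ->
    exists M : {set V}, #|M|%:R <= xi * #|V|%:R /\
      forall W : {set V}, W \subset ~: M -> (r %| #|W|)%N ->
        #|W|%:R <= xi ^+ 2 * #|V|%:R -> absorbing T G M W.
have exP (p : nat * nat) : exists c, P p.1 p.2 c.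
  case: p => r k /=; have [/andP[r3 rk]|nrk] := boolP (3 <= r <= k)%N; last first.
    by exists 1; split=> // m _ h; rewrite h in nrk.
  have k0 : (0 < k)%N by apply: leq_trans rk; apply: leq_trans r3.
  have m0 : 0 < k%:R^-1 :> R by rewrite invr_gt0 ltr0n.
  have mr : k%:R^-1 <= r%:R^-1 :> R.
    by rewrite lef_pV2 ?posrE ?ltr0n ?ler_nat //; apply: leq_trans r3.
  have [c c0 hc] := absorbing_core r3 m0 mr.
  by exists c; split=> // m -> _.
have [c cP] := choice exP.
(* The second hierarchy function sees only [gamma] or [alpha], not [r]. As both are at most
   [r%:R^-1], the integer [k] is at least [r], so a minimum over all [r <= k] covers the actual
   one. *)
pose g k := running_min (fun r => c (r, k)) k.
have g0 k : 0 < g k by apply: running_min_gt0 => r; have [] := cP (r, k).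
exists (fun x => x), (fun x => x * running_min g (scale x)), (fun x => x),
  (fun x => x ^+ 5); split.
  by split; [exact: hierarchy_id | exact: hierarchy_scale | exact: hierarchy_id
    | exact: hierarchy_exp].
move=> n r eps xi gamma alpha n0 r3 eps0 xi0 ga0 al0 gar alr xiga xial epsxi neps.
move=> VT T VTr tT V G Vn irrG degG no noEx.
(* Both structural hypotheses are used at the single value [k%:R^-1], which lies below [gamma] and
   below [alpha]. *)
pose m := Num.min gamma alpha.
have m0 : 0 < m by rewrite lt_min ga0.
have mr : m <= r%:R^-1 by rewrite ge_min gar.
have xim : xi <= m * running_min g (scale m) by rewrite /m; case: (leP gamma alpha).
pose k := scale m; have km : k%:R^-1 < m := scale_lt m0.
have r0R : 0 < r%:R :> R by rewrite ltr0n; apply: leq_trans r3.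
have rk : (r <= k)%N.
  rewrite -(ler_nat R) -lef_pV2 ?posrE ?ltr0n //; last exact: leq_trans r3.
  by apply: le_trans (ltW km) mr.
have m1 : m <= 1.
  by apply: le_trans mr _; rewrite invf_le1 // ler1n; apply: leq_trans r3.
have rg0 : 0 < running_min g (scale m) by apply: running_min_gt0.
have xig : xi <= running_min g k by apply: le_trans xim _; rewrite ler_piMl // ltW.
have xi1 : xi <= 1 by apply: le_trans xig (running_min_le1 _ _).
have xic : xi <= c (r, k).
  apply: le_trans xig _; apply: le_trans (running_min_leE g (leqnn k)) _.
  exact: (running_min_leE (fun r => c (r, k)) rk).
have [_ hc] := cP (r, k).
have hn : xi ^- 5 <= n%:R.
  rewrite invf_ple ?posrE ?exprn_gt0 ?ltr0n //; apply: le_trans neps _.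
  by rewrite lerXn2r // nnegrE ltW.
have := hc _ erefl (introT andP (conj r3 rk)) xi eps VT V T G xi0 xic xi1 (ltW
  eps0) epsxi.
rewrite Vn; apply=> //.
  move=> [S [h1 h2]]; apply: no; exists S; split=> //; apply: le_trans h2 _.
  rewrite ler_wpM2r ?exprn_ge0 //; apply: le_trans (ltW km) _.
  by rewrite ge_min lexx.
move=> iso [G' h1 h2]; apply: (noEx iso); exists G' => //; apply: le_trans h2 _.
rewrite ler_wpM2r ?exprn_ge0 //; apply: le_trans (ltW km) _.
by rewrite ge_min lexx orbT.
Qed.
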